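(* Let $T_C$ be the countable coloured tree with no least element obtained from a countable chain $C$ with no least element, in which all non-maximal nodes ramify infinitely, and let $\mathcal C$ be the family of finite trees of $B$-sets over $T_C$, with embeddings being strong embeddings. Then there is a unique (up to isomorphism) countable tree of $B$-sets $A$ such that (i) every finite tree of $B$-sets which is a strong substructure of $A$ lies in $\mathcal C$; (ii) $A$ is a union of a chain of members of $\mathcal C$; (iii) every member of $\mathcal C$ embeds strongly into $A$; (iv) if $B$ and $E$ are members of $\mathcal C$ such that $B$ is a strong substructure of $E$, then any strong embedding of $B$ into $A$ extends to a strong embedding of $E$ into $A$; (v) every isomorphism between finite strong substructures of $A$ extends to an automorphism of $A$.
   Context: $B$-sets. A $B$-relation on a non-empty set $X$ is a ternary relation $B(x;y,z)$ such that: (B1) $B(x;y,z)\to B(x;z,y)$; (B2) $B(x;y,z)\wedge B(y;x,z)\leftrightarrow x=y$; (B3) $B(x;y,z)\to B(x;y,w)\vee B(x;w,z)$. Then $(X,B)$ is a $B$-set. It is of positive type if for any $x,y,z$ for which $B$ does not hold in any order there is $u$ (the centroid) with $B(u;x,y)$, $B(u;x,z)$, $B(u;y,z)$. The branches at $a\in X$ are the classes of the equivalence relation $\neg B(a;y,z)$ on $X\setminus\{a\}$; $a$ is a ramification point if there are at least 3 branches at $a$. Trees. A semilinear order is a partial order $(T,\le)$ such that each $\{y:y\le x\}$ is linearly ordered and any two elements have a common lower bound. If $t\in T$, the cones at $t$ are the classes of $\{x:x>t\}$ under: $x\sim y$ iff there is $z>t$ with $z\le x$ and $z\le y$; their number is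 the ramification order of $t$; $t$ ramifies if this is greater than 1. A $C$-colouring of $T$ is a map $F:T\to C$ with $s<t\Rightarrow F(s)<F(t)$; a $C$-chain is a chain in $T$ on which all members of $C$ arise as colours. $T_C$ is the countable $C$-coloured semilinearly ordered meet semilattice, unique up to isomorphism, in which every non-maximal point has ramification order $\aleph_0$ and every point lies in a $C$-chain. Trees of $B$-sets. A tree of $B$-sets $A$ consists of a (possibly coloured) semilinear order $T=T^A$ which is a lower semilattice; for each $t\in T$ a $B$-set $(B(t),B_t)$ of positive type; and functions $f_t$ ($t\in T$), $g_{st}$ ($s\le t$) such that: $f_t$ is a surjection from $\{s\in T:t<s\}$ to the set of ramification points of $B(t)$ with $f_t(s_1)=f_t(s_2)$ iff $s_1,s_2$ lie in the same cone at $t$; $g_{ss}$ is the identity on $B(s)$; if $s<t$, $g_{st}$ is a surjection from $B(s)\setminus\bigcup_{s\le u<t}g_{su}^{-1}(f_u(t))$ to $B(t)$, and $g_{st}(x)=g_{st}(y)$ iff for some $u$ with $s\le u<t$, $g_{su}(x)$ and $g_{su}(y)$ lie in the same branch of $B_u$ at $f_u(t)$; and $g_{su}=g_{tu}\circ g_{st}$ for $s\le t\le u$. A finite tree of $B$-sets over $T_C$ is a tree of $B$-sets whose underlying tree $T^A$ is a finite meet-closed subtree of $T_C$, with inherited order and colours, with a root and with all non-leaf vertices of $T^A$ ramifying (in $T^A$), and all of whose $B(t)$ are finite. Strong embeddings. For $B$-sets of positive type, $(X_1,B_1)$ is a strong substructure of $(X_2,B_2)$ if $X_1\subseteq X_2$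 and $B_1$ is the restriction of $B_2$ to $X_1$; a strong embedding of $B$-sets is an isomorphism onto a strong substructure. A strong embedding of a tree of $B$-sets $A_1$ into $A_2$ over the same ambient tree consists of a tree embedding $\tau:T^{A_1}\to T^{A_2}$ (preserving colours, $<$ and meets), and strong $B$-set embeddings $\varphi_t:B(t)\to B(\tau(t))$ for $t\in T^{A_1}$ such that $\varphi_t f_t=f_{\tau(t)}\tau$ for each $t$, and $g_{\tau(s)\tau(t)}\varphi_s=\varphi_t g_{st}$ for $s\le t$. $A_1$ is a strong substructure of $A_2$ if it is a substructure and the inclusions ($\tau$ and all $\varphi_t$ being inclusion) form a strong embedding. Isomorphisms are strong embeddings for which $\tau$ and all $\varphi_t$ are bijections; an automorphism is an isomorphism from $A$ to itself. *)

(* Defs.v *)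
From HB Require Import structures.
From mathcomp Require Import all_boot all_order.
From mathcomp Require Import boolp classical_sets functions cardinality.

Set Implicit Arguments.
Unset Strict Implicit.
Unset Printing Implicit Defensive.

Import Order.TTheory.

Local Open Scope classical_set_scope.
Local Open Scope card_scope.
Local Open Scope order_scope.

(* [Brel x y z] stands for B(x;y,z). *)
Record Bset := MkBset {
  point :> Type;
  Brel : point -> point -> point -> Prop;
  Bset_inhabited : inhabited point;
  Brel_sym : forall x y z, Brel x y z -> Brel x z y;
  Brel_eq : forall x y z, Brel x y z /\ Brel y x z <-> x = y;
  Brel_split : forall x y z w, Brel x y z -> Brel x y w \/ Brel x w z }.

(* By [Brel_sym], the three negations cover all orders of x, y, z. *)
Definition positive_type (X : Bset) : Prop :=
  forall x y z : X, ~ Brel x y z -> ~ Brel y x z -> ~ Brel z x y ->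
    exists u : X, [/\ Brel u x y, Brel u x z & Brel u y z].

Definition same_branch (X : Bset) (a y z : X) : Prop :=
  [/\ y <> a, z <> a & ~ Brel a y z].

Definition branches (X : Bset) (a : X) : set (set X) :=
  [set K | exists2 y, y <> a & K = [set z | same_branch a y z]].

Definition ramification_point (X : Bset) (a : X) : Prop :=
  exists K1 K2 K3, [/\ branches a K1, branches a K2 & branches a K3] /\
    [/\ K1 <> K2, K1 <> K3 & K2 <> K3].

Definition strong_Bset_embedding (X Y : Bset) (phi : X -> Y) : Prop :=
  injective phi /\
  forall x y z : X, Brel (phi x) (phi y) (phi z) <-> Brel x y z.

Section Trees.
Context {d : Order.disp_t} {T : porderType d}.
Implicit Types s t x y : T.

Definition semilinear : Prop :=
  (forall x y z : T, y <= x -> z <= x -> y >=< z) /\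
  (forall x y : T, exists z : T, z <= x /\ z <= y).

Definition same_cone t x y : Prop := exists z, [/\ t < z, z <= x & z <= y].

Definition cones t : set (set T) :=
  [set K | exists2 x, t < x & K = [set y | same_cone t x y]].

Definition ramifies t : Prop :=
  exists K1 K2, [/\ cones t K1, cones t K2 & K1 <> K2].

Definition maximal t : Prop := ~ exists s, t < s.

Context {d' : Order.disp_t} {C : orderType d'}.

Definition colouring (F : T -> C) : Prop := forall s t, s < t -> F s < F t.

Definition colour_chain (F : T -> C) (S : set T) : Prop :=
  (forall x y, S x -> S y -> x >=< y) /\ (forall c, exists2 x, S x & F x = c).

End Trees.

Arguments semilinear {d} T.

(* The empty tree would satisfy every other clause for any C; the uniqueness of
   T_C presupposes that trees are non-empty. *)
Record is_TC {d d' : Order.disp_t} {C : orderType d}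
    {T : meetSemilatticeType d'} (F : T -> C) : Prop := {
  TC_inhabited : inhabited T;
  TC_countable : countable [set: T];
  TC_semilinear : semilinear T;
  TC_colouring : colouring F;
  TC_ramification : forall t : T, ~ maximal t -> cones t #= [set: nat];
  TC_chain : forall t : T, exists2 S : set T, colour_chain F S & S t }.

(* [tbf t s] is f_t(s); its value is irrelevant unless [t < s].
   [tbg s t] is the partial function g_{st}, with [None] for undefined; its
   values are irrelevant unless [s <= t]. *)
Record tree_of_Bsets {d : Order.disp_t} (C : orderType d) := MkTreeOfBsets {
  tb_disp : Order.disp_t;
  node : meetSemilatticeType tb_disp;
  node_semilinear : semilinear node;
  colour : node -> C;
  colourP : colouring colour;
  tbB : node -> Bset;
  tbB_positive : forall t, positive_type (tbB t);
  tbf : forall t : node, node -> tbB t;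
  tbf_ramification : forall t s, t < s -> ramification_point (tbf t s);
  tbf_surj : forall t (a : tbB t), ramification_point a ->
    exists2 s, t < s & tbf t s = a;
  tbf_eq : forall t s1 s2, t < s1 -> t < s2 ->
    (tbf t s1 = tbf t s2 <-> same_cone t s1 s2);
  tbg : forall s t : node, tbB s -> option (tbB t);
  tbg_id : forall s (x : tbB s), @tbg s s x = Some x;
  tbg_dom : forall s t (x : tbB s), s < t ->
    (@tbg s t x = None <->
     exists u, [/\ s <= u, u < t & @tbg s u x = Some (tbf u t)]);
  tbg_surj : forall s t (a : tbB t), s < t -> exists x, @tbg s t x = Some a;
  tbg_eq : forall s t (x y : tbB s) (a b : tbB t), s < t ->
    @tbg s t x = Some a -> @tbg s t y = Some b ->
    (a = b <-> exists u (x' y' : tbB u),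
       [/\ s <= u /\ u < t, @tbg s u x = Some x', @tbg s u y = Some y' &
           same_branch (tbf u t) x' y']);
  tbg_comp : forall s t u (x : tbB s), s <= t -> t <= u ->
    @tbg s u x = obind (@tbg t u) (@tbg s t x) }.

Arguments node {d C} A : rename.
Arguments colour {d C} A _ : rename.
Arguments tbB {d C A} t : rename.
Arguments tbf {d C A} t s : rename.
Arguments tbg {d C A} s t x : rename.

Definition countable_tb {d : Order.disp_t} {C : orderType d}
    (A : tree_of_Bsets C) : Prop :=
  countable [set: node A] /\ forall t : node A, countable [set: tbB t].

Definition tree_embedding {d d1 d2 : Order.disp_t} {C : orderType d}
    {T1 : meetSemilatticeType d1} {T2 : meetSemilatticeType d2}
    (F1 : T1 -> C) (F2 : T2 -> C) (tau : T1 -> T2) : Prop :=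
  [/\ forall t, F2 (tau t) = F1 t,
      forall s t, s < t -> tau s < tau t &
      forall s t, tau (Order.meet s t) = Order.meet (tau s) (tau t)].

(* The last clause is an equality of partial functions, domains included. *)
Record strong_embedding {d : Order.disp_t} {C : orderType d}
    (A1 A2 : tree_of_Bsets C) := MkStrongEmbedding {
  tau : node A1 -> node A2;
  tauP : tree_embedding (colour A1) (colour A2) tau;
  phi : forall t : node A1, tbB t -> tbB (tau t);
  phiP : forall t, strong_Bset_embedding (@phi t);
  phi_f : forall t s, t < s -> @phi t (tbf t s) = tbf (tau t) (tau s);
  phi_g : forall s t (x : tbB s), s <= t ->
    tbg (tau s) (tau t) (@phi s x) = omap (@phi t) (tbg s t x) }.

Arguments tau {d C A1 A2} h _ : rename.
Arguments phi {d C A1 A2} h t x : rename.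

Section Embeddings.
Context {d : Order.disp_t} {C : orderType d}.
Implicit Types A : tree_of_Bsets C.

(* The action on the disjoint union of the B-sets. *)
Definition phi_tot A1 A2 (h : strong_embedding A1 A2)
    (p : {t : node A1 & tbB t}) : {t : node A2 & tbB t} :=
  existT _ (tau h (projT1 p)) (phi h _ (projT2 p)).

Definition emb_eq A1 A2 (h k : strong_embedding A1 A2) : Prop :=
  tau h =1 tau k /\ phi_tot h =1 phi_tot k.

Definition emb_comp A1 A2 A3 (k : strong_embedding A2 A3)
    (h : strong_embedding A1 A2) : strong_embedding A1 A3.
Proof.
refine (@MkStrongEmbedding d C A1 A3 (fun t => tau k (tau h t)) _
  (fun t x => phi k _ (phi h t x)) _ _ _).
- have [c1 l1 m1] := tauP h; have [c2 l2 m2] := tauP k; split=> [t|s t st|s t].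
  + by rewrite c2 c1.
  + exact/l2/l1.
  + by rewrite m1 m2.
- move=> t; have [i1 b1] := phiP h t; have [i2 b2] := phiP k (tau h t).
  split=> [x y /i2/i1 //|x y z].
  by split=> [/b2/b1 //|/b1/b2].
- by move=> t s ts; rewrite phi_f // phi_f //; case: (tauP h) => _ + _; apply.
- move=> s t x st; rewrite phi_g; first by rewrite phi_g //; case: (tbg s t x).
  case: (tauP h) => _ l _.
  by move: st; rewrite le_eqVlt => /orP[/eqP->|/l/ltW].
Defined.

Definition isomorphism A1 A2 (h : strong_embedding A1 A2) : Prop :=
  bijective (tau h) /\ forall t, bijective (phi h t).

Definition isomorphic A1 A2 : Prop :=
  exists h : strong_embedding A1 A2, isomorphism h.

(* A strong substructure of A is given by its inclusion, a strong embedding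
   into A; this orders the strong substructures of A. *)
Definition sub_strong A A1 A2 (h1 : strong_embedding A1 A)
    (h2 : strong_embedding A2 A) : Prop :=
  exists k : strong_embedding A1 A2, emb_eq (emb_comp h2 k) h1.

Definition union_of_chain (K : tree_of_Bsets C -> Prop) A : Prop :=
  exists (I : Type) (M : I -> tree_of_Bsets C)
         (h : forall i, strong_embedding (M i) A),
    [/\ forall i, K (M i),
        forall i j, sub_strong (h i) (h j) \/ sub_strong (h j) (h i),
        forall t : node A, exists i (s : node (M i)), tau (h i) s = t &
        forall p : {t : node A & tbB t}, exists i q, phi_tot (h i) q = p].

Definition finite_tb A : Prop :=
  [/\ finite_set [set: node A],
      forall t : node A, finite_set [set: tbB t],
      exists r : node A, forall t, r <= t &
      forall t : node A, ~ maximal t -> ramifies t].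

(* The underlying tree is identified with its image, a finite meet-closed
   subtree of T_C with the inherited order and colours. *)
Definition finite_tb_over {d' : Order.disp_t} {T : meetSemilatticeType d'}
    (F : T -> C) A : Prop :=
  finite_tb A /\ exists iota : node A -> T, tree_embedding (colour A) F iota.

Record generic {d' : Order.disp_t} {T : meetSemilatticeType d'}
    (F : T -> C) A : Prop := {
  generic_countable : countable_tb A;
  generic_age : forall M (i : strong_embedding M A),
    finite_tb M -> finite_tb_over F M;
  generic_chain : union_of_chain (finite_tb_over F) A;
  generic_universal : forall M, finite_tb_over F M ->
    inhabited (strong_embedding M A);
  generic_rich : forall M E (i : strong_embedding M E),
    finite_tb_over F M -> finite_tb_over F E ->
    forall h : strong_embedding M A,
    exists k : strong_embedding E A, emb_eq (emb_comp k i) h;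
  generic_homogeneous : forall M N (i : strong_embedding M A)
      (j : strong_embedding N A) (h : strong_embedding M N),
    finite_tb M -> finite_tb N -> isomorphism h ->
    exists2 k : strong_embedding A A,
      isomorphism k & emb_eq (emb_comp k i) (emb_comp j h) }.

End Embeddings.

(* Main.v *)
(** The B-sets of a tree are encoded as quotients of subsets of one set of
    labels, the maps g_st being induced by the identity of labels; then adding a
    single point to some B(t), or a single node, is an explicit operation, and
    every strong extension of finite trees is a composite of such operations.
    The generic tree is the union of a chain of finite trees in which every
    request for a one-step extension is eventually granted; this gives (iv), and
    (iii) by starting from a trivial tree.  Since T_C has chains of all colours
    and infinitely many cones at its non-maximal nodes, every finite coloured
    tree embeds in it, so that being over T_C is no restriction on finite trees.
    Homogeneity and uniqueness follow by back-and-forth. *)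

Require Import Defs.
From HB Require Import structures.
From mathcomp Require Import all_boot all_order.
From mathcomp Require Import boolp classical_sets functions cardinality.

Set Implicit Arguments.
Unset Strict Implicit.
Unset Printing Implicit Defensive.

(** The axioms tie the tree and the $B$-sets together: a point with three branches must carry a cone
    of nodes, and if s is an immediate successor of t, the points of B(s) are the branches of B(t)
    at $f_t(s)$. Adding one point can therefore break the axioms until a node is added as well. This
    is why they are divided: [wptb] survives the addition of any admissible point, whereas [dom2] (a
    label is lost only by being some $f_u(t)$) and [frs] (every ramification point is some $f_t(s)$)
    may fail in one controlled place, which the next node repairs. Strong extensions are not
    decomposed explicitly. A partial embedding of a finite E into the limit L is a finite structure
    embedded in both, and one that misses something of E can always be enlarged ([progress]). This
    uses only four local properties of L, collected in [rich], each of which concerns finitely many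
    labels and can be granted at a finite stage. A new node may also leave some node with a single
    cone, which finite trees of $B$-sets exclude; every stage of the chain is therefore finished off
    by further nodes ([ramify_all]). *)

Definition fin (T : Type) (Q : T -> Prop) : Prop :=
  exists n (e : nat -> option T), forall x, Q x -> exists2 i, (i < n)%N & e i = Some x.

(** Induction on the length of the list: the last entry either lies below the minimum of the others
    and replaces it, or leaves it minimal. Applied to a reversed order it yields maximal
    elements. *)
Lemma fin_min (T : Type) (R : T -> T -> Prop) (Q : T -> Prop) :
  (forall x y z, R x y -> R y z -> R x z) -> (forall x, ~ R x x) ->
  fin Q -> forall x0, Q x0 -> exists2 x, Q x & forall y, Q y -> ~ R y x.
Proof.
move=> Rt Ri [n [e Qe]]; elim: n Q Qe => [|n IH] Q Ql x0 Qx0; first by case: (Ql _ Qx0).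
have [en|en] := pselect (exists2 a, Q a & e n = Some a); last first.
  apply: (IH Q) Qx0 => x Qx; have [i + ei] := Ql _ Qx.
  by rewrite ltnS leq_eqVlt => /orP[/eqP ni|ni]; [case: en; exists x; rewrite -?ni|exists i].
case: en => a Qa ea.
have [[y [Qy ya]]|na] := pselect (exists y, Q y /\ y <> a); last first.
  have e1 z : Q z -> z = a by move=> Qz; apply: contrapT => za; apply: na; exists z.
  by exists a => // z /e1 ->; exact: Ri.
have [z [Qz za]|x [Qx xa] xm] := IH (fun x => Q x /\ x <> a) _ y (conj Qy ya).
  have [i + ei] := Ql _ Qz; rewrite ltnS leq_eqVlt => /orP[/eqP ni|ni]; last by exists i.
  by case: za; move: ei; rewrite ni ea => -[].
have [Rax|n'] := pselect (R a x); last first.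
  exists x => // z Qz Rzx; have [za|za] := pselect (z = a); last exact: (xm z).
  by apply: n'; rewrite -za.
exists a => // z Qz Rza; have [za|za] := pselect (z = a).
  by apply: (Ri a); rewrite -{1}za.
by apply: (xm z) => //; apply: Rt Rza Rax.
Qed.

(** A $B$-set of positive type given by labels, all in one ternary relation: x is in use when
    [b x x x], and x and y name the same point when [b x y y], which in a $B$-set does mean
    equality. The congruence clauses make b well defined on classes. *)
Record preB (X : Type) (b : X -> X -> X -> Prop) : Prop := {
  pb_dom : forall x y z, b x y z -> [/\ b x x x, b y y y & b z z z];
  pb_refl : forall x y, b x x x -> b y y y -> b x x y;
  pb_sym : forall x y z, b x y z -> b x z y;
  pb_eq : forall x y z, b x y z -> b y x z -> b x y y;
  pb_split : forall x y z w, b x y z -> b w w w -> b x y w \/ b x w z;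
  pb_congl : forall x y z w, b x y y -> b x z w -> b y z w;
  pb_congr : forall x y z w, b x y y -> b z x w -> b z y w;
  pb_pos : forall x y z, b x x x -> b y y y -> b z z z ->
    ~ b x y z -> ~ b y x z -> ~ b z x y -> exists u, [/\ b u x y, b u x z & b u y z] }.

(** * Betweenness on labels *)

Section PreB.
Variables (X : Type) (b : X -> X -> X -> Prop).
Hypothesis H : preB b.
Let D x := b x x x.
Let E x y := b x y y.

Lemma pb_domx x y z : b x y z -> D x. Proof. by case/(pb_dom H). Qed.
Lemma pb_domy x y z : b x y z -> D y. Proof. by case/(pb_dom H). Qed.
Lemma pb_domz x y z : b x y z -> D z. Proof. by case/(pb_dom H). Qed.

Lemma pb_refr x y : D x -> D y -> b x y x.
Proof. by move=> dx dy; apply: (pb_sym H); apply: (pb_refl H). Qed.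

Lemma pb_esym x y : E x y -> E y x.
Proof.
move=> e; apply: (pb_eq H (z := y)) => //.
by apply: pb_refr; [exact: pb_domy e|exact: pb_domx e].
Qed.

Lemma pb_etrans x y z : E x y -> E y z -> E x z.
Proof. by move=> e1 e2; apply: (pb_congl H (pb_esym e1)). Qed.

Lemma pb_eany x y z : E x y -> D z -> b x y z.
Proof. by move=> e dz; case: (pb_split H e dz) => // /(pb_sym H). Qed.

Lemma pb_congr3 x y z w : E x y -> b z w x -> b z w y.
Proof. by move=> e /(pb_sym H) h; apply: (pb_sym H); apply: (pb_congr H e). Qed.

Lemma pb_cong x x' y y' z z' : E x x' -> E y y' -> E z z' ->
  b x y z -> b x' y' z'.
Proof.
by move=> e1 e2 e3 /(pb_congl H e1) /(pb_congr H e2) /(pb_congr3 e3).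
Qed.

Lemma pb_congE x x' y y' z z' : E x x' -> E y y' -> E z z' ->
  (b x y z <-> b x' y' z').
Proof.
by move=> e1 e2 e3; split; apply: pb_cong => //; apply: pb_esym.
Qed.

Lemma pb_sub y a m z : b y a m -> b m a z -> b m y z.
Proof.
move=> h1 h2; have dy := pb_domx h1; case: (pb_split H h2 dy) => // h3.
have e : E m y by apply: (pb_eq H (z := a)); apply: (pb_sym H).
by apply: pb_eany => //; exact: pb_domz h2.
Qed.

(** Transitivity of being nearer to p; it makes [fin_min] applicable to find points nearest to p. *)
Lemma pb_mid z p y w : b z p y -> b y p w -> b z p w.
Proof.
move=> h1 h2; have dz := pb_domx h1.
have fromE : E y z -> b z p w by move=> e; apply: (pb_congl H e).
case: (pb_split H h2 dz) => h3.
  by apply: fromE; apply: (pb_eq H (pb_sym H h3)); exact: (pb_sym H).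
case: (pb_split H h1 (pb_domz h2)) => // h4.
by apply: fromE; apply: (pb_eq H h3); exact: (pb_sym H).
Qed.

Lemma pb_brtrans a x y z : D y -> ~ b a x y -> ~ b a y z -> ~ b a x z.
Proof. by move=> dy n1 n2 /(pb_split H) /(_ dy) []. Qed.

End PreB.

(** The point [None] is placed next to a, at the start of the direction K. It separates y from z
    when exactly one of them lies in K; x separates it from y when x separates a from y, except for
    x = a and y in K, since then [None] and y are on the same side. For empty K it is a leaf in a
    branch of its own. *)
Definition near (X : Type) (b : X -> X -> X -> Prop) (a : X) (K : X -> Prop)
    (x y z : option X) : Prop :=
  match x, y, z with
  | Some x, Some y, Some z => b x y z
  | None, None, None => True
  | None, None, Some z => b z z z
  | None, Some y, None => b y y y
  | None, Some y, Some z =>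
      [/\ b y y y, b z z z & (K y /\ ~ K z) \/ (~ K y /\ K z)]
  | Some x, None, None => False
  | Some x, None, Some z => b x a z /\ ~ (b x a a /\ K z)
  | Some x, Some y, None => b x a y /\ ~ (b x a a /\ K y)
  end.

(* K is empty or a branch at a. *)
Record direction (X : Type) (b : X -> X -> X -> Prop) (a : X) (K : X -> Prop) :
    Prop := {
  dir_dom : b a a a;
  dir_K : forall y, K y -> b y y y;
  dir_branch : forall y z, K y -> b z z z -> (K z <-> ~ b a y z) }.

Section Near.
Variables (X : Type) (b : X -> X -> X -> Prop) (a : X) (K : X -> Prop).
Hypotheses (H : preB b) (dK : direction b a K).

Lemma dir_neq y z : K y -> b y a z -> ~ b a y z.
Proof.
move=> ky h1 h2; have e : b a y y by apply: (pb_eq H h2 h1).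
by have := (dir_branch dK ky (dir_K dK ky)).1 ky.
Qed.

Lemma dir_a : ~ K a.
Proof.
move=> ka; apply: (dir_branch dK ka (dir_dom dK)).1 => //; exact: dir_dom dK.
Qed.

Lemma dir_cong x y : b x y y -> K x -> K y.
Proof.
move=> e kx; apply/(dir_branch dK kx); first exact: pb_domy e.
move=> h; apply: ((dir_branch dK kx (dir_K dK kx)).1 kx).
by apply: (pb_congr3 H (pb_esym H e)).
Qed.

Lemma dir_ea x : b x a a -> ~ K x.
Proof. by move=> e kx; apply: dir_a; apply: dir_cong kx. Qed.

Lemma dir_sep y z : K y -> b z z z -> ~ K z -> b a y z.
Proof. by move=> ky dz nz; apply: contrapT => /(dir_branch dK ky dz). Qed.

Lemma near_preB : preB (near b a K).
Proof.
have da := dir_dom dK; have S := pb_sym H; have Dx := pb_domx H.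
have Dy := pb_domy H; have Dz := pb_domz H.
split.
- move=> [x|] [y|] [z|] //= .
  + by case/(pb_dom H).
  + by case=> /(pb_dom H) [].
  + by case=> /(pb_dom H) [].
  + by case.
- move=> [x|] [y|] //=; first exact: pb_refl.
  by move=> dx _; split; [exact: pb_refr|case=> e kx; exact: dir_ea kx].
- move=> [x|] [y|] [z|] //=; first exact: pb_sym.
  by case=> dy dz [[]|[]]; split; auto.
- move=> [x|] [y|] [z|] //=.
  + exact: pb_eq.
  + by case=> h1 _ [h2 _]; apply: (pb_eq H (S _ _ _ h1) (S _ _ _ h2)).
  + case=> h n [dx dz [[kx kz]|[kx kz]]].
      by apply: (dir_neq kx h); apply: dir_sep.
    apply: n; split=> //; apply: (pb_eq H h); apply: S.
    by apply: dir_sep.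
  + case=> dy dz [[ky kz]|[ky kz]] [h n]; exfalso.
      by apply: (dir_neq ky h); apply: dir_sep.
    apply: n; split=> //; apply: (pb_eq H h); apply: S.
    by apply: dir_sep.
- move=> [x|] [y|] [z|] [w|] //=.
  + by move=> h dw; exact: pb_split.
  + move=> h _.
    have [e|n] := pselect (b x a a).
      have [ky|ky] := pselect (K y); last first.
        left; split; last by case.
        by apply: (pb_eany H e); exact: Dy h.
      have [kz|kz] := pselect (K z); last first.
        right; split; last by case.
        by apply: (pb_eany H e); exact: Dz h.
      case: ((dir_branch dK ky (dir_K dK kz)).1 kz).
      by apply: (pb_congl H e).
    by case: (pb_split H h da) => h'; [left|right]; split=> //; [exact: S|case|case].
  + move=> [h n] dw; have [kw|kw] := pselect (b x a a /\ K w); last first.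
      case: (pb_split H h dw) => h'; first by right.
      left; exact: S.
    case: kw => e kw; left.
    have ky : ~ K y by move=> ky; apply: n.
    by apply: (pb_congl H (pb_esym H e)); apply: S; apply: dir_sep => //; exact: Dz h.
  + by move=> h _; left.
  + move=> [h n] dw; have [kw|kw] := pselect (b x a a /\ K w); last first.
      by case: (pb_split H h dw) => h'; [left|right].
    case: kw => e kw; right.
    have kz : ~ K z by move=> kz; apply: n.
    by apply: (pb_congl H (pb_esym H e)); apply: dir_sep => //; exact: Dz h.
  + by move=> h _; right.
  + case=> dy dz h dw; have [kw|kw] := pselect (K w);
      case: h => -[h1 h2]; (try (left; split; tauto)); (try (right; split; tauto)).
  + by case=> dy dz h _; left.
  + by move=> dy dw; right.
  + by move=> dy _; right.
  + by move=> dz dw; left.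
  + by move=> _ dw; left.
  + by move=> _ dw; left.
  + by move=> _ dw; left.
- move=> [x|] [y|] [z|] [w|] //=.
  + exact: pb_congl.
  + move=> e [h n]; split; first exact: (pb_congl H e).
    by case=> e' kz; apply: n; split=> //; apply: (pb_etrans H e).
  + move=> e [h n]; split; first exact: (pb_congl H e).
    by case=> e' kz; apply: n; split=> //; apply: (pb_etrans H e).
  1-4: by case=> _ _ [] [].
- move=> [x|] [y|] [z|] [w|] //=.
  + exact: pb_congr.
  + move=> e [h n]; split; first exact: (pb_congr3 H e).
    by case=> e' ky; apply: n; split=> //; apply: dir_cong ky; apply: pb_esym.
  + move=> e [dx dw h]; split=> //; first exact: Dy e.
    have kc := dir_cong e; have kc' := dir_cong (pb_esym H e).
    case: h => -[h1 h2]; [left|right]; split; auto.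
  + by move=> e _; exact: Dy e.
  1-3: by case=> _ _ [] [].
(* Positive type for a triple x, y, [None] without betweenness: x and y lie both in K or both
   outside, since otherwise [None] separates them. In either case the centroid of a, x, y serves; it
   is a itself when a separates x from y. *)
- have P2 x y : b x x x -> b y y y -> near b a K None (Some x) (Some y) \/
     near b a K (Some x) None (Some y) \/ near b a K (Some y) None (Some x) \/
    (~ K x /\ ~ K y /\ ~ b x a y /\ ~ b y a x) \/ (K x /\ K y).
    move=> dx dy /=; have [kx|kx] := pselect (K x); have [ky|ky] := pselect (K y).
    + by do 4 right.
    + by left; split=> //; left.
    + by left; split=> //; right.
    have [h1|h1] := pselect (b x a y).
      by right; left; split=> //; case.
    have [h2|h2] := pselect (b y a x).
      by right; right; left; split=> //; case.
    by right; right; right; left.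
  have nS x y z : near b a K x y z -> near b a K x z y.
    move: x y z => [x|] [y|] [z|] //=; first exact: S.
    by case=> dy dz [[]|[]]; split; auto.
  have key x y : b x x x -> b y y y ->
    ~ near b a K None (Some x) (Some y) -> ~ near b a K (Some x) None (Some y) ->
    ~ near b a K (Some y) None (Some x) ->
    exists u, [/\ near b a K u None (Some x), near b a K u None (Some y) &
                near b a K u (Some x) (Some y)].
    move=> dx dy n1 n2 n3; have := P2 _ _ dx dy.
    case=> [//|[//|[//|[[kx [ky [h1 h2]]]|[kx ky]]]]].
    + have [h3|h3] := pselect (b a x y).
        exists (Some a); split=> //=; (split; last by case); apply: pb_refl => //.
      have [u [u1 u2 u3]] := pb_pos H da dx dy h3 h1 h2.
      exists (Some u); split=> //=; split=> //; by case.
    + have h3 : ~ b a x y by exact: (dir_branch dK kx dy).1 ky.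
      have nx : ~ b x a y.
        move=> h; apply: n2; split=> //; case=> e _; exact: dir_ea e kx.
      have ny : ~ b y a x.
        move=> h; apply: n3; split=> //; case=> e _; exact: dir_ea e ky.
      have [u [u1 u2 u3]] := pb_pos H da dx dy h3 nx ny.
      have nu : ~ b u a a.
        by move=> e; apply: h3; apply: (pb_congl H e).
      by exists (Some u); split=> //=; split=> //; case.
  move=> [x|] [y|] [z|] //=.
  + by move=> dx dy dz n1 n2 n3; have [u hu] := pb_pos H dx dy dz n1 n2 n3; exists (Some u).
  + move=> dx dy _ n1 n2 n3.
    have [u [u1 u2 u3]] := key x y dx dy n3 n1 n2.
    by exists u; split=> //; apply: nS.
  + move=> dx _ dz n1 n2 n3.
    have [u [u1 u2 u3]] := key x z dx dz n2 n1 (fun h => n3 (nS _ _ _ h)).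
    by exists u; split=> //; apply: nS.
  + by move=> _ dy dz n1 n2 n3; apply: (key y z).
Qed.

End Near.

(** A star on the S-classes, with the class c as its centre; c may be empty. *)
Definition starb (X : Type) (D0 : X -> Prop) (S : X -> X -> Prop) (c : X -> Prop)
    (x y z : X) : Prop :=
  [/\ D0 x, D0 y, D0 z & S x y \/ S x z \/ (c x /\ ~ S y z)].

(** Three distinct leaves have the centre as centroid. The last hypothesis lets the centre be absent
    when there are no three distinct points. *)
Lemma star_preB (X : Type) (D0 : X -> Prop) (S : X -> X -> Prop) (c : X -> Prop) :
  (forall x, D0 x -> S x x) -> (forall x y, D0 x -> D0 y -> S x y -> S y x) ->
  (forall x y z, D0 x -> D0 y -> D0 z -> S x y -> S y z -> S x z) ->
  (forall x y, D0 x -> D0 y -> S x y -> c x -> c y) ->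
  (forall x y, D0 x -> D0 y -> c x -> c y -> S x y) ->
  (exists2 x, D0 x & c x) \/
  (forall x y z, D0 x -> D0 y -> D0 z -> S x y \/ S x z \/ S y z) ->
  preB (starb D0 S c).
Proof.
move=> Sr Ss St cS cc cp.
have sb x y : starb D0 S c x y y -> S x y.
  by case=> dx dy _ [//|[//|[_ []]]]; exact: Sr.
split.
- move=> x y z [dx dy dz _]; split; split=> //; left; exact: Sr.
- by move=> x y [dx _ _ _] [dy _ _ _]; split=> //; left; exact: Sr.
- move=> x y z [dx dy dz h]; split=> //.
  case: h => [h|[h|[h n]]]; [by right; left|by left|].
  by right; right; split=> // /Ss h'; apply: n; exact: h'.
- move=> x y z [dx dy dz h] [_ _ _ h']; split=> //; left.
  case: h => [//|[h|[h n]]].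
    case: h' => [/Ss|[|[h' n']]]; [exact| |by case: n'].
    by move=> h'; apply: (St x z y) => //; apply: Ss.
  case: h' => [/Ss|[|[h' n']]]; [exact|by move/n|exact: cc].
- move=> x y z w [dx dy dz h] [dw _ _ _].
  case: h => [h|[h|[h n]]]; [by left; split=> //; left|by right; split=> //; right; left|].
  have [yw|yw] := pselect (S y w); last by left; split=> //; right; right.
  right; split=> //; right; right; split=> // wz; apply: n; exact: St yw wz.
- move=> x y z w /[dup] [[dx dy _ _]] /sb e [_ dz dw h]; split=> //.
  case: h => [h|[h|[h n]]].
  + by left; apply: (St y x z) => //; apply: Ss.
  + by right; left; apply: (St y x w) => //; apply: Ss.
  + by right; right; split=> //; apply: cS h.
- move=> x y z w /[dup] [[dx dy _ _]] /sb e [dz _ dw h]; split=> //.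
  case: h => [h|[h|[h n]]].
  + by left; apply: (St z x y).
  + by right; left.
  + by right; right; split=> // yw; apply: n; apply: (St x y w).
- move=> x y z [dx _ _ _] [dy _ _ _] [dz _ _ _] n1 n2 n3.
  have e1 : ~ S x y by move=> h; apply: n1; split=> //; left.
  have e2 : ~ S x z by move=> h; apply: n1; split=> //; right; left.
  have e3 : ~ S y z by move=> h; apply: n2; split=> //; right; left.
  case: cp => [[u du cu]|/(_ x y z dx dy dz)]; last by tauto.
  by exists u; split; split=> //; right; right.
Qed.

(** The branch of k at a; it is empty for [None], when the new point opens a branch of its own. *)
Definition dirK (X : Type) (b : X -> X -> X -> Prop) (a : X) (k : option X) (y : X) :
    Prop :=
  if k is Some k0 then b y y y /\ ~ b a k0 y else False.

Lemma dirKP (X : Type) (b : X -> X -> X -> Prop) (a : X) (k : option X) :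
  preB b -> b a a a -> (forall k0, k = Some k0 -> b k0 k0 k0 /\ ~ b a k0 k0) ->
  direction b a (dirK b a k).
Proof.
move=> H da; case: k => [k0|] hk; last by split.
have [dk nk] := hk _ erefl; split=> //= [y []//|y z [dy ky] dz].
split=> [[_ kz]|n]; last first.
  split=> //; exact: (pb_brtrans H dy).
by apply: (pb_brtrans H dk) kz => h; apply: ky; apply: (pb_sym H).
Qed.

(** * Trees of $B$-sets on one set of labels *)

Section Ptb.
Context {d : Order.disp_t} {C : orderType d}.

(* A node t carries the B-set of the classes of [D t] under [eqv t], [fr t s x]
   says that x represents f_t(s), and the partial map g_{st} is induced by the
   identity on labels.  The root [rt] is virtual: it has no colour constraint
   and its B-set is a star, so that inserting a new least node is a special case
   of inserting a node between two others. *)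
Record pst (P X : Type) := Pst {
  nd : P -> Prop;
  le : P -> P -> Prop;
  rt : P;
  ctr : X;
  col : P -> C;
  be : P -> X -> X -> X -> Prop;
  fr : P -> P -> X -> Prop }.

Section Defs.
Variables (P X : Type) (Z : pst P X).

Definition lt s t := le Z s t /\ s <> t.
Definition D t x := be Z t x x x.
Definition eqv t x y := be Z t x y y.
Definition isglb m s t :=
  [/\ le Z m s, le Z m t & forall w, le Z w s -> le Z w t -> le Z w m].
Definition cone t s1 s2 := exists z, [/\ lt t z, le Z z s1 & le Z z s2].
Definition br3 t a x y z :=
  [/\ be Z t a x y, be Z t a x z & be Z t a y z] /\
  [/\ ~ eqv t a x, ~ eqv t a y & ~ eqv t a z].

(** The part of the axioms that survives the addition of a point. [w_dom1] with [dom2] describes the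
    domain of $g_{st}$, and [w_eq1] with [w_eq2] its kernel; [dom2] and the surjectivity [frs] of f
    are kept apart because they may fail for a moment. By [w_cone] the virtual root has at most one
    cone, so that proper nodes have proper meets. *)
Record wptb : Prop := {
  w_nd : forall s t, le Z s t -> nd Z s /\ nd Z t;
  w_refl : forall t, nd Z t -> le Z t t;
  w_trans : forall s t u, le Z s t -> le Z t u -> le Z s u;
  w_anti : forall s t, le Z s t -> le Z t s -> s = t;
  w_tree : forall x y z, le Z y x -> le Z z x -> le Z y z \/ le Z z y;
  w_glb : forall s t, nd Z s -> nd Z t -> exists m, isglb m s t;
  w_rt : forall t, nd Z t -> le Z (rt Z) t;
  w_ndrt : nd Z (rt Z);
  w_cone : forall s t, lt (rt Z) s -> lt (rt Z) t -> cone (rt Z) s t;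
  w_col : forall s t, lt s t -> s <> rt Z -> (col Z s < col Z t)%O;
  w_be : forall t x y z, be Z t x y z -> nd Z t;
  w_preB : forall t, preB (be Z t);
  w_ctr : D (rt Z) (ctr Z);
  w_star : forall x y z, be Z (rt Z) x y z <->
    starb (D (rt Z)) (eqv (rt Z)) (eqv (rt Z) (ctr Z)) x y z;
  w_mono : forall s t x, le Z s t -> D t x -> D s x;
  w_monoe : forall s t x y, le Z s t -> eqv s x y -> D t x -> eqv t x y;
  w_frctr : forall s, lt (rt Z) s -> fr Z (rt Z) s (ctr Z);
  w_frlt : forall t s x, fr Z t s x -> lt t s;
  w_frD : forall t s x, fr Z t s x -> D t x;
  w_frex : forall t s, lt t s -> exists x, fr Z t s x;
  w_freq : forall t s x y, fr Z t s x -> fr Z t s y -> eqv t x y;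
  w_frcong : forall t s x y, fr Z t s x -> eqv t x y -> fr Z t s y;
  w_frcone : forall t s1 s2 x, fr Z t s1 x -> lt t s2 ->
    (fr Z t s2 x <-> cone t s1 s2);
  w_dom1 : forall u t x, fr Z u t x -> ~ D t x;
  w_eq1 : forall u t a x y, fr Z u t a -> D t x -> D t y -> ~ be Z u a x y ->
    eqv t x y;
  w_eq2 : forall s t x y, lt s t -> eqv t x y ->
    exists u a, [/\ le Z s u, fr Z u t a & ~ be Z u a x y] }.

Definition dom2 := forall s t x, lt s t -> D s x -> ~ D t x ->
  exists2 u, le Z s u & fr Z u t x.

Definition frs := forall t a x y z, br3 t a x y z -> exists s, fr Z t s a.

Definition ptb := [/\ wptb, dom2 & frs].

Section Theory.
Hypothesis W : wptb.

Lemma le_lt s t : le Z s t -> s <> t -> lt s t. Proof. by []. Qed.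

Lemma lt_leT s t u : lt s t -> le Z t u -> lt s u.
Proof.
move=> [h n] h'; split; first exact: (w_trans W) h h'.
by move=> e; subst u; apply: n; apply: (w_anti W).
Qed.

Lemma le_ltT s t u : le Z s t -> lt t u -> lt s u.
Proof.
move=> h [h' n]; split; first exact: (w_trans W) h h'.
by move=> e; subst u; apply: n; apply: (w_anti W).
Qed.

Lemma lt_irr s t : lt s t -> le Z t s -> False.
Proof. by move=> [h n] h'; apply: n; apply: (w_anti W). Qed.

Lemma eqvD t x y : eqv t x y -> D t x /\ D t y.
Proof. by move=> /(pb_dom (w_preB W t)) []. Qed.

Lemma eqv_sym t x y : eqv t x y -> eqv t y x.
Proof. exact: (pb_esym (w_preB W t)). Qed.

Lemma eqv_trans t x y z : eqv t x y -> eqv t y z -> eqv t x z.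
Proof. exact: (pb_etrans (w_preB W t)). Qed.

Lemma eqvDE s t x y : le Z s t -> eqv s x y -> (D t x <-> D t y).
Proof.
move=> h e; split=> dd; first by have [] := eqvD (w_monoe W h e dd).
by have [] := eqvD (w_monoe W h (eqv_sym e) dd).
Qed.

Lemma fr_nd t s x : fr Z t s x -> nd Z t /\ nd Z s.
Proof. by case/(w_frlt W) => /(w_nd W). Qed.

Lemma cone_sub t s1 s2 : lt t s1 -> le Z s1 s2 -> cone t s1 s2.
Proof.
by move=> h h'; exists s1; split=> //; apply: (w_refl W); case: (w_nd W h').
Qed.

Lemma cone_sym t s1 s2 : cone t s1 s2 -> cone t s2 s1.
Proof. by case=> z [*]; exists z. Qed.

Lemma fr_up t s1 s2 x : fr Z t s1 x -> le Z s1 s2 -> fr Z t s2 x.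
Proof.
move=> h h'; have h1 := w_frlt W h.
apply/(w_frcone W h); [exact: lt_leT h1 h'|exact: cone_sub].
Qed.

Lemma fr_down t s1 s2 x : fr Z t s2 x -> lt t s1 -> le Z s1 s2 -> fr Z t s1 x.
Proof.
by move=> h h1 h2; apply/(w_frcone W h) => //; apply: cone_sym; exact: cone_sub.
Qed.

Lemma glb_uniq m m' s t : isglb m s t -> isglb m' s t -> m = m'.
Proof. by move=> [a1 a2 a3] [b1 b2 b3]; apply: (w_anti W); auto. Qed.

Lemma glbC m s t : isglb m s t -> isglb m t s.
Proof. by case=> *; split=> //; auto. Qed.

(** Labels in one branch at $f_s(t)$ share their fate up to t. If y were lost as $f_u(t)$ with s < u
    < t while x survives, then x and y would already be equal in u, because $f_s(u) = f_s(t)$, and x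
    would be lost at the same moment. *)
Lemma same_branch_twin s t F x y : dom2 -> fr Z s t F -> D s x -> D s y ->
  ~ be Z s F x y -> (D t x <-> D t y) /\ (D t x -> eqv t x y).
Proof.
move=> d2 f dx dy n; have lst := w_frlt W f.
have Hs := w_preB W s; have dF := w_frD W f.
have half x' y' : D s x' -> D s y' -> ~ be Z s F x' y' -> D t x' -> D t y'.
  move=> dx' dy' n' tx; apply: contrapT => ty.
  have [u su fu] := d2 _ _ _ lst dy' ty.
  have lut := w_frlt W fu.
  have ux : D u x' := w_mono W lut.1 tx.
  have [e|ne] := pselect (s = u).
    subst u; apply: n'; apply: (pb_sym Hs); apply: (pb_eany Hs) => //.
    exact: (w_freq W f fu).
  have fsu : fr Z s u F by apply: fr_down f _ lut.1.
  have e := w_eq1 W fsu ux (w_frD W fu) n'.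
  exact: (w_dom1 W (w_frcong W fu (eqv_sym e))).
have xy : D t x <-> D t y.
  by split; [exact: half|apply: half => // h; apply: n; exact: (pb_sym Hs)].
by split=> // tx; apply: (w_eq1 W f) => //; apply/xy.
Qed.

End Theory.
End Defs.

(** The relation [be] is compared on all labels of the root, so that also the domains of the maps
    $g_{st}$ agree. Only one half of [fr] is demanded, the other being [emb_fr]; the virtual root
    has no colour to be preserved. *)
Record emb (P X Q Y : Type) (Z : pst P X) (W : pst Q Y) (f : P -> Q) (h : X -> Y) :
    Prop := {
  e_nd : forall t, nd Z t -> nd W (f t);
  e_rt : f (rt Z) = rt W;
  e_col : forall t, nd Z t -> t <> rt Z -> col W (f t) = col Z t;
  e_le : forall s t, nd Z s -> nd Z t -> (le W (f s) (f t) <-> le Z s t);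
  e_glb : forall m s t, isglb Z m s t -> isglb W (f m) (f s) (f t);
  e_be : forall t x y z, nd Z t -> D Z (rt Z) x -> D Z (rt Z) y -> D Z (rt Z) z ->
    (be W (f t) (h x) (h y) (h z) <-> be Z t x y z);
  e_fr : forall t s x, fr Z t s x -> fr W (f t) (f s) (h x) }.

End Ptb.

(** * Adding a point to a B-set *)

Section AddPoint.
Context {d : Order.disp_t} {C : orderType d}.
Variables (P X : Type) (Z : @pst d C P X).
Hypothesis W : wptb Z.
Variables (v : P) (a : X) (k : option X) (al rho : P -> X).

(* The new point [None] sits next to a in B(v), in the branch of k, or in a new
   branch.  Hence below v it is a new leaf at f_t(v), while at a node t not
   below v it cannot be told from [rho t]. *)
Record position : Prop := {
  po_nd : nd Z v;
  po_a : D Z v a;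
  po_k : forall k0, k = Some k0 -> D Z v k0 /\ ~ eqv Z v a k0;
  po_rt : v = rt Z -> k = None /\ eqv Z v (ctr Z) a;
  po_alv : al v = a;
  po_al : forall t, lt Z t v -> fr Z t v (al t);
  po_rho : forall t, nd Z t -> ~ le Z t v -> exists w, isglb Z w t v /\
    ((rho t = al w /\ (k = None \/ ~ (w = v /\ fr Z v t a))) \/
     [/\ w = v, fr Z v t a & k = Some (rho t)]) }.

Definition KK (t : P) (y : X) : Prop := t = v /\ dirK (be Z v) a k y.
Definition sg (t : P) (o : option X) : X := odflt (rho t) o.

Definition addbe (t : P) : option X -> option X -> option X -> Prop :=
  if pselect (le Z t v) then near (be Z t) (al t) (KK t)
  else fun x y z => be Z t (sg t x) (sg t y) (sg t z).

Definition addfr (t s : P) (o : option X) : Prop :=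
  if o is Some x then fr Z t s x else ~ le Z t v /\ fr Z t s (rho t).

Definition addpt : @pst d C P (option X) :=
  Pst (nd Z) (le Z) (rt Z) (Some (ctr Z)) (col Z) addbe addfr.

Hypothesis po : position.

Lemma addbe_le t : le Z t v -> addbe t = near (be Z t) (al t) (KK t).
Proof. by rewrite /addbe; case: pselect. Qed.

Lemma addbe_nle t : ~ le Z t v ->
  addbe t = fun x y z => be Z t (sg t x) (sg t y) (sg t z).
Proof. by rewrite /addbe; case: pselect. Qed.

Lemma addbe_old t x y z : addbe t (Some x) (Some y) (Some z) = be Z t x y z.
Proof. by rewrite /addbe; case: pselect. Qed.

Lemma addfr_nle t s o : ~ le Z t v -> addfr t s o <-> fr Z t s (sg t o).
Proof. by move=> h; case: o => [x|] //=; tauto. Qed.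

Lemma addfr_le t s o : le Z t v -> addfr t s o -> exists2 x, o = Some x & fr Z t s x.
Proof. by move=> h; case: o => [x|] //=; [exists x|case]. Qed.

Lemma al_D t : le Z t v -> D Z t (al t).
Proof.
move=> h; have [->|n] := pselect (t = v); first by rewrite (po_alv po); exact: po_a.
by apply: (w_frD W (po_al po _)).
Qed.

Lemma KK_dir t : le Z t v -> direction (be Z t) (al t) (KK t).
Proof.
move=> h; have [e|n] := pselect (t = v); last first.
  by split; [exact: al_D| move=> y []| move=> y z []].
have := dirKP (w_preB W v) (po_a po) (po_k po).
rewrite e (po_alv po) => -[h1 h2 h3]; split=> //; first by move=> y [_ /h2].
by move=> y z [_ hy] dz; rewrite -(h3 y z hy dz); split=> [[]|].
Qed.

Lemma KK_lt t y : t <> v -> ~ KK t y. Proof. by move=> n []. Qed.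

Lemma ndle t : le Z t v -> nd Z t. Proof. by case/(w_nd W). Qed.

(** Both nodes have the same meet w with v, and when w = v they lie in the same cone at v; so the
    two prescriptions of [rho] agree. *)
Lemma rho_eq s t : le Z s t -> ~ le Z s v -> rho s = rho t.
Proof.
move=> st nsv; have [ns nt] := w_nd W st.
have ntv : ~ le Z t v by move=> h; apply: nsv; exact: (w_trans W) st h.
have [w [gw hw]] := po_rho po ns nsv; have [w' [gw' hw']] := po_rho po nt ntv.
have e : w = w'.
  apply: (glb_uniq W gw); case: gw' => g1 g2 g3; split=> //.
    case: (w_tree W g1 st) => // h; case: nsv; exact: (w_trans W) h g2.
  by move=> z zs zv; apply: g3 => //; exact: (w_trans W) zs st.
subst w'.
have ff : w = v -> (fr Z v s a <-> fr Z v t a).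
  move=> e; subst w; have l : lt Z v s.
    by split; [case: gw|move=> e; apply: nsv; rewrite -e; apply: (w_refl W); exact: po_nd].
  by split=> h; [exact: fr_up h st|exact: fr_down h l st].
case: hw => [[-> h1]|[h1 h2 h3]]; case: hw' => [[-> h1']|[h1' h2' h3']] //.
- case: h1 => [|n]; first by rewrite h3'.
  by case: n; split=> //; apply/ff.
- case: h1' => [|n]; first by rewrite h3.
  by case: n; split=> //; apply/ff.
- by move: h3; rewrite h3' => -[].
Qed.

Lemma addbe_preB t : preB (addbe t).
Proof.
rewrite /addbe; case: pselect => h; first exact: near_preB (w_preB W t) (KK_dir h).
have H := w_preB W t; split=> [x y z|x y|x y z|x y z|x y z w|x y z w|x y z w|].
- exact: pb_dom.
- exact: pb_refl.
- exact: pb_sym.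
- exact: pb_eq.
- exact: pb_split.
- exact: pb_congl.
- exact: pb_congr.
- move=> x y z dx dy dz n1 n2 n3; have [u hu] := pb_pos H dx dy dz n1 n2 n3.
  by exists (Some u).
Qed.

Lemma eqv_mix t x : le Z t v -> ~ addbe t None (Some x) (Some x) /\
  ~ addbe t (Some x) None None.
Proof. by move=> h; rewrite addbe_le //=; split=> // -[_ _ [] []]. Qed.

(** The justification of [rho]: with w the meet of t and v, the new point and [rho t] see the same
    branch at $f_w(t)$, so they have to be identified in t. The exception is a new branch opened at
    a = $f_v(t)$. *)
Lemma rho_branch t w F : isglb Z w t v -> ~ le Z t v -> fr Z w t F ->
  D Z w (rho t) -> (k = None -> w = v -> ~ fr Z v t a) ->
  forall z, D Z w z ->
    (~ addbe w (Some F) None (Some z) -> ~ be Z w F (rho t) z) /\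
    (~ be Z w F (rho t) z -> ~ addbe w (Some F) None (Some z)).
Proof.
move=> g ntv fF dr hk z dz; have [g1 g2 g3] := g.
have nt : nd Z t by case: (w_nd W g1).
have H := w_preB W w.
have [w' [gw' hw]] := po_rho po nt ntv; have e := glb_uniq W gw' g; subst w'.
rewrite addbe_le //=.
have [e|n] := pselect (w = v); last first.
  have fv : fr Z w v (al w) by exact: po_al.
  have nFa : ~ eqv Z w F (al w).
    move=> e; have /(w_frcone W fv) : fr Z w t (al w) by exact: w_frcong e.
    case; first exact: w_frlt fF.
    move=> u [[wu nwu] uv ut]; apply: nwu; apply: (w_anti W) => //; exact: g3.
  have -> : rho t = al w by case: hw => [[]|[]].
  split=> h1 h2; apply: h1; last by case: h2.
  split=> //; case=> e _; exact: nFa.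
subst w; have [fa|nfa] := pselect (fr Z v t a); last first.
  have -> : rho t = a by case: hw => [[]|[]] //; rewrite (po_alv po).
  rewrite (po_alv po); split=> h1 h2; apply: h1; last by case: h2.
  by split=> //; case=> e _; apply: nfa; apply: w_frcong e.
have kr : k = Some (rho t).
  by case: hw => [[_ []]|[]] // kn; [case: (hk kn)|case: kn].
have ea : eqv Z v F a by exact: w_freq fF fa.
have b1 : be Z v F (al v) z by rewrite (po_alv po); exact: (pb_eany H ea).
have KE : KK v z <-> ~ be Z v F (rho t) z.
  rewrite /KK /dirK kr.
  have cE : be Z v F (rho t) z <-> be Z v a (rho t) z.
    by split; apply: (pb_congl H) => //; exact: eqv_sym.
  by rewrite cE; split=> [[_ []]|].
split=> h1; first by apply/KE; apply: contrapT => nk; apply: h1; split=> //; case.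
by case=> _; apply; split; rewrite ?(po_alv po)//; apply/KE.
Qed.

Lemma nle_up s t : le Z s t -> ~ le Z s v -> ~ le Z t v.
Proof. by move=> st h h'; apply: h; exact: (w_trans W) st h'. Qed.

Lemma sg_eq s t o : le Z s t -> ~ le Z s v -> sg s o = sg t o.
Proof. by move=> st h; case: o => //=; exact: rho_eq. Qed.

Lemma GB t : nd Z t -> exists w, isglb Z w t v.
Proof. by move=> h; apply: (w_glb W) => //; exact: po_nd po. Qed.

Lemma w_addfrlt t s o : addfr t s o -> lt Z t s.
Proof. by case: o => [x|[_]] /=; exact: (w_frlt W). Qed.

Lemma branch_le t u F z : le Z t v -> fr Z u t F -> D Z u z ->
  addbe u (Some F) None (Some z).
Proof.
move=> tv f dz; have lut := w_frlt W f.
have luv : lt Z u v := lt_leT W lut tv.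
rewrite addbe_le /=; last by case: luv.
split; last by case=> _ /KK_lt; apply; case: luv.
apply: (pb_eany (w_preB W u)) => //.
by apply: (w_freq W) (po_al po luv); exact: fr_up f tv.
Qed.

(** In the exceptional case [rho t] is a, the point $f_v(t)$, which has no value in t. *)
Lemma rhoD_hk t w : ~ le Z t v -> isglb Z w t v -> D Z t (rho t) ->
  k = None -> w = v -> ~ fr Z v t a.
Proof.
move=> tv g dr kn wv fa; have [w' [gw' hw]] := po_rho po (fr_nd W fa).2 tv.
have e := glb_uniq W gw' g; subst w' w; case: hw => [[e _]|[_ _]]; last by rewrite kn.
by apply: (w_dom1 W fa); move: dr; rewrite e (po_alv po).
Qed.

Lemma rho_neq t w F : isglb Z w t v -> ~ le Z t v -> fr Z w t F ->
  (k = None -> w = v -> ~ fr Z v t a) -> ~ eqv Z w F (rho t).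
Proof.
move=> g ntv fF hk e; have [g1 g2 g3] := g.
have nt : nd Z t by case: (w_nd W g1).
have [w' [gw' hw]] := po_rho po nt ntv; have e' := glb_uniq W gw' g; subst w'.
have f := w_frcong W fF e.
case: hw => [[er h]|[ew fa kr]]; last first.
  by subst w; have [_] := po_k po kr; case; exact: (w_freq W fa f).
rewrite er in f; have [ew|n] := pselect (w = v).
  by subst w; rewrite (po_alv po) in f; case: h => [/hk /(_ erefl)|[]].
have fv : fr Z w v (al w) by exact: po_al.
have l : lt Z w t by exact: (w_frlt W f).
have [u [lwu uv ut]] := (w_frcone W fv l).1 f.
by apply: (lt_irr W lwu); exact: g3.
Qed.

Lemma rho_Drt t : nd Z t -> ~ le Z t v -> exists2 w, isglb Z w t v & D Z w (rho t).
Proof.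
move=> nt ntv; have [w [g hw]] := po_rho po nt ntv; exists w => //.
case: hw => [[-> _]|[-> _ /(po_k po) []//]].
by apply: al_D; case: g.
Qed.

Lemma addpt_wptb : wptb addpt.
Proof.
split=> /=.
- exact: (w_nd W).
- exact: (w_refl W).
- exact: (w_trans W).
- exact: (w_anti W).
- exact: (w_tree W).
- exact: (w_glb W).
- exact: (w_rt W).
- exact: (w_ndrt W).
- exact: (w_cone W).
- exact: (w_col W).
- move=> t x y z; rewrite /addbe; case: pselect => [h _|h]; first exact: ndle.
  exact: (w_be W).
- exact: addbe_preB.
- by rewrite /D /= addbe_old; exact: (w_ctr W).
(* At the root, [al (rt Z)] is the centre and the direction is empty, so the new point is one more
   leaf of the star. *)
- have rv : le Z (rt Z) v by apply: (w_rt W); exact: po_nd.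
  have ec : eqv Z (rt Z) (ctr Z) (al (rt Z)).
    have [e|n] := pselect (v = rt Z).
      by case: (po_rt po e) => _; rewrite -{1}(po_alv po) e.
    have l : lt Z (rt Z) v by split=> // e; apply: n.
    by apply: (w_freq W (w_frctr W l)); apply: po_al.
  have nK y : ~ KK (rt Z) y.
    by case=> /esym e; case: (po_rt po e) => ->.
  have H := w_preB W (rt Z); have S := w_star W.
  move=> x y z; rewrite /starb /eqv /D /= addbe_le //.
  move: x y z => [x|] [y|] [z|] //=.
  + split.
      case=> h _; have [dx _ dy] := pb_dom H h; split=> //.
      have /S [_ _ _] := h; case=> [h1|[h1|[h1 h2]]]; last by right; right; split=> //; case.
        right; right; split; last by case=> _ _ [] [].
        by apply: (pb_etrans H ec); apply: (pb_esym H).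
      by left.
    case=> dx dy _ [h|[[]|[h _]]].
      by split; [apply: (pb_sym H); apply: (pb_eany H h); case/(pb_dom H): ec|case=> _ /nK].
    split; last by case=> _ /nK.
    by apply: (pb_eany H) => //; apply: (pb_etrans H _ ec); apply: (pb_esym H).
  + split.
      case=> h _; have [dx _ dz] := pb_dom H h; split=> //.
      have /S [_ _ _] := h; case=> [h1|[h1|[h1 h2]]]; last by right; right; split=> //; case=> _ _ [] [].
        right; right; split; last by case=> _ _ [] [].
        by apply: (pb_etrans H ec); apply: (pb_esym H).
      by right; left.
    case=> dx _ dz [[]|[h|[h _]]].
      by split; [apply: (pb_sym H); apply: (pb_eany H h); case/(pb_dom H): ec|case=> _ /nK].
    split; last by case=> _ /nK.
    by apply: (pb_eany H) => //; apply: (pb_etrans H _ ec); apply: (pb_esym H).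
  + by split=> // -[_ _ _ [|[|[]]]].
  + have nn y' z' : ~ ((KK (rt Z) y' /\ ~ KK (rt Z) z') \/ (~ KK (rt Z) y' /\ KK (rt Z) z')).
      by have := nK y'; have := nK z'; tauto.
    by split=> [[_ _ /nn]|[_ _ _ [[_ _ /nn]|[[_ _ /nn]|[]]]]].
  + by split=> [h|[]//]; split=> //; right; left.
  + by split=> [h|[]//]; split=> //; left.
  + by split=> // _; split=> //; left.
- move=> s t [x|] st; rewrite /D /= ?addbe_old; first exact: (w_mono W).
  have [sv|sv] := pselect (le Z s v); first by rewrite (addbe_le sv).
  by rewrite (addbe_nle sv) (addbe_nle (nle_up st sv)) /= (rho_eq st) //; exact: (w_mono W).
- move=> s t x y st; rewrite /eqv /D /=.
  have [sv|sv] := pselect (le Z s v).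
    move: x y => [x|] [y|] //=; rewrite ?addbe_old; first exact: (w_monoe W).
      by move=> /(eqv_mix _ sv).2.
    by move=> /(eqv_mix _ sv).1.
  rewrite (addbe_nle sv) (addbe_nle (nle_up st sv)) !(sg_eq _ st sv).
  exact: (w_monoe W).
- exact: (w_frctr W).
- by move=> t s [x|] /=; [|case=> _]; exact: (w_frlt W).
- move=> t s [x|] /=; rewrite /D /= ?addbe_old; first exact: (w_frD W).
  by case=> h; rewrite addbe_nle //=; exact: (w_frD W).
- by move=> t s /(w_frex W) [x h]; exists (Some x).
- move=> t s x y; have [tv|tv] := pselect (le Z t v).
    move=> /(addfr_le tv) [x' -> h] /(addfr_le tv) [y' -> h'].
    by rewrite /eqv /= addbe_old; exact: (w_freq W) h h'.
  move=> /(addfr_nle _ _ tv) h /(addfr_nle _ _ tv) h'.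
  by rewrite /eqv /= addbe_nle //; exact: (w_freq W) h h'.
- move=> t s x y; have [tv|tv] := pselect (le Z t v).
    move=> /(addfr_le tv) [x' -> h]; case: y => [y|]; rewrite /eqv /= ?addbe_old.
      exact: (w_frcong W).
    by move=> /(eqv_mix _ tv).2.
  move=> /(addfr_nle _ _ tv) h; rewrite /eqv /= addbe_nle // => e.
  by apply/(addfr_nle _ _ tv); exact: (w_frcong W) h e.
- move=> t s1 s2 [x|] /=; first exact: (w_frcone W).
  case=> tv h l; split=> [[_ h']|h']; first exact: (w_frcone W h l).1 h'.
  by split=> //; exact: (w_frcone W h l).2 h'.
- move=> u t [x|] /=; rewrite /D /= ?addbe_old; first exact: (w_dom1 W).
  case=> uv f; have ut := (w_frlt W f).1.
  rewrite (addbe_nle (nle_up ut uv)) /= -(rho_eq ut) //; exact: (w_dom1 W f).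
- move=> u t p x y; have [uv|uv] := pselect (le Z u v); last first.
    move=> /[dup] /(w_addfrlt) [ut _]; move/(addfr_nle _ _ uv).
    rewrite /D /eqv /= (addbe_nle uv) (addbe_nle (nle_up ut uv)) !(sg_eq _ ut uv).
    exact: (w_eq1 W).
  move=> /(addfr_le uv) [F -> f].
  (* As u is below v and below t, it is below their meet w. If t is below v, or if u < w, the branch
     of the new point at $f_u(t)$ contains no old label; for u = w, [rho_branch] reduces the claim
     to [rho t]. *)
  have core z : D Z t z -> addbe t None None None ->
      ~ addbe u (Some F) None (Some z) -> addbe t None (Some z) (Some z).
    move=> dz dn nb; have [ut _] := w_frlt W f.
    have uz := w_mono W ut dz.
    have [tv|tv] := pselect (le Z t v); first by case: nb; exact: branch_le tv f uz.
    have [w g] := GB (fr_nd W f).2.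
    have [g1 g2 g3] := g; have uw : le Z u w by exact: g3.
    move: dn; rewrite (addbe_nle tv) /= => dr.
    have [e|n] := pselect (u = w).
      subst w; apply: (w_eq1 W f) => //.
      exact: (rho_branch g tv f (w_mono W ut dr) (rhoD_hk tv g dr) uz).1 nb.
    by case: nb; apply: (branch_le g2) uz; exact: (fr_down W f (le_lt uw n) g1).
  move: x y => [x|] [y|]; rewrite /D /eqv /= ?addbe_old.
  + exact: (w_eq1 W f).
  + move=> dx dn nb; apply: (pb_esym (addbe_preB t)); apply: core => //.
    by move=> h; apply: nb; apply: (pb_sym (addbe_preB u)).
  + by move=> dn dx nb; apply: core.
  + by [].
- move=> s t x y lst.
  (* [w_eq2] is applied to [rho t] from s', the larger of s and the meet w, so that the node u it
     finds is either w or not below v. *)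
  have core z : addbe t None (Some z) (Some z) ->
    exists u p, [/\ le Z s u, addfr u t p & ~ addbe u p None (Some z)].
    have [tv|tv] := pselect (le Z t v); first by move=> /(eqv_mix _ tv).1.
    rewrite (addbe_nle tv) /= => e.
    have [w g] := GB (w_nd W lst.1).2; have [g1 g2 g3] := g.
    have lwt : lt Z w t by split=> // e'; apply: tv; rewrite -e'.
    have [s' [ss' ws' ls']] : exists s', [/\ le Z s s', le Z w s' & lt Z s' t].
      case: (w_tree W lst.1 g1) => h; first by exists w; split=> //; apply: (w_refl W); exact: ndle g2.
      by exists s; split=> //; apply: (w_refl W); case: (w_nd W lst.1).
    have [u [p [su f n]]] := w_eq2 W ls' e.
    exists u, (Some p); split=> //; first exact: (w_trans W) ss' su.
    have [ut _] := w_frlt W f.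
    have [uv|uv] := pselect (le Z u v); last by rewrite addbe_nle //= (rho_eq ut).
    have e' : u = w by apply: (w_anti W); [exact: g3|exact: (w_trans W) ws' su].
    subst u; have [dr dz] := eqvD W e.
    by apply: (rho_branch g tv f (w_mono W ut dr) (rhoD_hk tv g dr) (w_mono W ut dz)).2.
  move: x y => [x|] [y|]; rewrite /eqv /= ?addbe_old.
  + move=> /(w_eq2 W lst) [u [p [su f n]]]; exists u, (Some p); split=> //.
    by rewrite addbe_old.
  + move=> /(pb_esym (addbe_preB t)) /core [u [p [su f n]]]; exists u, p; split=> //.
    by move=> /(pb_sym (addbe_preB u)).
  + exact: core.
  + move=> dn; have [p f] := w_frex W lst; exists s, (Some p).
    split=> //; first by apply: (w_refl W); case: (w_nd W lst.1).
    have [sv|sv] := pselect (le Z s v); first by rewrite addbe_le.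
    rewrite (addbe_nle sv) /= => e.
    have := w_dom1 W (w_frcong W f e); rewrite (rho_eq lst.1) //.
    by apply; move: dn; rewrite (addbe_nle (nle_up lst.1 sv)).
Qed.

(** The only label that may be lost without a cause is the new one, when it opens a branch at a =
    $f_v(t)$: no point of t corresponds to that branch yet. *)
Lemma addpt_dom2 : dom2 Z -> forall s t o, lt Z s t -> D addpt s o -> ~ D addpt t o ->
  (exists2 u, le Z s u & addfr u t o) \/
  [/\ o = None, k = None, le Z s v & fr Z v t a].
Proof.
move=> d2 s t [x|] lst; rewrite /D /= ?addbe_old.
  by move=> h1 h2; left; exact: d2.
move=> dn; have [tv|tv] := pselect (le Z t v).
  by rewrite (addbe_le tv) => /(_ I).
rewrite (addbe_nle tv) /= => ndr.
have [w g] := GB (w_nd W lst.1).2; have [g1 g2 g3] := g.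
have lwt : lt Z w t by split=> // e'; apply: tv; rewrite -e'.
have [w' [gw' hw]] := po_rho po (w_nd W lst.1).2 tv; have e := glb_uniq W gw' g; subst w'.
have dw : D Z w (rho t).
  case: hw => [[-> _]|[-> _ h]]; first exact: al_D.
  by case: (po_k po h).
have [s' [ss' ws' ls' ds']] : exists s', [/\ le Z s s', le Z w s', lt Z s' t & D Z s' (rho t)].
  case: (w_tree W lst.1 g1) => h; first by exists w; split=> //; apply: (w_refl W); exact: ndle g2.
  have [e|n] := pselect (s = w); first by exists w; subst w; split=> //; apply: (w_refl W); exact: ndle g2.
  exists s; split=> //; first by apply: (w_refl W); case: (w_nd W lst.1).
  have nsv : ~ le Z s v.
    by move=> h'; apply: n; apply: (w_anti W) => //; apply: g3 => //; case: lst.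
  by move: dn; rewrite addbe_nle //= (rho_eq lst.1).
have [u su f] := d2 _ _ _ ls' ds' ndr.
have [uv|uv] := pselect (le Z u v); last first.
  left; exists u; first exact: (w_trans W) ss' su.
  by split=> //; rewrite (rho_eq (w_frlt W f).1).
have e : u = w.
  by apply: (w_anti W); [apply: g3 => //; case: (w_frlt W f)|exact: (w_trans W) ws' su].
subst u; case: hw => [[e n]|[e fa kr]]; last first.
  have [_] := po_k po kr; case; rewrite -e in fa *; exact: (w_freq W fa f).
have [wv|wv] := pselect (w = v); last first.
  have := f; rewrite e => /(w_frcone W (po_al po (le_lt g2 wv)) lwt) [z [lz zv zt]].
  by case: (lt_irr W lz); exact: g3.
subst w; move: f; rewrite e (po_alv po) => f; right; split=> //.
  by case: n => // -[].
exact: (w_trans W) ss' su.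
Qed.

(** Among three branches that use the new point, it can be replaced by [al t], or by the label in
    [k] at v, so that the old [frs] applies. This breaks down only at a itself, which may receive
    its third branch. *)
Lemma addpt_frs : frs Z -> forall t o x y z, br3 addpt t o x y z ->
  (exists s, addfr t s o) \/
  [/\ t = v, k = None & exists2 b, o = Some b & eqv Z v a b].
Proof.
move=> fs t o x y z; have [tv|tv] := pselect (le Z t v); last first.
  rewrite /br3 /eqv /= (addbe_nle tv) => /fs [s f]; left; exists s.
  by apply/(addfr_nle _ _ tv).
have H := w_preB W t.
have core b x' y' : addbe t (Some b) None (Some x') -> addbe t (Some b) None (Some y') ->
   be Z t b x' y' -> ~ be Z t b x' x' -> ~ be Z t b y' y' ->
   (exists s, addfr t s (Some b)) \/
   [/\ t = v, k = None & exists2 b0, Some b = Some b0 & eqv Z v a b0].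
  rewrite addbe_le //= => -[h1 n1] [h2 n2] h3 n3 n4.
  have [e|n] := pselect (be Z t b (al t) (al t)); last first.
    by left; apply: (fs t b (al t) x' y').
  have [tv'|tv'] := pselect (t = v); last first.
    left; exists v; apply: (w_frcong W) (po_al po _) (eqv_sym W e) => //.
  subst t; rewrite (po_alv po) in e h1 h2.
  have e' := eqv_sym W e; rewrite /KK /dirK in n1 n2.
  have Hs := pb_sym H.
  case: k n1 n2 (po_k po) => [k0|] n1 n2 hk; last by right; split=> //; exists b.
  have [dk nk] := hk _ erefl.
  have sep q : be Z v b a q -> ~ (be Z v b (al v) (al v) /\ v = v /\
      be Z v q q q /\ ~ be Z v a k0 q) -> be Z v b k0 q.
    move=> hq nq; apply: contrapT => nb; apply: nq; rewrite (po_alv po).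
    split=> //; split=> //; split; first exact: (pb_domz H hq).
    by move=> h; apply: nb; apply: (pb_congl H e').
  left; apply: (fs v b k0 x' y'); split; split=> //; [exact: sep|exact: sep|].
  by move=> e2; apply: nk; apply: (eqv_trans W e').
have S := pb_sym (addbe_preB t).
have nN : addbe t None None None by rewrite addbe_le.
case: o x y z => [b|] [x|] [y|] [z|] [[]] /=; rewrite /eqv /= ?addbe_old.
- by move=> h1 h2 h3 [n1 n2 n3]; left; apply: (fs t b x y z).
- by move=> h1 /S h2 /S h3 [n1 n2 _]; apply: (core b x y).
- by move=> /S h1 h2 h3 [n1 _ n3]; apply: (core b x z).
- by move=> _ _; rewrite addbe_le.
- by move=> h1 h2 h3 [_ n1 n2]; apply: (core b y z).
- by move=> _ +; rewrite addbe_le.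
- by move=> +; rewrite addbe_le.
- by move=> +; rewrite addbe_le.
- rewrite addbe_le //= => -[_ _ h1] [_ _ h2] [_ _ h3]; exfalso; tauto.
all: by move=> _ _ _ [n1 n2 n3]; exfalso; tauto.
Qed.

(** The extra hypotheses exclude the two failures when a new branch is opened: a carries no node,
    and all other points lie in one branch at a, so that a does not become a ramification point. *)
Lemma addpt_ptb : ptb Z -> (k = None -> forall t, ~ fr Z v t a) ->
  (k = None -> forall y z, D Z v y -> D Z v z -> ~ eqv Z v a y -> ~ eqv Z v a z ->
     ~ be Z v a y z) -> ptb addpt.
Proof.
move=> [_ d2 fs] kfr kdeg; split; first exact: addpt_wptb.
  move=> u t o l h1 h2; case: (addpt_dom2 d2 l h1 h2) => // -[_ h3 _ h4].
  by case: (kfr h3 _ h4).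
move=> t o x y z hb; case: (addpt_frs fs hb) => // -[et ek [b eo eb]].
exfalso; subst t o; case: hb => -[]; rewrite /eqv /=.
have vv : le Z v v by apply: (w_refl W); exact: po_nd po.
have key y' z' : be Z v b y' z' -> ~ be Z v b y' y' -> ~ be Z v b z' z' -> False.
  move=> hb n1 n2; have H := w_preB W v.
  apply: (kdeg ek y' z'); [exact: (pb_domy H hb)|exact: (pb_domz H hb)| | |].
  - by move=> e; apply: n1; apply: (pb_congl H eb).
  - by move=> e; apply: n2; apply: (pb_congl H eb).
  - by apply: (pb_congl H (pb_esym H eb)).
case: x y z => [x|] [y|] [z|]; rewrite ?addbe_old.
- by move=> h1 _ _ [n1 n2 _]; exact: key h1 n1 n2.
- by move=> h1 _ _ [n1 n2 _]; exact: key h1 n1 n2.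
- by move=> _ h1 _ [n1 _ n2]; exact: key h1 n1 n2.
- by move=> _ _; rewrite addbe_le.
- by move=> _ _ h1 [_ n1 n2]; exact: key h1 n1 n2.
- by move=> _ +; rewrite addbe_le.
- by move=> +; rewrite addbe_le.
- by move=> +; rewrite addbe_le.
Qed.

End AddPoint.

Lemma position_ex (d : Order.disp_t) (C : orderType d) (P X : Type)
    (Z : @pst d C P X) (v : P) (a : X) (k : option X) :
  wptb Z -> nd Z v -> D Z v a ->
  (forall k0, k = Some k0 -> D Z v k0 /\ ~ eqv Z v a k0) ->
  (v = rt Z -> k = None /\ eqv Z v (ctr Z) a) ->
  exists al rho, position Z v a k al rho.
Proof.
move=> W nv da hk hr.
have /choice [al hal] : forall t, exists x : X,
    (t = v -> x = a) /\ (lt Z t v -> fr Z t v x).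
  move=> t; have [e|n] := pselect (t = v).
    by exists a; split=> // -[].
  have [l|l] := pselect (lt Z t v); last by exists a.
  by have [x hx] := w_frex W l; exists x.
have /choice [rho hrho] : forall t, exists r : X, nd Z t -> ~ le Z t v ->
   exists w, isglb Z w t v /\
    ((r = al w /\ (k = None \/ ~ (w = v /\ fr Z v t a))) \/
     [/\ w = v, fr Z v t a & k = Some r]).
  move=> t.
  have [nt|nt] := pselect (nd Z t); last by exists a.
  have [w g] := w_glb W nt nv.
  have [[e f]|n] := pselect (w = v /\ fr Z v t a); last first.
    by exists (al w) => _ _; exists w; split=> //; left; split=> //; right.
  case: k hk hr => [k0|] hk hr.
    by exists k0 => _ _; exists w; split=> //; right.
  by exists (al w) => _ _; exists w; split=> //; left; split=> //; left.
by exists al, rho; split=> //; [case: (hal v) => + _; apply|move=> t; case: (hal t)].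
Qed.

(** * Adding a node *)

Section AddNode.
Context {d : Order.disp_t} {C : orderType d}.
Variables (P X : Type) (Z : @pst d C P X).
Hypothesis W : wptb Z.
Variables (v : P) (a : X) (c : C) (x0 : option X).

(** The points of the new node are the branches of B(v) at a: [D0] collects the labels of points
    other than a, [sb] says that two of them lie in one branch, and [cc] is the branch chosen as
    centre of the star. *)
Definition sb (x y : X) : Prop := ~ be Z v a x y.
Definition D0 (x : X) : Prop := D Z v x /\ ~ eqv Z v a x.
Definition cc (x : X) : Prop := if x0 is Some x' then sb x' x else False.

(* The new node [None] lies above v in the cone of a, below the nodes which
   already are in this cone; its B-set is a star centred at x0 (x0 = None is
   only allowed if it has at most two points). *)
Record place : Prop := {
  pl_nd : nd Z v;
  pl_a : D Z v a;
  pl_rt : v = rt Z -> eqv Z v a (ctr Z);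
  pl_col : v <> rt Z -> (col Z v < c)%O;
  pl_colU : forall s, fr Z v s a -> (c < col Z s)%O;
  pl_x0 : forall x, x0 = Some x -> D0 x;
  pl_cc : forall s x, fr Z v s a -> cc x -> ~ D Z s x;
  pl_none : forall s, fr Z v s a -> x0 <> None;
  pl_two : (exists s, fr Z v s a) \/
    (forall x y z, D0 x -> D0 y -> D0 z -> ~ cc x -> ~ cc y -> ~ cc z ->
       [\/ sb x y, sb x z | sb y z]);
  pl_dom2 : forall s t x, lt Z s t -> D Z s x -> ~ D Z t x ->
    (exists2 u, le Z s u & fr Z u t x) \/ [/\ le Z s v, fr Z v t a, D0 x & cc x];
  pl_frs : forall t b x y z, br3 Z t b x y z ->
    (exists s, fr Z t s b) \/ (t = v /\ eqv Z v a b) }.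

Definition nodele (s t : option P) : Prop :=
  match s, t with
  | Some s, Some t => le Z s t
  | Some s, None => le Z s v
  | None, Some t => fr Z v t a
  | None, None => True
  end.

Definition nodebe (t : option P) : X -> X -> X -> Prop :=
  if t is Some t then be Z t else starb D0 sb cc.

Definition nodefr (t s : option P) (x : X) : Prop :=
  match t, s with
  | Some t, Some s => fr Z t s x
  | Some t, None => (t = v /\ eqv Z v a x) \/ fr Z t v x
  | None, Some s => [/\ fr Z v s a, D0 x & cc x]
  | None, None => False
  end.

Definition addnode : @pst d C (option P) X :=
  Pst (fun t => if t is Some t then nd Z t else True) nodele (Some (rt Z)) (ctr Z)
    (fun t => if t is Some t then col Z t else c) nodebe nodefr.

Hypothesis pl : place.

Lemma sb_refl x : D0 x -> sb x x. Proof. by case. Qed.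

Lemma sb_sym x y : sb x y -> sb y x.
Proof. by move=> h h'; apply: h; apply: (pb_sym (w_preB W v)). Qed.

Lemma sb_trans x y z : D0 y -> sb x y -> sb y z -> sb x z.
Proof. by case=> dy _; apply: (pb_brtrans (w_preB W v)). Qed.

Lemma eqv_sb x y : D0 x -> eqv Z v x y -> sb x y /\ D0 y.
Proof.
move=> [dx nx] e; have H := w_preB W v; split.
  by move=> h; apply: nx; apply: (pb_congr3 H (pb_esym H e)).
split; first by case: (eqvD W e).
by move=> e'; apply: nx; apply: (pb_etrans H e' (pb_esym H e)).
Qed.

Lemma cc_sb x y : D0 x -> sb x y -> cc x -> cc y.
Proof. by move=> dx; rewrite /cc; case: x0 => // x' h h'; apply: sb_trans h. Qed.

Lemma sb_cc x y : cc x -> cc y -> sb x y.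
Proof.
move: (pl_x0 pl); rewrite /cc; case: x0 => // x' hx h h'.
by apply: sb_trans (hx _ erefl) _ h'; exact: sb_sym.
Qed.

Lemma star_eqv x y : nodebe None x y y <-> [/\ D0 x, D0 y & sb x y].
Proof.
split=> [[dx dy _ h]|[dx dy h]]; last by split=> //; left.
by split=> //; case: h => [//|[//|[_ n]]]; case: (n (sb_refl dy)).
Qed.

Lemma star_D x : nodebe None x x x <-> D0 x.
Proof. by rewrite star_eqv; split=> [[]//|h]; split=> //; exact: sb_refl. Qed.

Lemma nodebe_preB t : preB (nodebe t).
Proof.
case: t => [t|]; first exact: (w_preB W).
apply: star_preB.
- exact: sb_refl.
- by move=> x y _ _; exact: sb_sym.
- by move=> x y z _ dy _; exact: sb_trans.
- by move=> x y dx _; exact: cc_sb.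
- by move=> x y _ _; exact: sb_cc.
- case E : x0 => [x'|].
    left; have dx := pl_x0 pl E; exists x' => //; rewrite /cc E; exact: sb_refl.
  right => x y z dx dy dz; have := pl_two pl; case=> [[s /(pl_none pl)]|] // h.
  have nc w : ~ cc w by rewrite /cc E.
  by case: (h x y z dx dy dz) => //; tauto.
Qed.

Lemma fr_ltv s : fr Z v s a -> lt Z v s. Proof. exact: (w_frlt W). Qed.

Lemma coneSS t s1 s2 : cone addnode (Some t) (Some s1) (Some s2) <-> cone Z t s1 s2.
Proof.
split=> [[[z|] [[l n] l1 l2]]|[z [[l n] l1 l2]]].
- by exists z; split=> //; split=> // e; apply: n; rewrite e.
- have [e|n'] := pselect (t = v); last first.
    by exists v; split; [|case: (fr_ltv l1)|case: (fr_ltv l2)].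
  by rewrite e; apply/(w_frcone W l1) => //; exact: fr_ltv.
- by exists (Some z); split=> //; split=> // -[].
Qed.

Lemma coneSN t s : le Z t v -> cone addnode (Some t) (Some s) None <->
  (lt Z t v /\ cone Z t s v) \/ (t = v /\ fr Z v s a).
Proof.
move=> tv; split=> [[[z|] [[l n] l1 l2]]|].
- left; have lz : lt Z t z by split=> // e; apply: n; rewrite e.
  by split; [exact: (lt_leT W lz)|exists z].
- have [e|n'] := pselect (t = v); first by right.
  left; split=> //; exists v; split=> //; first by case: (fr_ltv l1).
  by apply: (w_refl W); exact: pl_nd.
- case=> [[l [z [[h n] h1 h2]]]|[-> h]].
    by exists (Some z); split=> //; split=> // -[].
  exists None; split=> //; split=> //=; apply: (w_refl W); exact: pl_nd.
Qed.

(** The analogue of [same_branch_twin] when [dom2] may fail for the labels in [cc]: these are lost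
    at every node of the cone, hence together. *)
Lemma twin_v t x y : fr Z v t a -> D Z v y -> sb x y -> D Z t x -> D Z t y.
Proof.
move=> f dy h tx; apply: contrapT => ty.
have lvt := fr_ltv f; have dx := w_mono W lvt.1 tx.
have D0x : D0 x.
  by split=> // e; apply: (w_dom1 W f); apply/(eqvDE W lvt.1 e).
case: (pl_dom2 pl lvt dy ty) => [[u vu fu]|[_ _ dy' cy]]; last first.
  by apply: (pl_cc pl f) tx; apply: cc_sb dy' (sb_sym h) cy.
have lut := w_frlt W fu; have [e|ne] := pselect (v = u).
  subst u; apply: h; apply: (pb_sym (w_preB W v)); apply: (pb_eany (w_preB W v)) => //.
  exact: (w_freq W f fu).
have fsu : fr Z v u a by apply: (fr_down W f _ lut.1).
have ux : D Z u x := w_mono W lut.1 tx.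
have e := w_eq1 W fsu ux (w_frD W fu) h.
exact: (w_dom1 W (w_frcong W fu (eqv_sym W e))).
Qed.

Lemma D0_up t x : fr Z v t a -> D Z t x -> D0 x.
Proof.
move=> f tx; have l := (fr_ltv f).1; split; first exact: (w_mono W) l tx.
by move=> e; apply: (w_dom1 W f); apply/(eqvDE W l e).
Qed.

Lemma vv x : ~ fr Z v v x.
Proof. by case/(w_frlt W). Qed.

Lemma nodefr_exx s : fr Z v s a -> exists2 x, D0 x & cc x.
Proof.
move=> /(pl_none pl); rewrite /cc; case E : x0 => [x|] // _.
have dx := pl_x0 pl E; by exists x => //; exact: sb_refl.
Qed.

(** The new node lies below both s and t only if they are in one cone at v, and then it lies below
    their meet. *)
Lemma addnode_glb m s t : isglb Z m s t -> isglb addnode (Some m) (Some s) (Some t).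
Proof.
move=> [h1 h2 h3]; split=> //= -[w|] /=; first exact: h3.
move=> f1 f2; have [z [lz zs zt]] : cone Z v s t by apply/(w_frcone W f1) => //; exact: fr_ltv.
by apply: (fr_down W f1 _ h1); exact: (lt_leT W lz (h3 _ zs zt)).
Qed.

Lemma addnode_glbN m t : isglb Z m t v -> ~ fr Z v t a ->
  isglb addnode (Some m) (Some t) None.
Proof. by move=> [h1 h2 h3] n; split=> //= -[w|] /=; [exact: h3|move/n]. Qed.

Lemma addnode_wptb : wptb addnode.
Proof.
have nv := pl_nd pl; have vlev : le Z v v by exact: (w_refl W).
split.
- move=> [s|] [t|] //=; first exact: (w_nd W).
    by case/(w_nd W).
  by move=> /fr_ltv [/(w_nd W) []].
- by move=> [t|] //=; exact: (w_refl W).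
- move=> [s|] [t|] [u|] //=; try exact: (w_trans W).
  + by move=> h /fr_ltv [h' _]; exact: (w_trans W) h h'.
  + by move=> h h'; exact: (fr_up W h h').
- move=> [s|] [t|] //=.
  + by move=> h h'; rewrite (w_anti W h h').
  + by move=> h /fr_ltv h'; case: (lt_irr W h').
  + by move=> /fr_ltv h' h; case: (lt_irr W h').
- move=> [x|] [y|] [z|] //=; try exact: (w_tree W); try by auto.
  + move=> h1 f; have [h2 _] := fr_ltv f; case: (w_tree W h1 h2) => h; first by left.
    have [e|n] := pselect (y = v); first by left; rewrite e.
    by right; apply: (fr_down W f _ h1); split=> // e; apply: n.
  + move=> f h1; have [h2 _] := fr_ltv f; case: (w_tree W h1 h2) => h; first by right.
    have [e|n] := pselect (z = v); first by right; rewrite e.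
    by left; apply: (fr_down W f _ h1); split=> // e; apply: n.
- have gN t : nd Z t -> exists m, isglb addnode m (Some t) None.
    move=> nt; have [f|n] := pselect (fr Z v t a).
      by exists None; split=> //=.
    by have [m g] := w_glb W nt nv; exists (Some m); exact: addnode_glbN.
  move=> [s|] [t|] /=.
  + by move=> ns nt; have [m g] := w_glb W ns nt; exists (Some m); exact: addnode_glb.
  + by move=> h _; exact: gN.
  + by move=> _ /gN [m [h1 h2 h3]]; exists m; split=> // w h4 h5; apply: h3.
  + by exists None.
- by move=> [t|] /=; [exact: (w_rt W)|move=> _; exact: (w_rt W)].
- exact: (w_ndrt W).
- have cN t : lt addnode (Some (rt Z)) (Some t) -> cone addnode (Some (rt Z)) (Some t) None.
    move=> [h n]; have l : lt Z (rt Z) t by split=> // e; apply: n; rewrite e.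
    apply/coneSN; first exact: (w_rt W).
    have [e|n'] := pselect (rt Z = v).
      right; split=> //; apply: (w_frcong W (x := ctr Z)); last exact: (eqv_sym W (pl_rt pl (esym e))).
      by rewrite -e; exact: (w_frctr W).
    have l' : lt Z (rt Z) v by split=> //; exact: (w_rt W).
    by left; split=> //; exact: (w_cone W).
  move=> [s|] [t|] h1 h2.
  + by apply/coneSS; apply: (w_cone W); [case: h1|case: h2] => h n; split=> // e; apply: n; exact: (congr1 Some e).
  + exact: cN.
  + by apply: cone_sym; apply: cN.
  + by exists None; split.
- move=> [s|] [t|] [h n] n' /=.
  + by apply: (w_col W); [split=> // e; apply: n; rewrite e|move=> e; apply: n'; rewrite e].
  + have ns : s <> rt Z by move=> e; apply: n'; rewrite e.
    have nv' : v <> rt Z.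
      by move=> e; apply: ns; apply: (w_anti W); [rewrite -e|apply: (w_rt W); case: (w_nd W h)].
    have cv := pl_col pl nv'; have [->//|n2] := pselect (s = v).
    by apply: (Order.POrderTheory.lt_trans _ cv); apply: (w_col W).
  + exact: (pl_colU pl h).
  + by case: n.
- by move=> [t|] x y z //=; exact: (w_be W).
- exact: nodebe_preB.
- exact: (w_ctr W).
- exact: (w_star W).
- move=> [s|] [t|] x; rewrite /D /=.
  + exact: (w_mono W).
  + by move=> h /star_D [dx _]; exact: (w_mono W h).
  + by move=> f tx; apply/star_D; exact: D0_up f tx.
  + by [].
- move=> [s|] [t|] x y; rewrite /D /eqv /=.
  + exact: (w_monoe W).
  + move=> h e /star_D dx; have [h1 h2] := eqv_sb dx (w_monoe W h e dx.1).
    by apply/star_eqv.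
  + move=> f /star_eqv [dx dy h] tx.
    by apply: (w_eq1 W f) => //; exact: twin_v f dy.1 h tx.
  + by [].
- move=> [s|] [h n] /=.
    by apply: (w_frctr W); split=> // e; apply: n; exact: (congr1 Some e).
  have [e|n'] := pselect (rt Z = v); last by right; apply: (w_frctr W).
  by left; split=> //; exact: (pl_rt pl).
- move=> [t|] [s|] x //=.
  + by move=> /(w_frlt W) [h n]; split=> // -[].
  + by case=> [[-> _]|/(w_frlt W) [h _]]; split.
  + by case=> h _ _; split.
- move=> [t|] [s|] x //=.
  + exact: (w_frD W).
  + case=> [[-> e]|]; last exact: (w_frD W).
    by case: (eqvD W e).
  + by case=> _ h _; apply/star_D.
- move=> [t|] [s|] [h n] /=.
  + by apply: (w_frex W); split=> // e; apply: n; rewrite e.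
  + have [->|n'] := pselect (t = v); first by exists a; left; split=> //; exact: pl_a.
    by have [x hx] := w_frex W (conj h n'); exists x; right.
  + by have [x h1 h2] := nodefr_exx h; exists x.
  + by case: n.
- move=> [t|] [s|] x y //=; rewrite /eqv /=.
  + exact: (w_freq W).
  + case=> [[-> e]|f] [[e1 e2]|f'].
    * exact: (eqv_trans W (eqv_sym W e) e2).
    * by case: (vv f').
    * by subst t; case: (vv f).
    * exact: (w_freq W f f').
  + by case=> _ h1 h2 [_ h3 h4]; apply/star_eqv; split=> //; exact: sb_cc.
- move=> [t|] [s|] x y //=; rewrite /eqv /=.
  + exact: (w_frcong W).
  + case=> [[-> e] e'|f e]; last by right; exact: (w_frcong W f e).
    by left; split=> //; exact: (eqv_trans W e e').
  + by case=> f h1 h2 /star_eqv [_ h3 h4]; split=> //; exact: cc_sb h4 h2.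
- move=> [t|] [s1|] [s2|] x //= h1 [h2 n2].
  + rewrite coneSS; apply: (w_frcone W h1); split=> // e; apply: n2; rewrite e //.
  + rewrite coneSN //; have l1 := w_frlt W h1; have [e|n] := pselect (t = v).
      subst t; split.
        by case=> [[_ e]|/vv//]; right; split=> //; exact: (w_frcong W h1 (eqv_sym W e)).
      by case=> [[[]]//|[_ f]]; left; split=> //; exact: (w_freq W f h1).
    split=> [[[]//|f]|[[l cn]|[]//]].
      by left; split=> //; apply/(w_frcone W h1).
    by right; apply/(w_frcone W h1).
  + have l2 : lt Z t s2 by split=> // e; apply: n2; rewrite e.
    have -> : cone addnode (Some t) None (Some s2) = cone addnode (Some t) (Some s2) None.
      by apply/propext; split; exact: cone_sym.
    case: h1 => [[e h1]|h1].
      subst t; rewrite coneSN //; split=> [f|[[[]]//|[_ f]]].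
        by right; split=> //; exact: (w_frcong W f (eqv_sym W h1)).
      exact: (w_frcong W f h1).
    have l1 := w_frlt W h1; rewrite coneSN //; last by case: l1.
    split=> [f|[[_ cn]|[e _]]]; last by subst t; case: (vv h1).
      by left; split=> //; apply/(w_frcone W f).
    by apply/(w_frcone W h1) => //; exact: cone_sym.
  + by split=> // _; exists None; split.
  + case: h1 => f dx cx; split=> // _.
    have [z [lz z1 z2]] : cone Z v s1 s2 by apply/(w_frcone W f) => //; exact: fr_ltv.
    by exists (Some z); split=> //; split=> //=; exact: (fr_down W f lz z1).
  + by case: n2.
- move=> [u|] [t|] x //=; rewrite /D /=.
  + exact: (w_dom1 W).
  + by case=> [[_ e]|f] /star_D [h1 h2] //; exact: (w_dom1 W f h1).
  + by case=> f _ h; exact: (pl_cc pl f h).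
- move=> [u|] [t|] p x y //=; rewrite /D /eqv /=.
  + exact: (w_eq1 W).
  + case=> [[-> e]|f] /star_D dx /star_D dy n; apply/star_eqv; split=> //.
      by move=> h; apply: n; apply: (pb_congl (w_preB W v) e).
    by case: (eqv_sb dx (w_eq1 W f dx.1 dy.1 n)).
  + case=> f dp cp tx ty n; apply: (w_eq1 W f) => // h; apply: n.
    split=> //; [exact: D0_up f tx|exact: D0_up f ty|].
    by right; right; split=> //; apply.
- move=> [s|] [t|] x y [h n] //=; rewrite /eqv /=.
  + have l : lt Z s t by split=> // e; apply: n; rewrite e.
    by move=> e; have [u [p [h1 h2 h3]]] := w_eq2 W l e; exists (Some u), p.
  + by move=> /star_eqv [dx dy hs]; exists (Some v), a; split=> //; left; split=> //; exact: pl_a.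
  + move=> e; have [u [p [h1 h2 h3]]] := w_eq2 W (fr_ltv h) e.
    have [e'|n'] := pselect (v = u); last first.
      exists (Some u), p; split=> //=.
      by apply: (fr_down W h) => //; case: (w_frlt W h2).
    (* The cause of the identification sits at v, so x and y are already one point of the new star,
       and hence in one branch at its centre q, which represents t there. *)
    subst u; have [q dq cq] := nodefr_exx h; exists None, q; split=> //.
    have [tx ty] := eqvD W e.
    case=> _ dx dy; case=> [hs|[hs|[_ hs]]].
    * by apply: (pl_cc pl h) tx; exact: cc_sb hs cq.
    * by apply: (pl_cc pl h) ty; exact: cc_sb hs cq.
    * apply: hs => hb; apply: h3; apply: (pb_congl (w_preB W v)) hb.
      exact: (w_freq W h h2).
Qed.

(** The failures tolerated by [place] disappear: labels in [cc] are now lost as the centre of the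
    new star, and a is now $f_v$ of the new node. If there is no older node to be represented by the
    centre, [pl_two] leaves too few points for it to ramify. *)
Lemma addnode_ptb : ptb addnode.
Proof.
split; first exact: addnode_wptb.
- move=> [s|] [t|] x [h n]; rewrite /D /=.
  + move=> h1 h2; have l : lt Z s t by split=> // e; apply: n; rewrite e.
    case: (pl_dom2 pl l h1 h2) => [[u u1 u2]|[u1 u2 u3 u4]]; first by exists (Some u).
    by exists None.
  + move=> h1 h2; have [vx|vx] := pselect (D Z v x).
      exists (Some v) => /=; first exact: h.
      by left; split=> //; apply: contrapT => e; apply: h2; apply/star_D.
    have l : lt Z s v by split=> // e; apply: vx; rewrite -e.
    case: (pl_dom2 pl l h1 vx) => [[u u1 u2]|[_ /vv//]].
    by exists (Some u) => //; right.
  + move=> /star_D dx h2; case: (pl_dom2 pl (fr_ltv h) dx.1 h2) => [[u u1 u2]|[u1 u2 u3 u4]].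
      have [e|n'] := pselect (v = u).
        by subst u; case: dx => _ []; exact: (w_freq W h u2).
      by exists (Some u) => //=; apply: (fr_down W h) => //; case: (w_frlt W u2).
    by exists None.
  + by case: n.
- move=> [t|] b x y z.
    by move=> /(pl_frs pl) [[s h]|[-> e]]; [exists (Some s)|exists None; left].
  move=> [[b1 b2 b3] [n1 n2 n3]].
  have [db dx dy _] := b1; have [_ _ dz _] := b2.
  have s1 : ~ sb b x by move=> h; apply: n1; apply/star_eqv.
  have s2 : ~ sb b y by move=> h; apply: n2; apply/star_eqv.
  have s3 : ~ sb b z by move=> h; apply: n3; apply/star_eqv.
  have [e1 e2 e3] : [/\ ~ sb x y, ~ sb x z & ~ sb y z].
    by case: b1 => _ _ _; case: b2 => _ _ _; case: b3 => _ _ _; split; tauto.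
  have cb : cc b by case: b1 => _ _ _; tauto.
  case: (pl_two pl) => [[s f]|h]; first by exists (Some s).
  have nc w : ~ sb b w -> ~ cc w by move=> hn hw; apply: hn; exact: sb_cc.
  by case: (h x y z dx dy dz (nc _ s1) (nc _ s2) (nc _ s3)).
Qed.

End AddNode.

(** * Extending embeddings along one-step extensions *)

Definition ext (X Y : Type) (h : X -> Y) (m : Y) (o : option X) : Y :=
  if o is Some x then h x else m.

Section NearIso.
Variables (X Y : Type) (b0 : X -> X -> X -> Prop) (b : Y -> Y -> Y -> Prop).
Variables (h : X -> Y) (dom : X -> Prop) (m : Y).
Hypotheses (H0 : preB b0) (H : preB b).
Hypothesis iso : forall x y z, dom x -> dom y -> dom z ->
  (b (h x) (h y) (h z) <-> b0 x y z).
Hypothesis Dm : b m m m.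

(** Seen from the image of h, the point m lies as [None] does in [near b0 a K]. *)
Definition adjacent (a : X) (K : X -> Prop) : Prop :=
  [/\ forall y, b0 y y y -> ~ b m (h y) (h y),
      forall y z, b0 y y y -> b0 z z z ->
        (b m (h y) (h z) <-> (K y /\ ~ K z) \/ (~ K y /\ K z)) &
      forall y z, b0 y y y -> b0 z z z ->
        (b (h y) m (h z) <-> b0 y a z /\ ~ (b0 y a a /\ K z))].

Lemma near_iso a K : adjacent a K ->
  forall x y z, (forall x', x = Some x' -> dom x') -> (forall x', y = Some x' -> dom x') ->
   (forall x', z = Some x' -> dom x') ->
  (b (ext h m x) (ext h m y) (ext h m z) <-> near b0 a K x y z).
Proof.
move=> [n1 n2 n3].
have D x : dom x -> (b (h x) (h x) (h x) <-> b0 x x x) by move=> dx; apply: iso.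
have D0 x : dom x -> b (h x) (h x) (h x) -> b0 x x x by move=> dx; rewrite D.
move=> [x|] [y|] [z|] /= dx dy dz;
  try (move: (dx _ erefl) => {}dx); try (move: (dy _ erefl) => {}dy);
  try (move: (dz _ erefl) => {}dz).
- exact: iso.
- have S : b (h x) (h y) m <-> b (h x) m (h y) by split; apply: (pb_sym H).
  rewrite S; split=> [/[dup] /(pb_dom H) [/D0-/(_ dx) ex _ /D0-/(_ dy) ey]|].
    by move/(n3 _ _ ex ey).
  move=> [h1 h2]; have [ex _ ey] := pb_dom H0 h1.
  by apply/(n3 _ _ ex ey).
- split=> [/[dup] /(pb_dom H) [/D0-/(_ dx) ex _ /D0-/(_ dz) ez]|].
    by move/(n3 _ _ ex ez).
  move=> [h1 h2]; have [ex _ ez] := pb_dom H0 h1.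
  by apply/(n3 _ _ ex ez).
- split=> // e; have [/D0-/(_ dx) ex _ _] := pb_dom H e.
  exact: (n1 x ex (pb_esym H e)).
- split=> [/[dup] /(pb_dom H) [_ /D0-/(_ dy) ey /D0-/(_ dz) ez]|[ey ez h1]].
    by move/(n2 _ _ ey ez).
  by apply/(n2 _ _ ey ez).
- split=> [/(pb_dom H) [_ /D0 ey _]|ey]; first exact: ey.
  by apply: (pb_refr H) => //; apply/D.
- split=> [/(pb_dom H) [_ _ /D0 ey]|ey]; first exact: ey.
  by apply: (pb_refl H) => //; apply/D.
- by [].
Qed.

(** When [h a] lies between m and every image point, m relates to the image through [h a] alone,
    like a leaf hung at a. *)
Lemma gate_adjacent a : dom a -> (forall x, b0 x x x -> dom x) -> b0 a a a ->
  ~ b m (h a) (h a) -> (forall y, b0 y y y -> b (h a) m (h y)) ->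
  adjacent a (fun _ => False).
Proof.
move=> da dd Da na g.
have L y : b0 y y y -> b m (h a) (h y) -> False.
  by move=> dy h1; apply: na; apply: (pb_eq H h1); exact: g.
split.
- move=> y dy e; apply: na; apply: (pb_esym H).
  by apply: (pb_congr3 H (pb_esym H e)); exact: g.
- move=> y z dy dz; split; last by tauto.
  have Dha : b (h a) (h a) (h a) by apply/iso.
  move=> /(pb_split H) /(_ Dha) [/(pb_sym H)|]; by move/L => [].
- move=> y z dy dz; have Dha : b (h a) (h a) (h a) by apply/iso.
  have ia : b0 y a z <-> b (h y) (h a) (h z) by symmetry; apply: iso; auto.
  split.
    move=> h1; split; last by case.
    apply/ia; case: (pb_split H h1 Dha) => // h2.
    apply: (pb_eany H); last exact: (pb_domz H h1).
    by apply: (pb_eq H (pb_sym H h2)); apply: (pb_sym H); exact: g.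
  move=> [/ia h1 _]; case: (pb_split H h1 Dm) => // h2.
  have e : b (h y) (h a) (h a).
    by apply: (pb_eq H h2); apply: (pb_sym H); exact: g.
  by apply: (pb_congl H (pb_esym H e)); exact: g.
Qed.

(** Since nothing lies strictly between a and k, a point m between their images sits on the edge
    from a to k, and splits the image into the side of k, which is its branch at a, and the side of
    a. *)
Lemma between_adjacent a k : (forall x, b0 x x x -> dom x) -> b0 a a a -> b0 k k k ->
  b m (h a) (h k) -> ~ b m (h a) (h a) -> ~ b m (h k) (h k) ->
  (forall y, b0 y a k -> b0 y a a \/ b0 y k k) ->
  adjacent a (dirK b0 a (Some k)).
Proof.
move=> dd Da Dk hm na nk adj.
have Dha : b (h a) (h a) (h a) by apply/iso; auto.
have Dhk : b (h k) (h k) (h k) by apply/iso; auto.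
have nak : ~ b0 a k k.
  move=> e; have e' : b (h a) (h k) (h k) by apply/iso; auto.
  by apply: nk; apply: (pb_congr H e').
have nm y : b0 y y y -> ~ b m (h y) (h y).
  move=> dy e; have : b (h y) (h a) (h k) by apply: (pb_congl H e).
  move=> /(iso (dd _ dy) (dd _ Da) (dd _ Dk)) /adj [] e'.
    have e2 : b (h y) (h a) (h a) by apply/iso; auto.
    by apply: na; apply: (pb_etrans H e).
  have e2 : b (h y) (h k) (h k) by apply/iso; auto.
  by apply: nk; apply: (pb_etrans H e).
have ha : ~ b (h a) m (h k) by move=> h1; apply: na; exact: (pb_eq H hm h1).
have hk : ~ b (h k) m (h a).
  by move=> h1; apply: nk; exact: (pb_eq H (pb_sym H hm) h1).
have side p q y : b m p q -> b y y y -> ~ b m q q -> ~ b q m p ->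
    b q p y -> [/\ b m p y, ~ b m q y & b q m y].
  move=> h1 Dy nq nq' h2.
  have h3 : b q m y by case: (pb_split H h2 Dm) => // /(pb_sym H).
  have h4 : ~ b m q y by move=> h5; apply: nq; exact: (pb_eq H h5 h3).
  by split=> //; case: (pb_split H h1 Dy) => // /(pb_sym H).
have FK y : b0 y y y -> ~ b0 a k y ->
    [/\ b m (h a) (h y), ~ b m (h k) (h y) & b (h k) m (h y)].
  move=> dy n; apply: (side _ _ (h y) hm) => //; first by apply/iso; auto.
  apply/iso; auto.
  have [h1|h1] := pselect (b0 k a y) => //.
  (* The centroid of a, k and y lies between a and k, so it is one of them; it is not a, because y
     lies in the branch of k at a. *)
  have [u [u1 u2 u3]] : exists u, [/\ b0 u a k, b0 u a y & b0 u k y].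
    have [h2|h2] := pselect (b0 y a k).
      by exists y; split=> //; [exact: pb_refr|exact: pb_refr].
    by apply: (pb_pos H0 Da Dk dy n h1 h2).
  case: (adj _ u1) => e; last exact: (pb_congl H0 e).
  by case: n; apply: (pb_congl H0 e).
have FN y : b0 y y y -> b0 a k y ->
    [/\ b m (h k) (h y), ~ b m (h a) (h y) & b (h a) m (h y)].
  move=> dy n; apply: (side _ _ (h y) (pb_sym H hm)) => //; first by apply/iso; auto.
  by apply/iso; auto.
have mid y : b0 y y y -> b (h y) m (h a) -> b0 y a a.
  move=> dy h1; have Dhy : b (h y) (h y) (h y) by apply/iso; auto.
  have h2 : b m (h y) (h k).
    case: (pb_split H hm Dhy) => // /(pb_sym H) h2.
    by case: (nm y dy); exact: (pb_eq H h2).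
  have h3 : b (h y) (h a) (h k).
    case: (pb_split H (pb_sym H h1) Dhk) => // h3.
    by case: (nm y dy); apply: (pb_eq H h2); exact: (pb_sym H).
  have /adj [//|e] : b0 y a k by apply/iso; auto.
  case: hk; apply: (pb_congl H) h1.
  by apply/iso; auto.
have KE y : b0 y y y -> (dirK b0 a (Some k) y <-> ~ b0 a k y).
  by move=> dy; split=> [[]|].
split.
- exact: nm.
- move=> y z dy dz; rewrite (KE y dy) (KE z dz); have Dhy : b (h y) (h y) (h y) by apply/iso; auto.
  have Dhz : b (h z) (h z) (h z) by apply/iso; auto.
  have [ky|ky] := pselect (b0 a k y); have [kz|kz] := pselect (b0 a k z).
  + have [a1 a2 a3] := FN y dy ky; have [c1 c2 c3] := FN z dz kz.
    split; last by tauto.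
    by move=> h1; case: (pb_split H h1 Dha) => [/(pb_sym H)|].
  + have [a1 a2 a3] := FN y dy ky; have [c1 c2 c3] := FK z dz kz.
    split=> _; first by tauto.
    by case: (pb_split H c1 Dhy) => // /(pb_sym H).
  + have [a1 a2 a3] := FK y dy ky; have [c1 c2 c3] := FN z dz kz.
    split=> _; first by tauto.
    by case: (pb_split H a1 Dhz) => // /(pb_sym H).
  + have [a1 a2 a3] := FK y dy ky; have [c1 c2 c3] := FK z dz kz.
    split; last by tauto.
    by move=> h1; case: (pb_split H h1 Dhk) => [/(pb_sym H)|].
- move=> y z dy dz; have Dhy : b (h y) (h y) (h y) by apply/iso; auto.
  have Dhz : b (h z) (h z) (h z) by apply/iso; auto.
  have iay : b (h y) (h a) (h z) <-> b0 y a z by apply: iso; auto.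
  have ea : b0 y a a -> b (h y) (h a) (h a) by move=> e; apply/iso; auto.
  split=> [h1|[/iay h1 n]].
    have [kz|kz] := pselect (b0 a k z).
      split; last by case=> _ [].
      apply/iay; case: (pb_split H h1 Dha) => // /mid-/(_ dy) /ea e.
      exact: (pb_eany H e).
    have [c1 c2 c3] := FK z dz kz.
    split.
      apply/iay; case: (pb_split H h1 Dha) => // h2.
      case: (nm y dy); case: (pb_split H c1 Dhy) => [/(pb_sym H)|] h3; exact: (pb_eq H h3).
    case=> /ea e _; apply: na; apply: (pb_eq H c1).
    exact: (pb_congl H e h1).
  case: (pb_split H h1 Dm) => // /(pb_sym H) /(mid y dy) e.
  have [kz|kz] := pselect (b0 a k z); last by case: n.
  have [_ _ c3] := FN z dz kz.
  by apply: (pb_congl H (pb_esym H (ea e))).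
Qed.

End NearIso.

Section Extend.
Context {d : Order.disp_t} {C : orderType d}.
Variables (P X Q Y : Type) (Z : @pst d C P X) (V : @pst d C Q Y).
Variables (f : P -> Q) (h : X -> Y).
Hypotheses (W : wptb Z) (WV : wptb V) (VD : dom2 V) (E : emb Z V f h).

Lemma D_rt t x : D Z t x -> D Z (rt Z) x.
Proof. by move=> dx; exact: (w_mono W (w_rt W (w_be W dx)) dx). Qed.

Lemma emb_D t x : nd Z t -> D Z (rt Z) x -> (D V (f t) (h x) <-> D Z t x).
Proof. by move=> nt dx; apply: (e_be E). Qed.

Lemma emb_lt s t : lt Z s t -> lt V (f s) (f t).
Proof.
move=> [l n]; have [ns nt] := w_nd W l; split; first exact/(e_le E).
move=> e; apply: n; apply: (w_anti W) => //; apply/(e_le E) => //.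
by rewrite e; apply: (w_refl WV); exact: (e_nd E).
Qed.

Lemma emb_eqv t x y : nd Z t -> D Z (rt Z) x -> D Z (rt Z) y ->
  (eqv V (f t) (h x) (h y) <-> eqv Z t x y).
Proof. by move=> nt dx dy; apply: (e_be E). Qed.

Lemma emb_fr t s x : lt Z t s -> D Z t x -> fr V (f t) (f s) (h x) -> fr Z t s x.
Proof.
move=> l dx fx; have [y fy] := w_frex W l; apply: (w_frcong W fy).
have nt : nd Z t := (w_nd W l.1).1.
apply/(emb_eqv nt (D_rt (w_frD W fy)) (D_rt dx)).
exact: (w_freq WV (e_fr E fy) fx).
Qed.

Section Point.
Variables (v : P) (a : X) (k : option X) (al rho : P -> X) (m : Y).
Hypothesis po : position Z v a k al rho.
Hypothesis Dm : D V (f v) m.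
Hypothesis adj : adjacent (be Z v) (be V (f v)) h m a (dirK (be Z v) a k).
Hypothesis m_cone : k = None -> forall s, fr Z v s a -> ~ D V (f s) m.

Let iso t : nd Z t -> forall x y z, D Z (rt Z) x -> D Z (rt Z) y -> D Z (rt Z) z ->
  (be V (f t) (h x) (h y) (h z) <-> be Z t x y z).
Proof. by move=> nt x y z; exact: (e_be E). Qed.

Lemma Dm_le t : le Z t v -> D V (f t) m.
Proof.
move=> l; have [nt nv] := w_nd W l; apply: (w_mono WV) Dm; exact/(e_le E).
Qed.

(** Below v the image of [al t] is a gate for m: a label y in the branch of m at $f_t(v)$ would be
    equal to m at v by [same_branch_twin], contrary to [adj]. *)
Lemma adj_le t : le Z t v ->
  adjacent (be Z t) (be V (f t)) h m (al t) (KK Z v a k t).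
Proof.
move=> tv; have [nt nv] := w_nd W tv.
have [e|n] := pselect (t = v).
  subst t; rewrite (po_alv po); have [n1 n2 n3] := adj.
  have KE y : KK Z v a k v y <-> dirK (be Z v) a k y.
    by rewrite /KK; split=> [[]|].
  by split=> // y z dy dz; rewrite ?KE; auto.
have ltv : lt Z t v by [].
have fa := po_al po ltv; have da := al_D W po tv.
have Kn : KK Z v a k t = fun _ => False.
  by apply/funext => y; apply/propext; split=> //; exact: KK_lt.
have Fa := e_fr E fa; have Dmt := Dm_le tv; have lV := w_frlt WV Fa.
have [n1 _ _] := adj.
rewrite Kn; apply: (gate_adjacent (w_preB WV (f t)) (iso nt)) => //.
- exact: D_rt da.
- by move=> x; exact: D_rt.
- move=> e; apply: (w_dom1 WV Fa); apply/(eqvDE WV lV.1 e) => //.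
- move=> y dy; apply: contrapT => nb; have dy' := D_rt dy.
  have Dy : D V (f t) (h y) by apply/emb_D.
  have [tw1 tw2] := same_branch_twin WV VD Fa Dmt Dy nb.
  apply: (n1 y); last exact: tw2.
  by apply/(emb_D nv dy')/tw1.
Qed.

Let eh := ext h m.

Lemma addpt_be_le t x y z : le Z t v ->
  D (addpt Z v a k al rho) (rt Z) x -> D (addpt Z v a k al rho) (rt Z) y ->
  D (addpt Z v a k al rho) (rt Z) z ->
  (be V (f t) (eh x) (eh y) (eh z) <-> addbe Z v a k al rho t x y z).
Proof.
move=> tv; have [nt nv] := w_nd W tv.
have dr o x' : D (addpt Z v a k al rho) (rt Z) o -> o = Some x' -> D Z (rt Z) x'.
  by move=> + e; rewrite e /D /= addbe_old.
move=> dx dy dz; rewrite addbe_le //.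
apply: (near_iso (w_preB W t) (w_preB WV (f t)) (iso nt) (Dm_le tv) (adj_le tv)).
- by move=> x'; apply: dr.
- by move=> x'; apply: dr.
- by move=> x'; apply: dr.
Qed.

(** With w the meet of t and v, m and [rho t] lie in one branch at $f_w(t)$, so [same_branch_twin]
    applies. In the exceptional case both are lost, m because of [m_cone]. *)
Lemma rho_twin t : nd Z t -> ~ le Z t v ->
  (D V (f t) m <-> D Z t (rho t)) /\ (D Z t (rho t) -> eqv V (f t) m (h (rho t))).
Proof.
move=> nt ntv; have [w g dr] := rho_Drt W po nt ntv; have [g1 g2 g3] := g.
have lwt : lt Z w t by split=> // e; apply: ntv; rewrite -e.
have [F fF] := w_frex W lwt; have FF := e_fr E fF.
have nw : nd Z w := (w_nd W g1).1.
have drr := D_rt dr; have E1 := emb_D nt drr.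
have [[kn wv fa]|n] := pselect [/\ k = None, w = v & fr Z v t a].
  have n1 := m_cone kn fa.
  have n2 : ~ D Z t (rho t) by move=> dt; exact: (rhoD_hk W po ntv g dt kn wv fa).
  by split=> //; split.
have hk : k = None -> w = v -> ~ fr Z v t a by move=> kn wv fa; apply: n; split.
have nb : ~ be V (f w) (h F) m (h (rho t)).
  have dF := D_rt (w_frD W fF).
  have rr : D (addpt Z v a k al rho) (rt Z) None.
    by rewrite /D /= addbe_le //; apply: (w_rt W); case: (w_nd W g2).
  have := @addpt_be_le w (Some F) None (Some (rho t)) g2.
  rewrite /D /= !addbe_old => /(_ dF rr drr) ->.
  apply: (rho_branch W po g ntv fF dr hk dr).2.
  exact: (rho_neq W po g ntv fF hk).
have [t1 t2] := same_branch_twin WV VD FF (Dm_le g2) ((emb_D nw drr).2 dr) nb.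
by split; [rewrite t1|move=> /E1 /t1].
Qed.

Lemma emb_addpt : emb (addpt Z v a k al rho) V f eh.
Proof.
have dr o x' : D (addpt Z v a k al rho) (rt Z) o -> o = Some x' -> D Z (rt Z) x'.
  by move=> + e; rewrite e /D /= addbe_old.
split; [exact: (e_nd E)|exact: (e_rt E)|exact: (e_col E)|exact: (e_le E)|exact: (e_glb E)| |].
- move=> t x y z nt dx dy dz; have [tv|tv] := pselect (le Z t v).
    exact: addpt_be_le.
  rewrite /= addbe_nle //; have [t1 t2] := rho_twin nt tv.
  have [w g dw] := rho_Drt W po nt tv; have drr := D_rt dw.
  have H := w_preB WV (f t).
  have sr o : D (addpt Z v a k al rho) (rt Z) o -> D Z (rt Z) (sg rho t o).
    by case: o => [q|] //= /dr; apply.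
  have [dm|dm] := pselect (D Z t (rho t)).
    have em := t2 dm.
    have eo o : D (addpt Z v a k al rho) (rt Z) o -> D V (f t) (h (sg rho t o)) ->
        eqv V (f t) (eh o) (h (sg rho t o)).
      by case: o => [q|] //=.
    rewrite -(e_be E nt (sr _ dx) (sr _ dy) (sr _ dz)).
    have eo' o : D (addpt Z v a k al rho) (rt Z) o -> D V (f t) (eh o) ->
        eqv V (f t) (eh o) (h (sg rho t o)).
      by case: o => [q|] //=.
    split=> hb; have [a1 a2 a3] := pb_dom H hb.
      by apply: (pb_cong H) hb; apply: eo'.
    by apply: (pb_cong H) hb; apply: eqv_sym => //; apply: eo.
  have nm : ~ D V (f t) m by move/t1.
  case: x dx => [x|] dx; last first.
    by split=> hb; [case: nm; exact: (pb_domx H hb)|case: dm; exact: (pb_domx (w_preB W t) hb)].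
  case: y dy => [y|] dy; last first.
    by split=> hb; [case: nm; exact: (pb_domy H hb)|case: dm; exact: (pb_domy (w_preB W t) hb)].
  case: z dz => [z|] dz; last first.
    by split=> hb; [case: nm; exact: (pb_domz H hb)|case: dm; exact: (pb_domz (w_preB W t) hb)].
  by apply: (e_be E) => //; [exact: (dr _ _ dx)|exact: (dr _ _ dy)|exact: (dr _ _ dz)].
- move=> t s [x|] /=; first exact: (e_fr E).
  case=> tv fx; have nt := (fr_nd W fx).1.
  have [t1 t2] := rho_twin nt tv.
  apply: (w_frcong WV (e_fr E fx)); apply: (eqv_sym WV); apply: t2.
  exact: (w_frD W fx).
Qed.

End Point.

Section Node.
Variables (v : P) (a : X) (c : C) (x0 : option X) (w : Q).
Hypothesis pl : place Z v a c x0.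
Hypothesis nw : fr V (f v) w (h a).
Hypothesis colw : col V w = c.
Hypothesis hs : forall s x, fr Z v s a -> x0 = Some x -> fr V w (f s) (h x).
Hypothesis h1 : forall x, D0 Z v a x -> D V w (h x).
Hypothesis h2 : forall x y, D0 Z v a x -> D0 Z v a y -> be Z v a x y ->
  ~ eqv V w (h x) (h y).
Hypothesis h3 : forall x y z, x0 = Some x -> D0 Z v a y -> D0 Z v a z ->
  be Z v a y z -> be V w (h x) (h y) (h z).

Let A := addnode Z v a c x0.
Let f' (t : option P) : Q := if t is Some t then f t else w.

Let nv : nd Z v. Proof. exact: pl_nd pl. Qed.
Let lvw : lt V (f v) w. Proof. exact: (w_frlt WV nw). Qed.

Lemma D0_rt x : D0 Z v a x -> D Z (rt Z) x.
Proof. by case=> dx _; exact: D_rt dx. Qed.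

Lemma Dw x : D Z (rt Z) x -> (D V w (h x) <-> D0 Z v a x).
Proof.
move=> dx; split=> [dw|]; last exact: h1.
have vx : D V (f v) (h x) by apply: (w_mono WV) dw; case: lvw.
split; first exact/emb_D.
move=> e; apply: (w_dom1 WV nw); apply/(eqvDE WV lvw.1 (x := h a) (y := h x)) => //.
by apply/emb_eqv => //; apply: D_rt; exact: pl_a pl.
Qed.

Lemma sb_w x y : D0 Z v a x -> D0 Z v a y ->
  (eqv V w (h x) (h y) <-> sb Z v a x y).
Proof.
move=> dx dy; split=> [e hb|n]; first exact: (h2 dx dy hb).
apply: (w_eq1 WV nw); [exact: h1|exact: h1|].
move=> /(e_be E nv) hb; apply: n; apply: hb; [|exact: D0_rt|exact: D0_rt].
apply: D_rt; exact: pl_a pl.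
Qed.

Lemma cone_ltw s : fr Z v s a -> lt V w (f s).
Proof.
move=> fs; have := pl_none pl fs; case E0 : x0 => [x|] // _.
exact: (w_frlt WV (hs fs E0)).
Qed.

Lemma fr_cone s : nd Z s -> le V (f v) (f s) -> forall u, lt V (f v) u -> le V u w ->
  le V u (f s) -> fr Z v s a.
Proof.
move=> ns lvs u lu uw us; have fu := fr_down WV nw lu uw.
have fs := fr_up WV fu us; apply: emb_fr fs; last exact: pl_a pl.
by split; [exact/(e_le E)|move=> e; apply: (lt_irr WV lu); rewrite e].
Qed.

(** Being over [h a] and below the images of all nodes over a fixes the place of w in the tree. Its
    $B$-set induces the star on the labels of Z: by [h2] different branches stay different, and by
    [h3] the label in [x0] separates them. *)
Lemma emb_addnode : emb A V f' h.
Proof.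
have WA := addnode_wptb W pl.
have H := w_preB WV w.
have leN s : nd Z s -> (le V (f s) w <-> le Z s v).
  move=> ns; split=> [l|/(e_le E ns nv) l]; last exact: (w_trans WV l lvw.1).
  case: (w_tree WV l lvw.1) => [|l']; first by move/(e_le E ns nv).
  have [->|n] := pselect (s = v); first exact: (w_refl W).
  have ls : lt V (f v) (f s).
    by apply: emb_lt; split; [exact/(e_le E)|move=> e; apply: n].
  have fs := fr_cone ns l' ls l (w_refl WV (e_nd E ns)).
  by case: (lt_irr WV (cone_ltw fs)).
have leN' s : nd Z s -> (le V w (f s) <-> fr Z v s a).
  move=> ns; split=> [l|/cone_ltw [//]].
  have ls : le V (f v) (f s) := w_trans WV lvw.1 l.
  apply: (fr_cone ns ls lvw) => //; apply: (w_refl WV).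
  by case: (w_nd WV l).
have nw' : nd V w by case: (w_nd WV lvw.1).
split.
- by move=> [t|] //= nt; exact: (e_nd E).
- exact: (e_rt E).
- move=> [t|] //= nt n; apply: (e_col E) => // e; apply: n; rewrite e //.
- move=> [s|] [t|] /= ns nt; [exact: (e_le E)|exact: leN|exact: leN'|].
  by split=> // _; exact: (w_refl WV).
- have GN m s : nd Z s -> isglb A m (Some s) None -> isglb V (f' m) (f s) w.
    move=> ns g; have [fs|nfs] := pselect (fr Z v s a).
      have gn : isglb A None (Some s) None by split.
      rewrite (glb_uniq WA g gn) /=; split=> //; first by apply/leN'.
      exact: (w_refl WV).
    have [m0 g0] := w_glb W ns nv.
    rewrite (glb_uniq WA g (addnode_glbN c x0 g0 nfs)) /=.
    have [g1 g2 g3] := g0; have [G1 G2 G3] := e_glb E g0.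
    have nm : nd Z m0 by case: (w_nd W g1).
    split=> //; first by apply/leN.
    move=> u us uw; case: (w_tree WV uw lvw.1) => l; first exact: G3.
    have lvs : le V (f v) (f s) := w_trans WV l us.
    have [e|n] := pselect (u = f v); first by rewrite e in us uw *; apply: G3 => //; apply: (w_refl WV); exact: (e_nd E).
    by case: nfs; apply: (fr_cone ns lvs (u := u)) => //; split=> // e; apply: n.
  move=> m [s|] [t|] g; have [g1 g2 g3] := g.
  + have [ns nt] : nd Z s /\ nd Z t.
      by split; [have := (w_nd WA g1).2|have := (w_nd WA g2).2].
    have [m0 g0] := w_glb W ns nt.
    by rewrite (glb_uniq WA g (addnode_glb W v a c x0 g0)); exact: (e_glb E).
  + by apply: GN => //; exact: (w_nd WA g1).2.
  + apply: glbC; apply: GN; first exact: (w_nd WA g2).2.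
    exact: glbC.
  + have gn : isglb A None None None by split.
    by rewrite (glb_uniq WA g gn) /=; split=> //; exact: (w_refl WV).
- move=> [t|] x y z nt dx dy dz; first exact: (e_be E).
  rewrite /=; split=> [hb|[ex ey ez]].
    have [] := pb_dom H hb; move=> /(Dw dx) ex /(Dw dy) ey /(Dw dz) ez.
    have [sxy|nxy] := pselect (sb Z v a x y); first by split=> //; left.
    have [sxz|nxz] := pselect (sb Z v a x z); first by split=> //; right; left.
    have nyz : ~ sb Z v a y z.
      move=> /(sb_w ey ez) e; apply: nxy; apply/sb_w => //.
      by apply: (pb_congr3 H (pb_esym H e) hb).
    split=> //; right; right; split=> //.
    rewrite /cc; case E0 : x0 => [x'|].
      have ex' := pl_x0 pl E0.
      (* Suppose x is not the centre x'. Splitting [hb] at x', the point x separates x' from y or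
         from z, while x' separates x from the same label by [h3]; this forces x = x'. *)
      apply: contrapT => n.
      have nx q : ~ sb Z v a x q -> D0 Z v a q -> be V w (h x) (h q) (h x') -> False.
        move=> nq dq hq; apply: n; apply/sb_w => //; apply: (pb_esym H).
        apply: (pb_eq H (pb_sym H hq)); apply: (h3 E0) => //.
        exact: contrapT.
      case: (pb_split H hb (h1 ex')) => [|/(pb_sym H)]; exact: nx.
    case: (pl_two pl) => [[s /(pl_none pl)]//|].
    have nc q : ~ cc Z v a x0 q by rewrite /cc E0.
    by move=> /(_ x y z ex ey ez (nc _) (nc _) (nc _)) [].
  case=> [/(sb_w ex ey) e|[/(sb_w ex ez) e|[cx n]]].
  + by apply: (pb_eany H e); exact: h1.
  + by apply: (pb_sym H); apply: (pb_eany H e); exact: h1.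
  + move: cx; rewrite /cc; case E0 : x0 => [x'|] // cx.
    have ex' := pl_x0 pl E0; have /(sb_w ex' ex) e := cx.
    by apply: (pb_congl H e); apply: (h3 E0) => //; exact: contrapT.
- move=> [t|] [s|] x /=.
  + exact: (e_fr E).
  + case=> [[-> e]|fx]; last exact: (fr_up WV (e_fr E fx) lvw.1).
    apply: (w_frcong WV nw); have [d1 d2] := eqvD W e.
    by apply/emb_eqv => //; [exact: (D_rt d1)|exact: (D_rt d2)].
  + case=> fs dx; rewrite /cc; case E0 : x0 => [x'|] // cx.
    apply: (w_frcong WV (hs fs E0)); apply/sb_w => //; exact: (pl_x0 pl E0).
  + by [].
Qed.

End Node.
End Extend.

(** * Inserting a node below an existing cone *)

Section StarPlace.
Context {d : Order.disp_t} {C : orderType d}.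
Variables (P X : Type) (Z : @pst d C P X).
Hypothesis ZP : ptb Z.
Variables (v : P) (a : X) (c : C).
Hypothesis cv : v <> rt Z -> (col Z v < c)%O.
Hypothesis cU : forall s, fr Z v s a -> (c < col Z s)%O.
Variables (al rho : P -> X).
Hypothesis po : position Z v a None al rho.
Let Z1 := addpt Z v a None al rho.

Let W : wptb Z. Proof. by case: ZP. Qed.

Lemma KKN t' y : ~ KK Z v a None t' y. Proof. by case. Qed.

(** A leaf hung at a in a new branch is lost in every node over a, so it can be the centre of the
    star of a new node below them and represent them there. The failures reported by [addpt_dom2]
    and [addpt_frs] are exactly of the kind that [place] allows. *)
Lemma star_place : place Z1 v (Some a) c (Some None).
Proof.
have d2 : dom2 Z by case: ZP.
have fs : frs Z by case: ZP.
have vv : le Z v v by apply: (w_refl W); exact: po_nd po.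
have cc0 y : cc Z1 v (Some a) (Some None) (Some y) -> ~ D Z v y.
  rewrite /cc /sb /= (addbe_le _ _ _ _ vv) /= (po_alv po) => h dy; apply: h; split.
    by apply: (pb_eany (w_preB W v) (po_a po)).
  by case=> _ /KKN.
have ccN : cc Z1 v (Some a) (Some None) None.
  by rewrite /cc /sb /= (addbe_le _ _ _ _ vv).
have dN : D0 Z1 v (Some a) None.
  by split; rewrite /D /eqv /= (addbe_le _ _ _ _ vv).
split.
- exact: po_nd po.
- by rewrite /D /= addbe_old; exact: po_a po.
- move=> e; rewrite /eqv /= addbe_old; apply: (eqv_sym W).
  by case: (po_rt po e).
- exact: cv.
- exact: cU.
- by move=> x [<-].
- move=> s [y|] f'; first by move=> /cc0 n dy; apply: n; move: dy; rewrite /D /= addbe_old; apply: (w_mono W); case: (w_frlt W f').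
  move=> _; have ls := w_frlt W f'.
  have sv : ~ le Z s v by move=> h; exact: (lt_irr W ls).
  have g : isglb Z v s v by split=> //; case: ls.
  by rewrite /D /= (addbe_nle _ _ _ _ sv) => /(rhoD_hk W po sv g) /(_ erefl erefl); apply.
- by [].
- have [[t ft]|nf] := pselect (exists s, fr Z v s a); first by left; exists t.
  right=> -[x|] [y|] [z|] //; rewrite /D0 /D /eqv /= !addbe_old.
  move=> [dx nx] [dy ny] [dz nz] _ _ _; rewrite /sb /= !addbe_old.
  have [h1|h1] := pselect (be Z v a x y); last by constructor 1.
  have [h2|h2] := pselect (be Z v a x z); last by constructor 2.
  have [h3|h3] := pselect (be Z v a y z); last by constructor 3.
  by have [t ft] := fs _ _ _ _ _ (conj (And3 h1 h2 h3) (And3 nx ny nz)); case: nf; exists t.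
- move=> s u o l h1 h2; case: (addpt_dom2 W po d2 l h1 h2) => [|[-> _ h3 h4]]; first by left.
  by right.
- move=> u b x y z /(addpt_frs W po fs) [|[-> _ [b' -> e]]]; first by left.
  by right; split=> //; rewrite /eqv /= addbe_old.
Qed.

End StarPlace.

Section Star.
Context {d : Order.disp_t} {C : orderType d}.
Variables (P X : Type) (Z : @pst d C P X).
Hypothesis ZP : ptb Z.
Variables (v : P) (a : X) (t : P) (c : C).
Hypothesis ft : fr Z v t a.
Hypothesis tmin : forall s, fr Z v s a -> le Z t s.
Hypothesis cv : v <> rt Z -> (col Z v < c)%O.
Hypothesis ct : (c < col Z t)%O.

Let W : wptb Z. Proof. by case: ZP. Qed.

(** As t is the least node over a, only v can cause a loss or an identification between v and t.
    Thus a alone is lost here, and in [child_eqv] only labels in one branch at a become equal. *)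
Lemma child_D y : D Z v y -> ~ eqv Z v a y -> D Z t y.
Proof.
case: ZP => _ d2 _ dy n; apply: contrapT => ty.
have [u vu fu] := d2 _ _ _ (w_frlt W ft) dy ty.
have [e|ne] := pselect (v = u).
  by subst u; apply: n; exact: (w_freq W ft fu).
have lut := w_frlt W fu.
have fvu : fr Z v u a by apply: (fr_down W ft _ lut.1).
by apply: (lt_irr W lut); exact: tmin.
Qed.

Lemma child_eqv x y : be Z v a x y -> ~ eqv Z t x y.
Proof.
move=> h e; have [u [b [vu fu n]]] := w_eq2 W (w_frlt W ft) e.
have [e'|ne] := pselect (v = u).
  by subst u; apply: n; apply: (pb_congl (w_preB W v)) h; exact: (w_freq W ft fu).
have lut := w_frlt W fu.
have fvu : fr Z v u a by apply: (fr_down W ft _ lut.1).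
by apply: (lt_irr W lut); exact: tmin.
Qed.

Variables (al rho : P -> X).
Hypothesis po : position Z v a None al rho.
Let Z1 := addpt Z v a None al rho.

Let W1 : wptb Z1. Proof. exact: (addpt_wptb W po). Qed.

Lemma star_cU s : fr Z v s a -> (c < col Z s)%O.
Proof.
move=> fs'; have l := tmin fs'; have [<-//|n] := pselect (t = s).
apply: (Order.POrderTheory.lt_trans ct); apply: (w_col W) => //.
by move=> e; case: (lt_irr W (w_frlt W ft)); rewrite e; apply: (w_rt W); exact: po_nd po.
Qed.

Variables (Q Y : Type) (V : @pst d C Q Y) (f : P -> Q) (h : X -> Y).
Hypotheses (WV : wptb V) (VD : dom2 V) (E : emb Z V f h).
Variables (w : Q) (m : Y).
Hypotheses (vw : lt V (f v) w) (fm : fr V w (f t) m) (cw : col V w = c).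

Let nv : nd Z v. Proof. exact: po_nd po. Qed.
Let nt : nd Z t. Proof. by case: (fr_nd W ft). Qed.
Let wt : lt V w (f t). Proof. exact: (w_frlt WV fm). Qed.
Let fw : fr V (f v) w (h a).
Proof. apply: (fr_down WV (e_fr E ft) vw); by case: wt. Qed.
Let dwm : D V w m. Proof. exact: (w_frD WV fm). Qed.
Let dvm : D V (f v) m. Proof. exact: (w_mono WV vw.1 dwm). Qed.

Lemma star_D0 y : D Z v y -> ~ eqv Z v a y ->
  [/\ D V (f t) (h y), D V w (h y) & ~ eqv V w m (h y)].
Proof.
move=> dy n; have dt := child_D dy n.
have dt' : D V (f t) (h y) by apply/(emb_D E nt) => //; exact: (D_rt W dy).
split=> //; first exact: (w_mono WV wt.1 dt').
by move=> e; apply: (w_dom1 WV fm); apply/(eqvDE WV wt.1 e).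
Qed.

(** The new leaf is realized in V by a label m of the point of B(w) that carries [f t]. A label y in
    the branch of m at [h a] would equal m in w and be lost at [f t], but every label of Z at v
    other than a survives at t. *)
Lemma star_adj : adjacent (be Z v) (be V (f v)) h m a (dirK (be Z v) a None).
Proof.
have da := po_a po.
have iso : forall x y z, D Z (rt Z) x -> D Z (rt Z) y -> D Z (rt Z) z ->
  (be V (f v) (h x) (h y) (h z) <-> be Z v x y z).
  by move=> x y z; apply: (e_be E nv).
apply: (gate_adjacent (w_preB WV (f v)) iso dvm) => //.
- exact: (D_rt W da).
- by move=> x; exact: (D_rt W).
- by move=> e; apply: (w_dom1 WV fw); apply/(eqvDE WV vw.1 e).
- move=> y dy; apply: contrapT => nb.
  have dy' : D V (f v) (h y) by apply/(emb_D E nv) => //; exact: (D_rt W dy).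
  have na : ~ eqv Z v a y.
    move=> e; apply: nb; apply: (pb_sym (w_preB WV _)); apply: (pb_eany (w_preB WV _)) => //.
    by apply/(emb_eqv E nv (D_rt W da) (D_rt W dy)).
  have [_ _ n] := star_D0 dy na; apply: n.
  exact: (same_branch_twin WV VD fw dvm dy' nb).2.
Qed.

Lemma star_emb : emb (addnode Z1 v (Some a) c (Some None)) V
  (fun o => if o is Some o then f o else w) (ext h m).
Proof.
have E1 : emb Z1 V f (ext h m).
  apply: (emb_addpt W WV VD E po dvm star_adj) => _ s fs.
  apply: (w_dom1 WV (u := w)); apply: (fr_up WV fm); apply/(e_le E) => //.
    by case: (fr_nd W fs).
  exact: tmin.
have vv : le Z v v by apply: (w_refl W).
have SS y : D0 Z1 v (Some a) (Some y) -> D Z v y /\ ~ eqv Z v a y.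
  by case; rewrite /D /eqv /= !addbe_old.
have HV := w_preB WV w.
apply: (emb_addnode W1 WV E1 (star_place ZP cv star_cU po) fw cw).
- move=> s x /= fs [<-] /=; apply: (fr_up WV fm); apply/(e_le E) => //.
    by case: (fr_nd W fs).
  exact: tmin.
- move=> [y|] //= /SS [h1 h2]; by case: (star_D0 h1 h2).
- move=> [x|] [y|] //=.
  + move=> /SS [h1 h2] /SS [h3 h4]; rewrite addbe_old => hb e.
    have [i1 i2 i3] := star_D0 h1 h2.
    apply: (child_eqv hb); apply/(emb_eqv E nt (D_rt W h1) (D_rt W h3)).
    exact: (w_monoe WV wt.1 e).
  + move=> /SS [h1 h2] _ _ e; have [_ _] := star_D0 h1 h2; apply.
    exact: (eqv_sym WV).
  + by move=> _ /SS [h1 h2] _; case: (star_D0 h1 h2).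
  + by move=> _ _; rewrite (addbe_le _ _ _ _ vv).
- move=> x [y|] [z|] [<-] /=.
  + move=> /SS [h1 h2] /SS [h3 h4]; rewrite addbe_old => hb.
    have [i1 i2 i3] := star_D0 h1 h2; have [j1 j2 j3] := star_D0 h3 h4.
    apply: contrapT => nb; apply: (child_eqv hb).
    apply/(emb_eqv E nt (D_rt W h1) (D_rt W h3)).
    exact: (w_eq1 WV fm).
  + move=> /SS [h1 h2] _ _; have [i1 i2 i3] := star_D0 h1 h2.
    exact: (pb_refr HV).
  + move=> _ /SS [h1 h2] _; have [i1 i2 i3] := star_D0 h1 h2.
    exact: (pb_refl HV).
  + by move=> _ _; rewrite (addbe_le _ _ _ _ vv).
Qed.

End Star.

(** * Finite induction and nearest points *)

Lemma fin_sub (T : Type) (Q Q' : T -> Prop) : (forall x, Q' x -> Q x) -> fin Q -> fin Q'.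
Proof. by move=> s [n [e h]]; exists n, e => x /s /h. Qed.

(** Passing to a proper subset decreases the number of indices at which the list names an
    element. *)
Lemma fin_ind (T : Type) (R : (T -> Prop) -> Prop) :
  (forall Q, (forall Q', (forall x, Q' x -> Q x) -> (exists x, Q x /\ ~ Q' x) -> R Q') -> R Q) ->
  forall Q, fin Q -> R Q.
Proof.
move=> IH Q0 [n [e he]].
pose m (Q : T -> Prop) := count (fun i => `[< exists2 x, e i = Some x & Q x >]) (iota 0 n).
suff key k : forall Q, (forall x, Q x -> Q0 x) -> (m Q < k)%N -> R Q by apply: (key (m Q0).+1).
elim: k => // k IHk Q hQ mQ; apply: IH => Q' hQ' [x [qx nx]].
apply: IHk => [y /hQ' /hQ //|]; rewrite ltnS in mQ; apply: leq_trans mQ.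
have [i ilt ei] := he x (hQ x qx).
have imem : i \in iota 0 n by rewrite mem_iota.
have /permP p := perm_to_rem imem; rewrite /m !p /=.
have -> : `[< exists2 x0, e i = Some x0 & Q' x0 >] = false.
  by apply/asboolP => -[y]; rewrite ei => -[<-].
have -> : `[< exists2 x0, e i = Some x0 & Q x0 >] by apply/asboolP; exists x.
rewrite add0n add1n ltnS; apply: sub_count => j /asboolP [y ey qy].
by apply/asboolP; exists y => //; exact: hQ'.
Qed.

(* Either some point of S separates x from all of S, or S has to be completed
   by a point strictly between two points of S. *)
Lemma gate_or_between (X : Type) (b : X -> X -> X -> Prop) (S : X -> Prop) (x s0 : X) :
  preB b -> fin S -> (forall y, S y -> b y y y) ->
  (forall y1 y2 y3, S y1 -> S y2 -> S y3 -> ~ b y1 y2 y3 -> ~ b y2 y1 y3 ->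
     ~ b y3 y1 y2 -> exists u, S u /\ [/\ b u y1 y2, b u y1 y3 & b u y2 y3]) ->
  S s0 -> b x x x -> (forall y, S y -> ~ b y x x) ->
  (exists2 a, S a & forall y, S y -> b a x y) \/
  (exists m a k, [/\ S a, S k, b m a k, forall y, S y -> ~ b m y y &
     forall y, S y -> b y a k -> b y a a \/ b y k k]).
Proof.
move=> H fS SD Spos Ss0 Dx xS; have Sy := pb_sym H.
have min p (Q : X -> Prop) : (forall y, Q y -> S y) -> (exists y, Q y) ->
    exists2 y, Q y & forall z, Q z -> b z p y -> b z y y.
  move=> QS [y0 Qy0].
  have [|?|y Qy my] := @fin_min X (fun z y => b z p y /\ ~ b z y y) Q _ _ (fin_sub QS fS) y0 Qy0.
  - move=> z y w [h1 n1] [h2 n2]; split; first exact: (pb_mid H h1 h2).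
    move=> e; apply: n1; apply: (pb_eq H (Sy _ _ _ h1)); apply: Sy.
    by apply: (pb_congr3 H (pb_esym H e)).
  - by case=> h []; exact: pb_domx h.
  - exists y => // z Qz hz; apply: contrapT => n; exact: (my z Qz).
(* a is nearest to x in S. If it is not a gate for some y, then either x itself lies between a and
   y, or the centroid of a, x, y does, and this centroid is not in S because a was nearest. *)
have [a Sa mina] := min x S (fun _ h => h) (ex_intro _ s0 Ss0).
have Da := SD _ Sa.
have [g|ng] := pselect (forall y, S y -> b a x y); first by left; exists a.
right.
have [m [y [z [Yy Yz hm mS]]]] : exists m y z, [/\ S y, S z, b m y z & forall w, S w -> ~ b m w w].
  have [y [Yy ny]] : exists y, S y /\ ~ b a x y.
    by apply: contrapT => n; apply: ng => y hy; apply: contrapT => h; apply: n; exists y.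
  have Dy := SD _ Yy.
  have [h1|h1] := pselect (b x a y).
    by exists x, a, y; split=> // w Sw e; apply: (xS _ Sw); exact: (pb_esym H).
  have h2 : ~ b y a x.
    by move=> h2; apply: ny; apply: (pb_congl H (mina y Yy (Sy _ _ _ h2))); apply: (pb_refr H).
  have [u [u1 u2 u3]] := pb_pos H Da Dx Dy ny h1 (fun h => h2 h).
  exists u, a, y; split=> // w Sw e.
  have w1 : b w x a by apply: Sy; exact: (pb_congl H e).
  have e' := mina w Sw w1.
  apply: ny; apply: (pb_congl H (pb_etrans H e e')); exact: u3.
have Dm := pb_domx H hm.
(* Taking the point a' nearest to m on one side, and then the point k nearest to m on the other side
   of a', leaves no point of S strictly between a' and k. *)
have [a' [Ya' ha'] mina'] := min m (fun a => S a /\ b m a z) (fun _ h => h.1) (ex_intro _ y (conj Yy hm)).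
have [k [Yk hk] mink] := min m (fun k => S k /\ b m a' k) (fun _ h => h.1) (ex_intro _ z (conj Yz ha')).
exists m, a', k; split=> // q Yq hq.
case: (pb_split H hq Dm) => h.
  left; apply: mina'; last exact: Sy.
  by split=> //; apply: (pb_sub H h).
right; apply: mink => //; split=> //; apply: (Sy); exact: (pb_sub H (Sy _ _ _ h) (Sy _ _ _ hk)).
Qed.

(** * Rich structures *)

Section Richness.
Context {d : Order.disp_t} {C : orderType d}.

(** All that is required of the target: a node of given colour inside an interval, a node over a
    that keeps two branches apart, density, and a branch at a other than that of k (for k = a, any
    other point). The last three exempt the root, whose $B$-set is a star; in the first, the root
    imposes no lower bound on the colour. *)
Record rich (P X : Type) (L : @pst d C P X) : Prop := {
  ri_node : forall s t c, lt L s t -> s = rt L \/ (col L s < c)%O -> (c < col L t)%O ->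
    exists u, [/\ lt L s u, lt L u t & col L u = c];
  ri_top : forall v a k1 k2 c, v <> rt L -> be L v a k1 k2 -> ~ eqv L v a k1 ->
    ~ eqv L v a k2 -> (col L v < c)%O ->
    exists u, [/\ fr L v u a, col L u = c, D L u k1, D L u k2 & ~ eqv L u k1 k2];
  ri_between : forall v x y, v <> rt L -> D L v x -> D L v y -> ~ eqv L v x y ->
    exists b, [/\ be L v b x y, ~ eqv L v b x & ~ eqv L v b y];
  ri_leaf : forall v a k, v <> rt L -> D L v a -> D L v k ->
    exists b, ~ eqv L v a b /\ be L v a b k }.

Variables (PE XE PL XL : Type) (E : @pst d C PE XE) (L : @pst d C PL XL).
Hypotheses (EP : ptb E) (LP : ptb L) (LR : rich L).
Hypotheses (EfinP : fin (nd E)) (EfinX : fin (D E (rt E))).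
Hypothesis Einh : forall p, nd E p -> exists x, D E p x.

Let WE : wptb E. Proof. by case: EP. Qed.
Let WL : wptb L. Proof. by case: LP. Qed.
Let dE : dom2 E. Proof. by case: EP. Qed.
Let dL : dom2 L. Proof. by case: LP. Qed.

(* A finite structure Z embedded both in E and in L, that is, a partial
   embedding of E into L. *)
Record stage := Stage {
  sP : Type; sX : Type; sZ : @pst d C sP sX;
  sfE : sP -> PE; shE : sX -> XE; sfL : sP -> PL; shL : sX -> XL;
  s_ptb : ptb sZ;
  s_E : emb sZ E sfE shE;
  s_L : emb sZ L sfL shL;
  s_inh : forall t, nd sZ t -> exists x, D sZ t x;
  s_top : exists t, lt sZ (rt sZ) t }.

Definition above (s s' : stage) : Prop :=
  (forall t, nd (sZ s) t -> exists t',
     [/\ nd (sZ s') t', sfE t' = sfE t & sfL t' = sfL t]) /\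
  (forall x, D (sZ s) (rt (sZ s)) x -> exists x',
     [/\ D (sZ s') (rt (sZ s')) x', shE x' = shE x & shL x' = shL x]).

Definition hit (s : stage) (q : PE + XE) : Prop :=
  match q with
  | inl p => exists2 t, nd (sZ s) t & sfE t = p
  | inr x => exists2 z, D (sZ s) (rt (sZ s)) z & shE z = x
  end.

Definition gain (s s' : stage) : Prop := above s s' /\
  ((exists p, [/\ nd E p, ~ hit s (inl p) & hit s' (inl p)]) \/
   (exists x, [/\ D E (rt E) x, ~ hit s (inr x) & hit s' (inr x)])).

Lemma emb_inj (P X : Type) (Z : pst P X) f h s t : wptb Z -> emb Z E f h ->
  nd Z s -> nd Z t -> f s = f t -> s = t.
Proof.
move=> W e ns nt est; apply: (w_anti W); apply/(e_le e) => //; rewrite est;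
  apply: (w_refl WE); exact: (e_nd e).
Qed.

(** * Enlarging a partial embedding *)

Section Step.
Variable s : stage.
Notation P := (sP s).
Notation X := (sX s).
Notation Z := (sZ s).
Notation fE := (@sfE s).
Notation hE := (@shE s).
Notation fL := (@sfL s).
Notation hL := (@shL s).

Let ZP : ptb Z. Proof. exact: s_ptb. Qed.
Let W : wptb Z. Proof. by case: ZP. Qed.
Let d2 : dom2 Z. Proof. by case: ZP. Qed.
Let fs : frs Z. Proof. by case: ZP. Qed.
Let eE : emb Z E fE hE. Proof. exact: s_E. Qed.
Let eL : emb Z L fL hL. Proof. exact: s_L. Qed.

Lemma DrtZ t x : D Z t x -> D Z (rt Z) x. Proof. exact: (D_rt W). Qed.

Lemma fL_rt t : nd Z t -> t <> rt Z -> fL t <> rt L.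
Proof.
move=> nt n e; apply: n; apply: (w_anti W); last exact: (w_rt W).
apply/(e_le eL) => //; first exact: (w_ndrt W).
by rewrite e (e_rt eL); apply: (w_refl WL); exact: (w_ndrt WL).
Qed.

Lemma fE_rt t : nd Z t -> t <> rt Z -> fE t <> rt E.
Proof.
move=> nt n e; apply: n; apply: (emb_inj W eE) => //; first exact: (w_ndrt W).
by rewrite e (e_rt eE).
Qed.

Lemma point_step v a k mE mL : nd Z v -> v <> rt Z -> D Z v a ->
  (forall k0, k = Some k0 -> D Z v k0 /\ ~ eqv Z v a k0) ->
  D E (fE v) mE -> D L (fL v) mL ->
  adjacent (be Z v) (be E (fE v)) hE mE a (dirK (be Z v) a k) ->
  adjacent (be Z v) (be L (fL v)) hL mL a (dirK (be Z v) a k) ->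
  (k = None -> forall t, ~ fr Z v t a) ->
  (k = None -> forall y z, D Z v y -> D Z v z -> ~ eqv Z v a y -> ~ eqv Z v a z ->
     ~ be Z v a y z) ->
  exists s', gain s s'.
Proof.
move=> nv nr da hk dmE dmL aE aL kfr kdeg.
have [al [rho po]] := position_ex W nv da hk (fun e => False_ind _ (nr e)).
have W1 := addpt_wptb W po.
have P1 := addpt_ptb W po ZP kfr kdeg.
have E1 : emb (addpt Z v a k al rho) E fE (ext hE mE).
  by apply: (emb_addpt W WE dE eE po dmE aE) => /kfr n t /n.
have L1 : emb (addpt Z v a k al rho) L fL (ext hL mL).
  by apply: (emb_addpt W WL dL eL po dmL aL) => /kfr n t /n.
have i1 t : nd (addpt Z v a k al rho) t -> exists x, D (addpt Z v a k al rho) t x.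
  by move=> /(@s_inh s) [x hx]; exists (Some x); rewrite /D /= addbe_old.
have t1 : exists t, lt (addpt Z v a k al rho) (rt (addpt Z v a k al rho)) t.
  by case: (s_top s) => t ht; exists t.
exists (Stage P1 E1 L1 i1 t1); split; first split=> /=.
- by move=> t nt; exists t.
- by move=> x dx; exists (Some x); rewrite /D /= addbe_old.
right; exists mE; split.
- exact: (D_rt WE dmE).
- case=> z dz ez; have [n _ _] := aE.
  have dz' : D Z v z by apply/(emb_D eE nv dz); rewrite ez.
  by apply: (n z dz'); rewrite ez.
- by exists None => //; rewrite /= /D /= addbe_le //; exact: (w_rt W).
Qed.

(** At the root all nodes lie over the centre, and Z has a proper node; so a label with nodes of E
    over it but none of Z does not sit at the root. *)
Lemma rt_single v w a : nd Z v -> D Z v a -> fr E (fE v) w (hE a) ->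
  (forall t, ~ fr Z v t a) -> v <> rt Z.
Proof.
move=> nv da fw n e; subst v; have [t lt'] := s_top s.
apply: (n t); apply: (w_frcong W (w_frctr W lt')).
apply/(emb_eqv eE nv) => //; first exact: (w_ctr W).
rewrite (e_rt eE) in fw *; have lw := w_frlt WE fw.
have ft' : fr E (rt E) (fE t) (hE (ctr Z)) by rewrite -(e_rt eE); exact: (e_fr eE (w_frctr W lt')).
apply: (w_freq WE ft'); apply/(w_frcone WE fw); first exact: (w_frlt WE ft').
by apply: (w_cone WE) => //; exact: (w_frlt WE ft').
Qed.

Definition child v w := forall w', lt E (fE v) w' -> le E w' w -> w' = w.

Section Child.
Variables (v : P) (a : X) (w : PE).
Hypotheses (nv : nd Z v) (da : D Z v a) (fw : fr E (fE v) w (hE a)) (cw : child v w).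

Lemma chE_D x : D E (fE v) x -> ~ eqv E (fE v) (hE a) x -> D E w x.
Proof.
move=> dx n; apply: contrapT => nx.
have [u vu fu] := dE (w_frlt WE fw) dx nx; have lu := w_frlt WE fu.
have [e|ne] := pselect (fE v = u).
  by apply: n; apply: (w_freq WE fw); rewrite e.
have e := cw (conj vu ne) lu.1; subst u; exact: (lt_irr WE lu lu.1).
Qed.

Lemma chE_eqv x y : eqv E w x y -> ~ be E (fE v) (hE a) x y.
Proof.
move=> e; have [u [b [vu fu n]]] := w_eq2 WE (w_frlt WE fw) e; have lu := w_frlt WE fu.
have [e'|ne] := pselect (fE v = u).
  rewrite -e' in fu n => hb; apply: n; apply: (pb_congl (w_preB WE _)) hb.
  exact: (w_freq WE fw fu).
have e' := cw (conj vu ne) lu.1; subst u; case: (lt_irr WE lu lu.1).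
Qed.

(** Since Z has no node over a, [frs] leaves at most two branches at a, and the star of the new node
    needs no centre. In L the branches present have to become distinct points of one node, which
    [ri_top] provides for two branches. *)
Lemma node_step : (forall t, ~ fr Z v t a) -> ~ hit s (inl w) ->
  (exists y, D0 Z v a y) -> exists s', gain s s'.
Proof.
move=> nfr nw [y0 dy0]; have nr := rt_single nv da fw nfr.
have lvw := w_frlt WE fw.
have cvw : (col Z v < col E w)%O.
  by rewrite -(e_col eE nv nr); apply: (w_col WE lvw); exact: fE_rt.
have pl : place Z v a (col E w) None.
  split=> //.
  - by move=> s' /nfr.
  - by move=> s' /nfr.
  - right=> x y z [dx nx] [dy ny] [dz nz] _ _ _.
    have [h1|h1] := pselect (be Z v a x y); last by constructor 1.
    have [h2|h2] := pselect (be Z v a x z); last by constructor 2.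
    have [h3|h3] := pselect (be Z v a y z); last by constructor 3.
    by have [t /nfr] := fs (conj (And3 h1 h2 h3) (And3 nx ny nz)).
  - by move=> s' t x h1 h2 h3; left; exact: d2 h2 h3.
  - by move=> t b x y z /fs h; left.
have ED x : D Z v x -> D E (fE v) (hE x) by move=> dx; apply/(emb_D eE nv) => //; exact: (DrtZ dx).
have E1 : emb (addnode Z v a (col E w) None) E (fun o => if o is Some t then fE t else w) hE.
  apply: (emb_addnode W WE eE pl fw) => //.
  - move=> x [dx nx]; apply: chE_D; first exact: ED.
    by move=> e; apply: nx; apply/(emb_eqv eE nv (DrtZ da) (DrtZ dx)).
  - move=> x y [dx nx] [dy ny] hb /chE_eqv; apply.
    by apply/(e_be eE nv (DrtZ da) (DrtZ dx) (DrtZ dy)).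
have LD x : D Z v x -> D L (fL v) (hL x) by move=> dx; apply/(emb_D eL nv) => //; exact: (DrtZ dx).
have nrL := fL_rt nv nr; have HL := w_preB WL (fL v).
have L0 x : D0 Z v a x -> ~ eqv L (fL v) (hL a) (hL x).
  by move=> [dx nx] /(emb_eqv eL nv (DrtZ da) (DrtZ dx)).
have beL x y : D0 Z v a x -> D0 Z v a y ->
    (be L (fL v) (hL a) (hL x) (hL y) <-> be Z v a x y).
  by move=> [dx _] [dy _]; apply: (e_be eL nv (DrtZ da) (DrtZ dx) (DrtZ dy)).
(* k1 and k2 lie in different branches at a which together contain all labels of Z other than a. If
   Z has one branch only, [ri_leaf] supplies the other in L. *)
have [k1 [k2 [hk n1 n2 hy]]] : exists k1 k2, [/\ be L (fL v) (hL a) k1 k2,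
    ~ eqv L (fL v) (hL a) k1, ~ eqv L (fL v) (hL a) k2 &
    forall y, D0 Z v a y -> ~ be L (fL v) (hL a) k1 (hL y) \/ ~ be L (fL v) (hL a) k2 (hL y)].
  have [[y1 [dy1 h1]]|n] := pselect (exists y1, D0 Z v a y1 /\ be Z v a y0 y1).
    exists (hL y0), (hL y1); split; [exact/beL|exact: L0|exact: L0|].
    move=> y dy; rewrite !beL //.
    have [h2|] := pselect (be Z v a y0 y); last by left.
    have [h3|] := pselect (be Z v a y1 y); last by right.
    have [_ n0] := dy0; have [_ n1] := dy1; have [_ ny] := dy.
    by have [t /nfr] := fs (conj (And3 h1 h2 h3) (And3 n0 n1 ny)).
  have [b [nb hb]] := ri_leaf LR nrL (LD _ da) (LD _ dy0.1).
  exists (hL y0), b; split=> //; [exact: (pb_sym HL)|exact: L0|].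
  by move=> y dy; left; rewrite beL // => h; apply: n; exists y.
have cvL : (col L (fL v) < col E w)%O by rewrite (e_col eL nv nr).
have [u [fu cu du1 du2 nu]] := ri_top LR nrL hk n1 n2 cvL.
have tw k y : D L u k -> D0 Z v a y -> ~ be L (fL v) (hL a) k (hL y) ->
    D L u (hL y) /\ eqv L u k (hL y).
  move=> dk dy nb; have dk' : D L (fL v) k by apply: (w_mono WL) dk; case: (w_frlt WL fu).
  have [t1 t2] := same_branch_twin WL dL fu dk' (LD _ dy.1) nb.
  by split; [apply/t1|exact: t2].
have Du y : D0 Z v a y -> D L u (hL y).
  by move=> dy; case: (hy y dy) => nb; [case: (tw k1 y)|case: (tw k2 y)].
have L1 : emb (addnode Z v a (col E w) None) L (fun o => if o is Some t then fL t else u) hL.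
  apply: (emb_addnode W WL eL pl fu) => //.
  move=> x y dx dy /(beL _ _ dx dy) hb e.
  have sep k : D L u k -> ~ be L (fL v) (hL a) k (hL x) -> ~ be L (fL v) (hL a) k (hL y) -> False.
    move=> dk h1 h2; apply: (pb_brtrans HL _ _ h2) hb; last by move=> /(pb_sym HL).
    by apply: (w_mono WL) dk; case: (w_frlt WL fu).
  case: (hy x dx) (hy y dy) => h1 [] h2; try exact: sep h1 h2.
  + have [_ e1] := tw _ _ du1 dx h1; have [_ e2] := tw _ _ du2 dy h2.
    apply: nu; apply: (eqv_trans WL e1); apply: (eqv_trans WL e); exact: (eqv_sym WL).
  + have [_ e1] := tw _ _ du2 dx h1; have [_ e2] := tw _ _ du1 dy h2.
    apply: nu; apply: (eqv_trans WL e2); apply: (eqv_sym WL); exact: (eqv_trans WL e1).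
have P1 := addnode_ptb W pl.
have i1 t : nd (addnode Z v a (col E w) None) t -> exists x, D (addnode Z v a (col E w) None) t x.
  case: t => [t|] /= => [/(@s_inh s) [x hx]|_]; first by exists x.
  by exists y0; apply/star_D.
have t1 : exists t, lt (addnode Z v a (col E w) None) (rt (addnode Z v a (col E w) None)) t.
  by case: (s_top s) => t [h n]; exists (Some t); split=> // -[].
exists (Stage P1 E1 L1 i1 t1); split; first split=> /=.
- by move=> t nt; exists (Some t).
- by move=> x dx; exists x.
left; exists w; split=> //; first by case: (w_nd WE lvw.1).
by exists None.
Qed.

(** Nodes of Z already lie over a. The least of them, t0, is above w, and w is inserted between v
    and t0 as in [star_emb]; [ri_node] gives its counterpart in L. *)
Lemma star_step t : fr Z v t a -> ~ hit s (inl w) -> exists s', gain s s'.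
Proof.
move=> ft nw.
have [_ [t0 [nt0 ft0 <-]] tmin'] : exists2 p, (exists t, [/\ nd Z t, fr Z v t a & fE t = p]) &
   forall q, (exists t, [/\ nd Z t, fr Z v t a & fE t = q]) -> ~ lt E q p.
  apply: (fin_min (R := lt E)).
  - by move=> x y z h [h' _]; exact: (lt_leT WE h h').
  - by move=> x [].
  - by apply: fin_sub EfinP => p [t' [nt' _ <-]]; exact: (e_nd eE).
  - by exists t; split=> //; case: (fr_nd W ft).
have tmin t' : fr Z v t' a -> le Z t0 t'.
  move=> ft'; have [z [lz z1 z2]] := (w_frcone W ft0 (w_frlt W ft')).1 ft'.
  have [e|n] := pselect (z = t0); first by rewrite -e.
  have fz := fr_down W ft0 lz z1; have nz : nd Z z := (w_nd W z1).1.
  case: (tmin' (fE z)); first by exists z.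
  by apply: (emb_lt W WE eE).
have lvt := w_frlt W ft0.
have ltE : lt E w (fE t0).
  have [z [lz z1 z2]] := (w_frcone WE fw (emb_lt W WE eE lvt)).1 (e_fr eE ft0).
  have e := cw lz z1; subst z; split=> // e; apply: nw; exists t0 => //.
have lvw := w_frlt WE fw.
have wr : w <> rt E.
  by move=> e; apply: (lt_irr WE lvw); rewrite e; apply: (w_rt WE); exact: (e_nd eE).
have tr : t0 <> rt Z.
  by move=> e; apply: (lt_irr W lvt); rewrite e; apply: (w_rt W).
have cv : v <> rt Z -> (col Z v < col E w)%O.
  by move=> nr; rewrite -(e_col eE nv nr); apply: (w_col WE lvw); exact: fE_rt.
have ct : (col E w < col Z t0)%O by rewrite -(e_col eE nt0 tr); exact: (w_col WE).
have hr : v = rt Z -> None = None :> option X /\ eqv Z v (ctr Z) a.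
  move=> e; split=> //; rewrite e; apply: (w_freq W (w_frctr W _)); last by rewrite -e; exact: ft0.
  by rewrite -e.
have [al [rho po]] := @position_ex _ _ _ _ Z v a None W nv da (fun k0 => ltac:(discriminate)) hr.
have [mE hmE] := w_frex WE ltE.
have E1 := star_emb ZP ft0 tmin cv ct po WE dE eE lvw hmE erefl.
have cvL : fL v = rt L \/ (col L (fL v) < col E w)%O.
  have [e|n] := pselect (v = rt Z); first by left; rewrite e (e_rt eL).
  by right; rewrite (e_col eL nv n); exact: cv.
have ctL : (col E w < col L (fL t0))%O by rewrite (e_col eL nt0 tr).
have [u [lvu lut cu]] := ri_node LR (emb_lt W WL eL lvt) cvL ctL.
have [mL hmL] := w_frex WL lut.
have L1 := star_emb ZP ft0 tmin cv ct po WL dL eL lvu hmL cu.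
have W1 := addpt_wptb W po.
have pl := star_place ZP cv (star_cU ZP ft0 tmin ct po) po.
have P1 := addnode_ptb W1 pl.
pose Z1 := addnode (addpt Z v a None al rho) v (Some a) (col E w) (Some None).
have i1 t' : nd Z1 t' -> exists x, D Z1 t' x.
  case: t' => [t'|] /= => [/(@s_inh s) [x hx]|_].
    by exists (Some x); rewrite /D /= addbe_old.
  by exists None; apply/star_D => //; exact: (pl_x0 pl erefl).
have t1 : exists t', lt Z1 (rt Z1) t'.
  by case: (s_top s) => t' [h n]; exists (Some t'); split=> // -[].
exists (Stage P1 E1 L1 i1 t1); split; first split=> /=.
- by move=> t' nt; exists (Some t').
- by move=> x dx; exists (Some x); rewrite /D /= addbe_old.
left; exists w; split=> //; first by case: (w_nd WE lvw.1).
by exists None.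
Qed.

(** If a is the only point of Z at v, a node over it would have an empty $B$-set. A second point is
    supplied first: any label alive at w differs from a, and [ri_leaf] matches it in L. *)
Lemma leaf_step : (forall t, ~ fr Z v t a) -> (forall y, ~ D0 Z v a y) ->
  exists s', gain s s'.
Proof.
move=> nfr n0; have nr := rt_single nv da fw nfr; have lvw := w_frlt WE fw.
have all y : D Z v y -> eqv Z v a y.
  by move=> dy; apply: contrapT => n; apply: (n0 y).
have dhE : D E (fE v) (hE a) by apply/(emb_D eE nv) => //; exact: (DrtZ da).
have dhL : D L (fL v) (hL a) by apply/(emb_D eL nv) => //; exact: (DrtZ da).
have [x dx] := Einh (w_nd WE lvw.1).2.
have dvx : D E (fE v) x := w_mono WE lvw.1 dx.
have nx : ~ eqv E (fE v) (hE a) x.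
  by move=> e; apply: (w_dom1 WE fw); apply/(eqvDE WE lvw.1 e).
have [b [nb hb]] := ri_leaf LR (fL_rt nv nr) dhL dhL.
have gate (Q Y : Type) (V : pst Q Y) (f : P -> Q) (h : X -> Y) (e : emb Z V f h) m :
    wptb V -> D V (f v) m -> ~ eqv V (f v) (h a) m ->
    adjacent (be Z v) (be V (f v)) h m a (dirK (be Z v) a None).
  move=> WV dm nm; have HV := w_preB WV (f v).
  have iso : forall x y z, D Z (rt Z) x -> D Z (rt Z) y -> D Z (rt Z) z ->
    (be V (f v) (h x) (h y) (h z) <-> be Z v x y z) by move=> *; exact: (e_be e).
  apply: (gate_adjacent HV iso dm) => //.
  - exact: (DrtZ da).
  - by move=> y; exact: DrtZ.
  - by move=> e'; apply: nm; exact: (pb_esym HV).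
  - move=> y dy; apply: (pb_sym HV); apply: (pb_eany HV) => //.
    by apply/(e_be e nv (DrtZ da) (DrtZ dy) (DrtZ dy)); exact: all.
have db := pb_domy (w_preB WL _) hb.
apply: (@point_step v a None x b nv nr da) => //.
- exact: (gate _ _ _ _ _ eE).
- exact: (gate _ _ _ _ _ eL).
- by move=> _ y z /all e _ n; case: (n e).
Qed.

End Child.

Lemma child_ex v p F : fr E (fE v) p F ->
  exists w, [/\ fr E (fE v) w F, child v w & le E w p].
Proof.
move=> fp; have [ndv ndp] := fr_nd WE fp.
have [w [fw wp] wm] : exists2 w, (fr E (fE v) w F /\ le E w p) &
   forall q, (fr E (fE v) q F /\ le E q p) -> ~ lt E q w.
  apply: (fin_min (R := lt E)) (p) _.
  - by move=> x y z h [h' _]; exact: (lt_leT WE h h').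
  - by move=> x [].
  - by apply: fin_sub EfinP => q [/(fr_nd WE) []].
  - by split=> //; exact: (w_refl WE).
exists w; split=> // w' l lw; apply: contrapT => n.
by apply: (wm w') => //; split; [exact: (fr_down WE fw)|exact: (w_trans WE lw)].
Qed.

Definition missing v x := D E (fE v) x /\ forall z, D Z v z -> ~ eqv E (fE v) (hE z) x.

Hypothesis noA : forall v a w, nd Z v -> D Z v a -> fr E (fE v) w (hE a) ->
  child v w -> hit s (inl w).

(** The child w is present in Z as v', and x is not missing there; so some label of Z equals x at w,
    which means that it lies with x in one branch at a. *)
Lemma child_hit v a w x : nd Z v -> D Z v a -> fr E (fE v) w (hE a) -> child v w ->
  D E (fE v) x -> ~ eqv E (fE v) (hE a) x ->
  (forall v', lt Z v v' -> ~ missing v' x) ->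
  exists2 z, D Z v z & ~ be E (fE v) (hE a) (hE z) x.
Proof.
move=> nv da fw cw dx nx nm; have [v' nv' ev'] := noA nv da fw cw.
have lw := w_frlt WE fw; rewrite -ev' in lw.
have l : lt Z v v'.
  by case: lw => l n; split; [exact/(e_le eE)|move=> e; apply: n; rewrite e].
have dwx := chE_D fw cw dx nx.
have [z dz ez] : exists2 z, D Z v' z & eqv E w (hE z) x.
  apply: contrapT => n; apply: (nm v' l); split; first by rewrite ev'.
  by move=> z dz e; apply: n; exists z => //; rewrite -ev'.
by exists z; [exact: (w_mono W l.1)|exact: (chE_eqv fw cw ez)].
Qed.

(** A highest node v with a missing label x is taken, so that [child_hit] applies: at a label which
    carries nodes of E, the branch of x is already represented. Hence a gate found by
    [gate_or_between] carries no node, and x is added there as a leaf; otherwise a point between two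
    neighbours is added. *)
Lemma missing_step v0 x0 : nd Z v0 -> missing v0 x0 -> exists s', gain s s'.
Proof.
move=> nv0 m0.
have [_ [v [x [nv mx <-]]] vmax] : exists2 p,
    (exists v x, [/\ nd Z v, missing v x & fE v = p]) &
    forall q, (exists v x, [/\ nd Z v, missing v x & fE v = q]) -> ~ lt E p q.
  apply: (fin_min (R := fun p q => lt E q p)).
  - by move=> a b c h [h' _]; exact: (le_ltT WE h' h).
  - by move=> a [].
  - by apply: fin_sub EfinP => p [v [x [nv _ <-]]]; exact: (e_nd eE).
  - by exists v0, x0.
have nm v' x' : lt Z v v' -> ~ missing v' x'.
  move=> l m; apply: (vmax (fE v')); last exact: (emb_lt W WE eE).
  by exists v', x'; split=> //; case: (w_nd W l.1).
have [dx hx] := mx.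
have nr : v <> rt Z.
  (* In the star of the root, two labels in one branch at the centre are equal, so [child_hit]
     contradicts that x is missing. *)
  move=> e; subst v; have [t lt'] := s_top s.
  have [w [fw cw _]] := child_ex (e_fr eE (w_frctr W lt')).
  have dc := w_ctr W.
  have [z dz nb] := child_hit nv dc fw cw dx (hx _ dc) (fun v' l => @nm v' x l).
  move: fw nb dx; rewrite (e_rt eE) => fw nb dx'.
  apply: nb; apply/(w_star WE).
  have dz' : D E (rt E) (hE z) by rewrite -(e_rt eE); apply/(emb_D eE nv).
  have dc' : D E (rt E) (hE (ctr Z)) by exact: (w_frD WE fw).
  split=> //; right; right; split; last by rewrite -(e_rt eE); exact: hx.
  exact: (w_freq WE (w_frctr WE (w_frlt WE fw)) fw).
have HE := w_preB WE (fE v); have HL := w_preB WL (fL v).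
have isoE : forall y1 y2 y3, D Z (rt Z) y1 -> D Z (rt Z) y2 -> D Z (rt Z) y3 ->
  (be E (fE v) (hE y1) (hE y2) (hE y3) <-> be Z v y1 y2 y3) by move=> *; exact: (e_be eE).
have isoL : forall y1 y2 y3, D Z (rt Z) y1 -> D Z (rt Z) y2 -> D Z (rt Z) y3 ->
  (be L (fL v) (hL y1) (hL y2) (hL y3) <-> be Z v y1 y2 y3) by move=> *; exact: (e_be eL).
have nrL := fL_rt nv nr.
have dd y : be Z v y y y -> D Z (rt Z) y by exact: DrtZ.
have ED y : D Z v y -> D E (fE v) (hE y) by move=> dy; apply/isoE => //; exact: DrtZ dy.
have LD y : D Z v y -> D L (fL v) (hL y) by move=> dy; apply/isoL => //; exact: DrtZ dy.
pose S y := exists2 z, D Z v z & hE z = y.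
have [z0 dz0] := s_inh nv.
case: (@gate_or_between _ (be E (fE v)) S x (hE z0) HE) => //.
- apply: fin_sub EfinX => y [z dz <-]; rewrite -(e_rt eE).
  by apply/(emb_D eE (w_ndrt W) (DrtZ dz)); exact: (DrtZ dz).
- by move=> y [z dz <-]; exact: ED.
- move=> _ _ _ [y1 d1 <-] [y2 d2' <-] [y3 d3 <-].
  have := (isoE y1 y2 y3 (DrtZ d1) (DrtZ d2') (DrtZ d3)) => ->.
  have := (isoE y2 y1 y3 (DrtZ d2') (DrtZ d1) (DrtZ d3)) => ->.
  have := (isoE y3 y1 y2 (DrtZ d3) (DrtZ d1) (DrtZ d2')) => -> n1 n2 n3.
  have [u [u1 u2 u3]] := pb_pos (w_preB W v) d1 d2' d3 n1 n2 n3.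
  have du := pb_domx (w_preB W v) u1; have du' := DrtZ du.
  have [d1' d2'' d3'] := And3 (DrtZ d1) (DrtZ d2') (DrtZ d3).
  exists (hE u); split; first by exists u.
  by split; apply/isoE.
- by exists z0.
- by move=> y [z dz <-]; exact: hx.
- move=> [_ [a da <-] ga].
  have da' := DrtZ da.
  have g z : D Z v z -> be E (fE v) (hE a) x (hE z) by move=> dz; apply: ga; exists z.
  have nfE p : ~ fr E (fE v) p (hE a).
    move=> /child_ex [w [fw cw _]].
    have [z dz nb] := child_hit nv da fw cw dx (hx _ da) (fun v' l => @nm v' x l).
    by apply: nb; apply: (pb_sym HE); exact: g.
  have deg y z : D Z v y -> D Z v z -> ~ eqv Z v a y -> ~ eqv Z v a z -> ~ be Z v a y z.
    move=> dy dz ny nz hb; have [_ _ fsE] := EP.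
    have [|p /nfE//] := fsE (fE v) (hE a) x (hE y) (hE z).
    split; split; [exact: g|exact: g| |exact: hx| |].
    + exact/(isoE _ _ _ da' (DrtZ dy) (DrtZ dz)).
    + by move/(emb_eqv eE nv da' (DrtZ dy)).
    + by move/(emb_eqv eE nv da' (DrtZ dz)).
  (* k represents the only branch of Z at a, or is a itself if there is none; [ri_leaf] then yields
     a point of L outside this branch. *)
  have [k [dk hk]] : exists k, D Z v k /\ forall y, D Z v y -> ~ eqv Z v a y ->
      ~ eqv Z v a k /\ ~ be Z v a k y.
    have [[k [dk nk]]|n] := pselect (exists k, D Z v k /\ ~ eqv Z v a k).
      by exists k; split=> // y dy ny; split=> //; exact: deg.
    by exists a; split=> // y dy ny; case: n; exists y.
  have [b [nb hb]] := ri_leaf LR nrL (LD _ da) (LD _ dk).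
  have db := pb_domy HL hb.
  have gb y : D Z v y -> be L (fL v) (hL a) b (hL y).
    move=> dy; have [e|n] := pselect (eqv Z v a y).
      apply: (pb_sym HL); apply: (pb_eany HL) => //.
      by apply/(emb_eqv eL nv da' (DrtZ dy)).
    have [n1 n2] := hk y dy n.
    apply: contrapT => nby; apply: n2; apply: contrapT => n2.
    have n2' : ~ be L (fL v) (hL a) (hL k) (hL y).
      by move/(isoL _ _ _ da' (DrtZ dk) (DrtZ dy)).
    apply: (pb_brtrans HL (LD _ dy) nby _) hb.
    by move=> /(pb_sym HL).
  apply: (@point_step v a None x b nv nr da) => //.
  + apply: (gate_adjacent HE isoE) => //.
    by move=> e; apply: (hx _ da); exact: (pb_esym HE).
  + apply: (gate_adjacent HL isoL) => //.
    by move=> e; apply: nb; exact: (pb_esym HL).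
  + by move=> _ t /(e_fr eE) /nfE.
- move=> [m [_ [_ [[a da <-] [k dk <-] hm nmS adj]]]].
  have da' := DrtZ da; have dk' := DrtZ dk.
  have dm := pb_domx HE hm.
  have na := nmS _ (ex_intro2 _ _ a da erefl); have nk := nmS _ (ex_intro2 _ _ k dk erefl).
  have nak : ~ eqv Z v a k.
    move=> /(emb_eqv eE nv da' dk') e; apply: na; apply: (pb_eq HE hm).
    apply: (pb_sym HE); apply: (pb_eany HE) => //; exact: eqv_sym e.
  have adj' y : be Z v y a k -> be Z v y a a \/ be Z v y k k.
    move=> hy; have dy := pb_domx (w_preB W v) hy; have dy' := DrtZ dy.
    have Sy : S (hE y) by exists y.
    have /(adj _ Sy) : be E (fE v) (hE y) (hE a) (hE k) by apply/isoE.
    by case=> h; [left|right]; apply/isoE.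
  have [b [hb n1 n2]] := ri_between LR nrL (LD _ da) (LD _ dk) (fun e => nak ((emb_eqv eL nv da' dk').1 e)).
  apply: (@point_step v a (Some k) m b nv nr da) => //.
  + by move=> k0 [<-].
  + exact: (pb_domx HL hb).
  + exact: (between_adjacent (w_preB W v) HE isoE dm dd).
  + apply: (between_adjacent (w_preB W v) HL isoL) => //.
    exact: (pb_domx HL hb).
Qed.

End Step.

Definition complete (s : stage) : Prop :=
  (forall p, nd E p -> hit s (inl p)) /\
  forall x, D E (rt E) x -> exists2 z, D (sZ s) (rt (sZ s)) z & eqv E (rt E) (shE z) x.

(** If no enlargement exists, the steps above show that every child over a label of Z is present and
    that no label is missing. Then no node p is missing either: from the highest node of Z below p,
    the next node of E towards p is over a label of Z, hence present. *)
Lemma progress (s : stage) : complete s \/ exists s', gain s s'.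
Proof.
have [g|ng] := pselect (exists s', gain s s'); first by right.
left; have [W d2 fs] := s_ptb s; have eE := s_E s.
have noA v a w : nd (sZ s) v -> D (sZ s) v a -> fr E (sfE v) w (shE a) -> child v w -> hit s (inl w).
  move=> nv da fw cw; apply: contrapT => nh; apply: ng.
  have [[t ft]|nf] := pselect (exists t, fr (sZ s) v t a); first exact: (star_step nv da fw cw ft nh).
  have nf' t : ~ fr (sZ s) v t a by move=> h; apply: nf; exists t.
  have [[y hy]|n0] := pselect (exists y, D0 (sZ s) v a y).
    by apply: (node_step nv da fw cw nf' nh); exists y.
  by apply: (leaf_step nv da fw nf') => y hy; apply: n0; exists y.
have nm v x : nd (sZ s) v -> ~ missing v x.
  by move=> nv m; apply: ng; exact: (missing_step noA nv m).
split.
  move=> p np; apply: contrapT => nh.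
  have [_ [v [nv lv <-]] vmax] : exists2 q, (exists v, [/\ nd (sZ s) v, le E (sfE v) p & sfE v = q]) &
    forall q', (exists v, [/\ nd (sZ s) v, le E (sfE v) p & sfE v = q']) -> ~ lt E q q'.
    apply: (fin_min (R := fun p q => lt E q p)).
    - by move=> a b c h [h' _]; exact: (le_ltT WE h' h).
    - by move=> a [].
    - by apply: fin_sub EfinP => q [v [nv _ <-]]; exact: (e_nd eE).
    - exists (rt (sZ s)); split=> //; first exact: (w_ndrt W).
      by rewrite (e_rt eE); exact: (w_rt WE).
  have lvp : lt E (sfE v) p by split=> // e; apply: nh; exists v.
  have [F fF] := w_frex WE lvp.
  have [a da ea] : exists2 a, D (sZ s) v a & eqv E (sfE v) (shE a) F.
    apply: contrapT => n; apply: (nm v F nv); split; first exact: (w_frD WE fF).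
    by move=> z dz e; apply: n; exists z.
  have [w [fw cw wp]] := child_ex (w_frcong WE fF (eqv_sym WE ea)).
  have [v' nv' ev'] := noA v a w nv da fw cw.
  apply: (vmax w); last exact: (w_frlt WE fw).
  by exists v'; rewrite ev'.
move=> x dx; apply: contrapT => n; apply: (nm (rt (sZ s)) x (w_ndrt W)).
rewrite /missing (e_rt eE); split=> // z dz e; apply: n; by exists z.
Qed.

Lemma above_refl s : above s s.
Proof. by split=> [t|x] h; [exists t|exists x]. Qed.

Lemma above_trans s1 s2 s3 : above s1 s2 -> above s2 s3 -> above s1 s3.
Proof.
move=> [h1 h2] [h3 h4]; split.
  move=> t /h1 [t2 [n2 <- <-]]; have [t3 [n3 e1 e2]] := h3 _ n2; by exists t3.
move=> x /h2 [t2 [n2 <- <-]]; have [t3 [n3 e1 e2]] := h4 _ n2; by exists t3.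
Qed.

Lemma above_hit s s' q : above s s' -> hit s q -> hit s' q.
Proof.
move=> [h1 h2]; case: q => [p|x] [z hz <-].
  by have [t [nt e1 _]] := h1 _ hz; exists t.
by have [t [nt e1 _]] := h2 _ hz; exists t.
Qed.

Lemma fin_sum (A B : Type) (Q : A -> Prop) (R : B -> Prop) : fin Q -> fin R ->
  fin (fun q => match q with inl a => Q a | inr b => R b end).
Proof.
move=> [n [e he]] [m [g hg]].
exists (n + m)%N, (fun i => if (i < n)%N then omap inl (e i) else omap inr (g (i - n)%N)).
move=> [a /he [i li ei]|b /hg [i li ei]].
  by exists i; [exact: ltn_addr|rewrite li ei].
exists (n + i)%N; first by rewrite ltn_add2l.
by rewrite ltnNge leq_addr /= addKn ei.
Qed.

(** Every gain shrinks the finite set of nodes and labels of E that are not hit. *)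
Lemma completion (s : stage) : exists2 s', above s s' & complete s'.
Proof.
pose U q := match q with inl p => nd E p | inr x => D E (rt E) x end.
suff key Q : fin Q -> forall s, (forall q, U q -> ~ hit s q -> Q q) ->
    exists2 s', above s s' & complete s'.
  exact: (key U (fin_sum EfinP EfinX)).
move: Q; apply: fin_ind => Q IH {}s hQ.
case: (progress s) => [c|[s1 [ab g]]]; first by exists s => //; exact: above_refl.
have [q [uq nq hq]] : exists q, [/\ U q, ~ hit s q & hit s1 q].
  by case: g => [[p [*]]|[x [*]]]; [exists (inl p)|exists (inr x)].
have [|||s2 ab2 c2] := IH (fun q => Q q /\ ~ hit s1 q) _ _ s1.
- by move=> q' [].
- by exists q; split; [exact: hQ|case].
- by move=> q' uq' nq'; split=> //; apply: hQ => // h; apply: nq'; exact: above_hit ab h.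
by exists s2 => //; exact: above_trans ab ab2.
Qed.

(** The embedding goes back from E to the stage and on to L. On labels the way back is a choice,
    determined only up to equality at the root, and so is the compatibility claimed for labels. *)
Lemma complete_emb (s : stage) : complete s -> exists f h,
  [/\ emb E L f h, (forall t, nd (sZ s) t -> f (sfE t) = sfL t) &
    forall x, D (sZ s) (rt (sZ s)) x -> eqv L (rt L) (h (shE x)) (shL x)].
Proof.
move=> [cP cX]; have [W _ _] := s_ptb s; have eE := s_E s; have eL := s_L s.
have [t0 _] := s_top s; have [z0 dz0] := s_inh (w_ndrt W).
have /choice [f hf] : forall p, exists q, forall t, nd (sZ s) t -> sfE t = p -> sfL t = q.
  move=> p; have [[t nt et]|n] := pselect (exists2 t, nd (sZ s) t & sfE t = p).
    by exists (sfL t) => t' nt' et'; congr sfL; apply: (emb_inj W eE) => //; rewrite et.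
  by exists (rt L) => t nt et; case: n; exists t.
have /choice [g hg] : forall x, exists z, D E (rt E) x -> D (sZ s) (rt (sZ s)) z /\ eqv E (rt E) (shE z) x.
  move=> x; have [dx|n] := pselect (D E (rt E) x); last by exists z0.
  by have [z dz ez] := cX x dx; exists z.
have fE t : nd (sZ s) t -> f (sfE t) = sfL t by move=> nt; rewrite -(hf (sfE t) t nt erefl).
have rtE : rt E = sfE (rt (sZ s)) by rewrite (e_rt eE).
have bE t x y z : nd (sZ s) t -> D E (rt E) x -> D E (rt E) y -> D E (rt E) z ->
    (be E (sfE t) x y z <-> be (sZ s) t (g x) (g y) (g z)).
  move=> nt dx dy dz; have [gx ex] := hg x dx; have [gy ey] := hg y dy; have [gz ez] := hg z dz.
  rewrite -(e_be eE nt gx gy gz).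
  have lr : le E (rt E) (sfE t) by apply: (w_rt WE); exact: (e_nd eE).
  have H := w_preB WE (sfE t).
  have cg u : D E (rt E) u -> D E (sfE t) u -> eqv E (sfE t) u (shE (g u)).
    by move=> du dtu; apply: (w_monoe WE lr) dtu; apply: (eqv_sym WE); case: (hg u du).
  have cg' u : D E (rt E) u -> D E (sfE t) (shE (g u)) -> eqv E (sfE t) (shE (g u)) u.
    by move=> du dtu; apply: (w_monoe WE lr) dtu; case: (hg u du).
  split=> hb; have [d1 d2 d3] := pb_dom H hb; apply: (pb_cong H) hb; first [exact: cg|exact: cg'].
exists f, (fun x => shL (g x)); split=> //; last first.
  move=> x dx; have dx' : D E (rt E) (shE x) by rewrite rtE; apply/(emb_D eE) => //; exact: (w_ndrt W).
  have [gx ex] := hg _ dx'.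
  rewrite -(e_rt eL); apply/(emb_eqv eL) => //; first exact: (w_ndrt W).
  by move: ex; rewrite rtE => /(emb_eqv eE (w_ndrt W) gx dx).
split.
- by move=> p /cP [t nt <-]; rewrite fE //; exact: (e_nd eL).
- by rewrite rtE fE; [exact: (e_rt eL)|exact: (w_ndrt W)].
- move=> p /cP [t nt <-] n; rewrite fE //.
  have n' : t <> rt (sZ s) by move=> e; apply: n; rewrite e -rtE.
  by rewrite (e_col eL) // (e_col eE).
- move=> p q /cP [t nt <-] /cP [u nu <-]; rewrite !fE //.
  by rewrite (e_le eL nt nu) (e_le eE nt nu).
- move=> m p q gm; have [g1 g2 _] := gm.
  have [nm np] := w_nd WE g1; have [_ nq] := w_nd WE g2.
  have [t nt et] := cP _ np; have [u nu eu] := cP _ nq; subst p q.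
  have [w gw] := w_glb W nt nu.
  have -> : m = sfE w by apply: (glb_uniq WE gm); exact: (e_glb eE).
  have nw : nd (sZ s) w by case: gw => /(w_nd W) [].
  by rewrite !fE //; exact: (e_glb eL).
- move=> p x y z /cP [t nt <-] dx dy dz; rewrite fE // bE //.
  have [gx _] := hg x dx; have [gy _] := hg y dy; have [gz _] := hg z dz.
  exact: (e_be eL).
- move=> p q x fpq; have [np nq] := fr_nd WE fpq.
  have [t nt et] := cP _ np; have [u nu eu] := cP _ nq; subst p q.
  rewrite !fE //; apply: (e_fr eL).
  have dx := w_frD WE fpq.
  have dx' : D E (rt E) x by exact: (D_rt WE dx).
  have [gx ex] := hg _ dx'.
  have lr : le E (rt E) (sfE t) by apply: (w_rt WE); exact: (e_nd eE).
  have e1 : eqv E (sfE t) x (shE (g x)) by apply: (w_monoe WE lr) dx; exact: (eqv_sym WE).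
  have f1 := w_frcong WE fpq e1.
  apply: (emb_fr W WE eE) f1.
    have [l n] := w_frlt WE fpq; split; first exact/(e_le eE).
    by move=> e; apply: n; rewrite e.
  by apply/(emb_D eE) => //; case: (eqvD WE e1).
Qed.

End Richness.

(** * The structure with only a virtual root *)

Section Seed.
Context {d : Order.disp_t} {C : orderType d}.
Variables (P X : Type) (r0 : P) (x0 : X) (Dm : X -> Prop) (cl : P -> C).
Hypothesis Dx0 : Dm x0.

Definition seed : @pst d C P X :=
  Pst (eq r0) (fun s t => r0 = s /\ r0 = t) r0 x0 cl
    (fun t x y z => r0 = t /\ starb Dm eq (eq x0) x y z) (fun _ _ _ => False).

Lemma seed_star x y : starb Dm eq (eq x0) x y y <-> x = y /\ Dm x.
Proof.
split=> [[dx _ _ h]|[<- dx]]; last by split=> //; left.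
by split=> //; case: h => [|[|[_ []]]].
Qed.

Lemma seed_eqv x y : eqv seed r0 x y <-> x = y /\ Dm x.
Proof. by rewrite -seed_star; split=> [[]|]. Qed.

Lemma seed_D x : D seed r0 x <-> Dm x.
Proof. by rewrite /D -/(eqv seed r0 x x) seed_eqv; split=> [[]|]. Qed.

Lemma seed_lt s t : ~ lt seed s t.
Proof. by case=> -[<- <-]. Qed.

Lemma seed_wptb : wptb seed.
Proof.
have nlt := seed_lt.
split; try by []; try by move=> ? ? /nlt; try by move=> ? /nlt.
- by move=> s t u [h _] [_ h']; split.
- by move=> s t [h1 h2] _; rewrite -h1.
- by move=> x y z h1 h2; left; split; [case: h1|case: h2].
- by move=> s t <- <-; exists r0; split.
- by move=> t x y z [].
- move=> t; have [e|n] := pselect (r0 = t); last first.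
    have F x y z : be seed t x y z -> False by case.
    by split=> *; exfalso; eauto.
  subst t; have H : preB (starb Dm eq (eq x0)).
    by apply: star_preB => //; [move=> *; congruence|move=> *; congruence|move=> *; congruence|left; exists x0].
  have -> : be seed r0 = starb Dm eq (eq x0).
    by apply/funext => x; apply/funext => y; apply/funext => z; apply/propext; split=> [[]|].
  exact: H.
- exact/seed_D.
- move=> x y z; split.
    case=> _ [h1 h2 h3 h]; split; [exact/seed_D|exact/seed_D|exact/seed_D|].
    case: h => [e|[e|[e n]]]; [left|right; left|right; right].
    + exact/seed_eqv.
    + exact/seed_eqv.
    + split; first by apply/seed_eqv; split=> //; rewrite /= e.
      by case/seed_eqv.
  case=> /seed_D h1 /seed_D h2 /seed_D h3 h; split=> //; split=> //.
  case: h => [/seed_eqv[e _]|[/seed_eqv[e _]|[/seed_eqv[e _] n]]]; [by left|by right; left|].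
  by right; right; split=> // e'; apply: n; apply/seed_eqv.
- by move=> s t x [<- <-].
- by move=> s t x y [<- <-].
- by move=> s /nlt.
- by move=> s t x y /nlt.
Qed.

Lemma seed_br3 t b x y z : br3 seed t b x y z -> t = r0 /\ eqv seed r0 x0 b.
Proof.
case=> -[[<- h1] _ _] [n1 n2 _]; split=> //; apply/seed_eqv; split=> //.
have [db dx dy h] := h1; case: h => [e|[e|[//]]].
  by case: n1; apply/seed_eqv.
by case: n2; apply/seed_eqv.
Qed.

Lemma seed_emb (Q Y : Type) (V : @pst d C Q Y) (h : X -> Y) : wptb V -> h x0 = ctr V ->
  (forall x y, Dm x -> Dm y -> (eqv V (rt V) (h x) (h y) <-> x = y)) ->
  emb seed V (fun _ => rt V) h.
Proof.
move=> WV h0 hE; split=> //.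
- by move=> t _; exact: (w_ndrt WV).
- by move=> t <- [].
- by move=> s t <- <-; split=> // _; apply: (w_refl WV); exact: (w_ndrt WV).
- by move=> m s t _; have := w_refl WV (w_ndrt WV); split.
- move=> t x y z <- /seed_D dx /seed_D dy /seed_D dz.
  have DE u : Dm u -> D V (rt V) (h u) by move=> du; exact/hE.
  rewrite (w_star WV) -h0; split=> [[h1 h2 h3 hh]|[_ [h1 h2 h3 hh]]]; split=> //.
  + by split=> //; move: hh; rewrite !hE.
  + exact: DE.
  + exact: DE.
  + exact: DE.
  + by rewrite !hE.
Qed.

End Seed.

(** * The generic chain *)

Section Relabel.
Context {d : Order.disp_t} {C : orderType d}.
Variables (P1 X1 P2 X2 : Type) (Z : @pst d C P2 X2) (jP : P1 -> P2) (jX : X1 -> X2).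
Variables (r : P1) (c : X1).
Hypotheses (jr : jP r = rt Z) (jc : jX c = ctr Z).
Hypothesis jinj : forall p q, nd Z (jP p) -> jP p = jP q -> p = q.
Hypothesis jPs : forall q, nd Z q -> exists p, jP p = q.
Hypothesis jXs : forall y, D Z (rt Z) y -> exists x, jX x = y.

(** Every addition wraps a label type in [option]. Renaming brings the result back to fixed label
    types, so that the stages of the chain can be literal extensions of one another, with identity
    maps as inclusions. *)
Definition relab : @pst d C P1 X1 :=
  Pst (fun t => nd Z (jP t)) (fun s t => le Z (jP s) (jP t)) r c (fun t => col Z (jP t))
    (fun t x y z => be Z (jP t) (jX x) (jX y) (jX z))
    (fun t s x => fr Z (jP t) (jP s) (jX x)).

Lemma relab_lt s t : wptb Z -> (lt relab s t <-> lt Z (jP s) (jP t)).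
Proof.
move=> W; split=> -[h n]; split=> // e; apply: n; last by rewrite e.
by apply: (jinj _ e); case: (w_nd W h).
Qed.

Lemma relab_cone t s1 s2 : wptb Z ->
  (cone relab t s1 s2 <-> cone Z (jP t) (jP s1) (jP s2)).
Proof.
move=> W; split=> -[z [h1 h2 h3]].
  by exists (jP z); split=> //; apply/relab_lt.
have [z' ez] := jPs (w_nd W h2).1; subst z.
by exists z'; split=> //; apply/relab_lt.
Qed.

Lemma relab_glb m s t : wptb Z -> (isglb Z (jP m) (jP s) (jP t) <-> isglb relab m s t).
Proof.
move=> W; split=> -[h1 h2 h3]; split=> // w; first exact: h3.
move=> h4 h5; have [w' ew] := jPs (w_nd W h4).1; subst w; exact: h3.
Qed.

Lemma relab_wptb : wptb Z -> wptb relab.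
Proof.
move=> W; have LT s t := relab_lt s t W; have CN t s1 s2 := relab_cone t s1 s2 W.
have sx t x : D Z t x -> exists x', jX x' = x by move=> /(D_rt W) /jXs.
split=> /=.
- by move=> s t /(w_nd W).
- by move=> t /(w_refl W).
- by move=> s t u; exact: (w_trans W).
- move=> s t h1 h2; apply: jinj; last exact: (w_anti W).
  by case: (w_nd W h1).
- by move=> x y z; exact: (w_tree W).
- move=> s t ns nt; have [m g] := w_glb W ns nt.
  have [m' em] : exists m', jP m' = m by apply: jPs; case: g => /(w_nd W) [].
  by subst m; exists m'; apply/relab_glb.
- by move=> t nt; rewrite jr; exact: (w_rt W).
- by rewrite jr; exact: (w_ndrt W).
- by move=> s t /LT /= h1 /LT /= h2; apply/CN; rewrite /= jr in h1 h2 *; exact: (w_cone W).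
- move=> s t /LT h n; apply: (w_col W h) => e; apply: n.
  by apply: jinj; rewrite ?jr // e; exact: (w_ndrt W).
- by move=> t x y z; exact: (w_be W).
- move=> t; have H := w_preB W (jP t); split.
  + by move=> x y z; exact: (pb_dom H).
  + by move=> x y; exact: (pb_refl H).
  + by move=> x y z; exact: (pb_sym H).
  + by move=> x y z; exact: (pb_eq H).
  + by move=> x y z w; exact: (pb_split H).
  + by move=> x y z w; exact: (pb_congl H).
  + by move=> x y z w; exact: (pb_congr H).
  + move=> x y z dx dy dz n1 n2 n3; have [u [u1 u2 u3]] := pb_pos H dx dy dz n1 n2 n3.
    have [u' eu] := sx _ _ (pb_domx H u1); subst u; by exists u'.
- by rewrite /D /= jr jc; exact: (w_ctr W).
- by move=> x y z; rewrite jr (w_star W) /starb /eqv /D /= jr jc.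
- by move=> s t x; exact: (w_mono W).
- by move=> s t x y; exact: (w_monoe W).
- by move=> s /LT; rewrite /= jr jc; exact: (w_frctr W).
- by move=> t s x /(w_frlt W) h; apply/LT.
- by move=> t s x; exact: (w_frD W).
- move=> t s /LT h; have [x fx] := w_frex W h.
  by have [x' ex] := sx _ _ (w_frD W fx); exists x'; rewrite ex.
- by move=> t s x y; exact: (w_freq W).
- by move=> t s x y; exact: (w_frcong W).
- by move=> t s1 s2 x h1 /LT h2; rewrite CN; exact: (w_frcone W).
- by move=> u t x; exact: (w_dom1 W).
- by move=> u t a x y; exact: (w_eq1 W).
- move=> s t x y /LT h e; have [u [a [h1 h2 h3]]] := w_eq2 W h e.
  have [u' eu] := jPs (fr_nd W h2).1; subst u.
  by have [a' ea] := sx _ _ (w_frD W h2); subst a; exists u', a'.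
Qed.

Lemma relab_ptb : ptb Z -> ptb relab.
Proof.
case=> W d2 fs; split; first exact: relab_wptb.
- move=> s t x /(relab_lt _ _ W) h h1 h2; have [u h3 h4] := d2 _ _ _ h h1 h2.
  by have [u' eu] := jPs (fr_nd W h4).1; subst u; exists u'.
- move=> t a x y z hb; have [s h] := fs (jP t) (jX a) (jX x) (jX y) (jX z) hb.
  by have [s' es] := jPs (fr_nd W h).2; subst s; exists s'.
Qed.

Lemma emb_relab (N : @pst d C P1 X1) f h : wptb Z -> wptb N -> emb N Z f h ->
  (forall t, nd N t -> jP t = f t) -> (forall x, D N (rt N) x -> jX x = h x) ->
  r = rt N -> emb N relab id id.
Proof.
move=> W WN e ef eh er; split=> //=.
- by move=> t nt; rewrite ef //; exact: (e_nd e).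
- by move=> t nt n; rewrite ef //; exact: (e_col e).
- by move=> s t ns nt; rewrite !ef //; exact: (e_le e).
- move=> m s t g; apply/relab_glb => //; have [g1 g2 _] := g.
  have [nm ns] := w_nd WN g1; have [_ nt] := w_nd WN g2.
  by rewrite !ef //; exact: (e_glb e).
- by move=> t x y z nt dx dy dz; rewrite ef // !eh //; exact: (e_be e).
- move=> t s x h1; have [nt ns] := fr_nd WN h1; rewrite !ef // eh; first exact: (e_fr e).
  exact: (D_rt WN (w_frD WN h1)).
Qed.

End Relabel.

Section Old.
Context {d : Order.disp_t} {C : orderType d}.
Variables (P X : Type) (Z : @pst d C P X).
Hypothesis W : wptb Z.

Lemma old_addpt v a k al rho : emb Z (addpt Z v a k al rho) id Some.
Proof. by split=> //= t x y z _ _ _ _; rewrite addbe_old. Qed.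

Lemma old_addnode v a c x0 : emb Z (addnode Z v a c x0) Some id.
Proof.
split=> //; last by move=> m s t g; exact: addnode_glb.
Qed.

End Old.

(** * Finite stages with fixed label types *)

Section Labels.
Context {d : Order.disp_t} {C : orderType d}.
Implicit Type N : @pst d C (nat * C) nat.

Lemma fin_bound (T : Type) (g : T -> nat) (Q : T -> Prop) : fin Q ->
  exists m, forall x, Q x -> (g x < m)%N.
Proof.
case=> n [e he].
suff [m hm] : exists m, forall i x, (i < n)%N -> e i = Some x -> (g x < m)%N.
  by exists m => x /he [i li ei]; exact: hm li ei.
clear he; elim: n => [|n [m hm]]; first by exists 0%N.
exists (maxn m (if e n is Some x then (g x).+1 else 0)) => i x.
rewrite ltnS leq_eqVlt => /orP[/eqP->|li] ei.
  by rewrite ei leq_maxr.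
by apply: leq_trans (hm i x li ei) _; exact: leq_maxl.
Qed.

(** A node label contains its colour, so the union of the stages is coloured without choices and
    fresh labels of every colour remain. [la_ram] adds what [ptb] leaves open: a point that carries
    nodes does ramify. *)
Record lab N : Prop := {
  la_ptb : ptb N;
  la_finP : fin (nd N);
  la_finX : fin (D N (rt N));
  la_inh : forall t, nd N t -> exists x, D N t x;
  la_ram : forall t s, lt N t s -> exists a x y z, fr N t s a /\ br3 N t a x y z;
  la_top : exists t, lt N (rt N) t;
  la_col : forall t, nd N t -> col N t = t.2 }.

Definition sub N N' : Prop := emb N N' id id /\ ctr N' = ctr N.

Lemma subl_refl N : sub N N.
Proof. by split=> //; split. Qed.

Lemma emb_compose (P1 X1 P2 X2 P3 X3 : Type) (N1 : @pst d C P1 X1) (N2 : @pst d C P2 X2)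
    (N3 : @pst d C P3 X3) f1 h1 f2 h2 : wptb N1 -> wptb N2 ->
  emb N1 N2 f1 h1 -> emb N2 N3 f2 h2 -> emb N1 N3 (f2 \o f1) (h2 \o h1).
Proof.
move=> W1 W2 e1 e2.
have DD x : D N1 (rt N1) x -> D N2 (rt N2) (h1 x).
  by move=> dx; rewrite -(e_rt e1); apply/(emb_D e1) => //; exact: (w_ndrt W1).
split=> /=.
- by move=> t /(e_nd e1) /(e_nd e2).
- by rewrite (e_rt e1) (e_rt e2).
- move=> t nt n; rewrite -(e_col e1 nt n); apply: (e_col e2 (e_nd e1 nt)).
  move=> e; apply: n; apply: (w_anti W1); last exact: (w_rt W1).
  apply/(e_le e1 nt (w_ndrt W1)); rewrite e (e_rt e1).
  by apply: (w_refl W2); exact: (w_ndrt W2).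
- by move=> s t ns nt; rewrite -(e_le e1 ns nt); apply: (e_le e2); exact: (e_nd e1).
- by move=> m s t /(e_glb e1) /(e_glb e2).
- move=> t x y z nt dx dy dz; rewrite -(e_be e1 nt dx dy dz).
  by apply: (e_be e2); [exact: (e_nd e1)|exact: DD|exact: DD|exact: DD].
- by move=> t s x /(e_fr e1) /(e_fr e2).
Qed.

Lemma sub_trans N1 N2 N3 : wptb N1 -> wptb N2 -> sub N1 N2 -> sub N2 N3 -> sub N1 N3.
Proof.
move=> W1 W2 [e1 c1] [e2 c2]; split; last by rewrite c2.
exact: (emb_compose W1 W2 e1 e2).
Qed.

Lemma br3_emb (P X Q Y : Type) (Z : @pst d C P X) (V : @pst d C Q Y) f h t a x y z :
  wptb Z -> emb Z V f h -> br3 Z t a x y z -> br3 V (f t) (h a) (h x) (h y) (h z).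
Proof.
move=> W e [[h1 h2 h3] [n1 n2 n3]]; have H := w_preB W t.
have nt := w_be W h1.
have [/(D_rt W) da /(D_rt W) dx /(D_rt W) dy] := pb_dom H h1.
have [_ _ /(D_rt W) dz] := pb_dom H h2.
by split; split; apply/(e_be e).
Qed.

(** The renaming that makes the fresh label m the added element [None]. *)
Definition jx (T : eqType) (m x : T) : option T := if x == m then None else Some x.

Lemma jx_new (T : eqType) (m : T) : jx m m = None. Proof. by rewrite /jx eqxx. Qed.

Lemma jx_old (T : eqType) (m x : T) : x <> m -> jx m x = Some x.
Proof. by rewrite /jx => /eqP /negbTE ->. Qed.

Lemma jx_inj (T : eqType) (m : T) : injective (jx m).
Proof.
by move=> x y; rewrite /jx; case: eqP => [->|n]; case: eqP => [->|n'] // -[].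
Qed.

Lemma fin_add (T : Type) (m : T) (Q Q' : T -> Prop) : fin Q ->
  (forall x, Q' x -> Q x \/ x = m) -> fin Q'.
Proof.
move=> [n [e he]] h; exists n.+1, (fun i => if i is i.+1 then e i else Some m).
move=> x /h [/he [i li ei]|->]; first by exists i.+1.
by exists 0%N.
Qed.

Lemma sub_lt N N' s t : wptb N -> sub N N' -> nd N s -> nd N t -> (lt N' s t <-> lt N s t).
Proof. by move=> W [e _] ns nt; rewrite /lt -(e_le e ns nt). Qed.

Lemma fresh_x N : lab N -> exists m, ~ D N (rt N) m.
Proof.
move=> /la_finX /(fin_bound id) [m hm]; exists m => /hm; by rewrite ltnn.
Qed.

Lemma fresh_p N c : lab N -> exists p, ~ nd N p /\ p.2 = c.
Proof.
move=> /la_finP /(fin_bound (fun p => p.1)) [m hm]; exists (m, c); split=> // /hm.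
by rewrite ltnn.
Qed.

Lemma add_point_label N v a k : lab N -> nd N v -> D N v a -> v <> rt N ->
  (forall k0, k = Some k0 -> D N v k0 /\ ~ eqv N v a k0) ->
  (k = None -> forall t, ~ fr N v t a) ->
  (k = None -> forall y z, D N v y -> D N v z -> ~ eqv N v a y -> ~ eqv N v a z ->
     ~ be N v a y z) ->
  exists N' m, [/\ sub N N' /\ lab N', (forall t, nd N' t <-> nd N t),
    (forall s, ~ fr N' v s m), ~ eqv N' v a m &
    if k is Some k0 then be N' v m a k0 /\ ~ eqv N' v k0 m
    else forall y, D N v y -> be N' v a m y].
Proof.
move=> LN nv da nr hk kfr kdeg.
have [ZP fP fX inh ram top cl] := LN; have [W d2 fs] := ZP.
have [al [rho po]] := position_ex W nv da hk (fun e => False_ind _ (nr e)).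
have P1 := addpt_ptb W po ZP kfr kdeg; have [W1 _ _] := P1.
have [m hm] := fresh_x LN.
have mo x : D N (rt N) x -> jx m x = Some x by move=> dx; apply: jx_old => e; apply: hm; rewrite -e.
have mr t x : D N t x -> jx m x = Some x by move=> /(D_rt W) /mo.
have jc : jx m (ctr N) = ctr (addpt N v a k al rho) by apply: mo; exact: (w_ctr W).
have jXs y : D (addpt N v a k al rho) (rt (addpt N v a k al rho)) y -> exists x, jx m x = y.
  case: y => [y|] dy; last by exists m; rewrite jx_new.
  by exists y; apply: mo; move: dy; rewrite /D /= addbe_old.
have ji (p q : nat * C) : nd (addpt N v a k al rho) (id p) -> id p = id q -> p = q by [].
have js q : nd (addpt N v a k al rho) q -> exists p : nat * C, id p = q by move=> _; exists q.
pose N' : pst (nat * C) nat := @relab d C (nat * C) nat (nat * C) (option nat) (addpt N v a k al rho) id (jx m) (rt N) (ctr N).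
have P' : ptb N' := @relab_ptb d C (nat * C) nat (nat * C) (option nat) (addpt N v a k al rho) id (jx m) (rt N) (ctr N) erefl jc ji js jXs P1.
have [W' _ _] := P'.
have S : sub N N'.
  by split=> //; exact: (emb_relab (jX := jx m) (r := rt N) (ctr N) js W1 W (old_addpt N v a k al rho)).
have [eS _] := S.
have vv : le N v v by exact: (w_refl W).
have DN' t x : nd N t -> D N t x -> D N' t x.
  by move=> nt dx; have dr := D_rt W dx; apply/(emb_D eS nt dr).
exists N', m; split=> //.
- split=> //; split=> //.
  + apply: (fin_add (m := m) fX) => x; have [->|n] := pselect (x = m); first by right.
    by move=> hx; left; move: hx; rewrite /D /= (jx_old n) /= addbe_old.
  + by move=> t nt; have [x dx] := inh t nt; exists x; exact: DN'.
  + move=> t s lts; have [nt ns] := w_nd W' lts.1.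
    have [b [x [y [z [fb hb]]]]] := ram t s ((sub_lt W S nt ns).1 lts).
    by exists b, x, y, z; split; [exact: (e_fr eS)|exact: (br3_emb W eS hb)].
- by move=> s; rewrite /= jx_new /= => -[].
- by rewrite /eqv /= jx_new (mr v) // (addbe_le _ _ _ _ vv).
- case: k hk {kfr kdeg} po P1 W1 jc jXs ji js @N' P' W' S eS DN' => [k0|] hk po P1 W1 jc jXs ji js N' P' W' S eS DN'.
    have [dk nk] := hk _ erefl.
    rewrite /eqv /= jx_new (mr _ _ da) (mr _ _ dk) (addbe_le _ _ _ _ vv) /=.
    split; last by case=> _ _ [] [].
    split=> //; right; rewrite /KK; split; last by split=> //; split=> // h; apply: nk.
    by case=> _ [_ h]; apply: h; apply: (pb_refr (w_preB W v)).
  move=> y dy; rewrite /= jx_new (mr _ _ da) (mr _ _ dy) (addbe_le _ _ _ _ vv) /= (po_alv po).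
  split; last by case=> _ [].
  by apply: (pb_eany (w_preB W v)).
Qed.

(** A leaf is hung at a and a node put over a with this leaf as centre, as in [star_place]. The
    labels k1 and k2 lie in two branches at a and the leaf gives a third, so that a ramifies as
    [la_ram] demands. *)
Lemma add_node_label N v a c k1 k2 : lab N -> be N v a k1 k2 -> ~ eqv N v a k1 -> ~ eqv N v a k2 ->
  (v = rt N -> eqv N v (ctr N) a) -> (v <> rt N -> (col N v < c)%O) ->
  (forall s, fr N v s a -> (c < col N s)%O) ->
  exists N' u, [/\ [/\ sub N N', lab N', ~ nd N u & forall t, nd N' t <-> nd N t \/ t = u],
    fr N' v u a, col N' u = c,
    [/\ D N' u k1, D N' u k2 & ~ eqv N' u k1 k2] &
    (forall t, nd N t -> (le N' t u <-> le N t v) /\ (le N' u t <-> fr N v t a))].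
Proof.
move=> LN hb n1 n2 hr cv cU.
have [ZP fP fX inh ram top cl] := LN; have [W d2 fs] := ZP.
have H := w_preB W v.
have nv := w_be W hb; have [da dk1 dk2] := pb_dom H hb.
have hr' : v = rt N -> None = None :> option nat /\ eqv N v (ctr N) a by move=> e; split=> //; exact: hr.
have [al [rho po]] := @position_ex _ _ _ _ N v a None W nv da (fun k0 => ltac:(discriminate)) hr'.
have pl := star_place ZP cv cU po.
have W1 := addpt_wptb W po.
have P2 := addnode_ptb W1 pl; have [W2 _ _] := P2.
have [m hm] := fresh_x LN.
have [p0 [np0 cp0]] := fresh_p c LN.
have mo x : D N (rt N) x -> jx m x = Some x by move=> dx; apply: jx_old => e; apply: hm; rewrite -e.
have mr t x : D N t x -> jx m x = Some x by move=> /(D_rt W) /mo.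
have po' t : nd N t -> jx p0 t = Some t by move=> nt; apply: jx_old => e; apply: np0; rewrite -e.
pose Z2 := addnode (addpt N v a None al rho) v (Some a) c (Some None).
have jc : jx m (ctr N) = ctr Z2 by apply: mo; exact: (w_ctr W).
have jr : jx p0 (rt N) = rt Z2 by apply: po'; exact: (w_ndrt W).
have jXs y : D Z2 (rt Z2) y -> exists x, jx m x = y.
  case: y => [y|] dy; last by exists m; rewrite jx_new.
  by exists y; apply: mo; move: dy; rewrite /D /= addbe_old.
have ji p q : nd Z2 (jx p0 p) -> jx p0 p = jx p0 q -> p = q by move=> _ /jx_inj.
have js q : nd Z2 q -> exists p, jx p0 p = q.
  case: q => [q|] nq; last by exists p0; rewrite jx_new.
  by exists q; exact: po'.
pose N' : pst (nat * C) nat := @relab d C (nat * C) nat (option (nat * C)) (option nat) Z2 (jx p0) (jx m) (rt N) (ctr N).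
have P' : ptb N' := @relab_ptb d C (nat * C) nat (option (nat * C)) (option nat) Z2 (jx p0) (jx m) (rt N) (ctr N) jr jc ji js jXs P2.
have [W' _ _] := P'.
have eZ : emb N Z2 Some Some.
  exact: (emb_compose W W1 (old_addpt N v a None al rho) (old_addnode W1 v (Some a) c (Some None))).
have S : sub N N' by split=> //; exact: (emb_relab (jX := jx m) (r := rt N) (ctr N) js W2 W eZ).
have [eS _] := S.
have vv : le N v v by exact: (w_refl W).
have DN' t x : nd N t -> D N t x -> D N' t x.
  by move=> nt dx; have dr := D_rt W dx; apply/(emb_D eS nt dr).
have ndE t : nd N' t <-> nd N t \/ t = p0.
  have [->|n] := pselect (t = p0); first by rewrite /= jx_new; split=> //; right.
  by rewrite /= (jx_old n) /=; split=> [|[]]; auto.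
have leE t : nd N t -> (le N' t p0 <-> le N t v) /\ (le N' p0 t <-> fr N v t a).
  by move=> nt; rewrite /= jx_new (po' _ nt).
have dN : D0 (addpt N v a None al rho) v (Some a) None by exact: (pl_x0 pl).
have D0k y : D N v y -> ~ eqv N v a y -> D0 (addpt N v a None al rho) v (Some a) (Some y).
  by move=> dy ny; split; rewrite /D /eqv /= !addbe_old.
have DU y : D N v y -> ~ eqv N v a y -> D N' p0 y.
  by move=> dy ny; rewrite /D /= jx_new (mr _ _ dy); apply/star_D; exact: D0k.
have fva : fr N' v p0 a.
  by rewrite /= jx_new (po' _ nv) (mr _ _ da) /=; left; split=> //; rewrite /eqv /= addbe_old.
have sbN y : D N v y -> ~ sb (addpt N v a None al rho) v (Some a) None (Some y).
  rewrite /sb /= (addbe_le _ _ _ _ vv) /= (po_alv po) => dy; apply; split; last by case=> _ [].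
  by apply: (pb_eany H).
have DUm : D N' p0 m by rewrite /D /= !jx_new; apply/star_D.
exists N', p0; split=> //.
- split=> //; split=> //.
  + by apply: (fin_add (m := p0) fP) => t /ndE.
  + apply: (fin_add (m := m) fX) => x; have [->|n] := pselect (x = m); first by right.
    by move=> hx; left; move: hx; rewrite /D /= jr (jx_old n) /= addbe_old.
  + move=> t /ndE [nt|->]; last by exists m.
    by have [x dx] := inh t nt; exists x; exact: DN'.
  + move=> t s lts; have [/ndE nt /ndE ns] := w_nd W' lts.1.
    case: nt => [nt|et]; case: ns => [ns|es].
    * have [b [x [y [z [fb hb']]]]] := ram t s ((sub_lt W S nt ns).1 lts).
      by exists b, x, y, z; split; [exact: (e_fr eS)|exact: (br3_emb W eS hb')].
    * subst s; have ltv := (leE t nt).1.1 lts.1.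
      have [e|n] := pselect (t = v).
        subst t; exists a, k1, k2, m; split=> //.
        have g y : D N v y -> be N' v a y m.
          move=> dy; apply: (pb_sym (w_preB W' v)).
          rewrite /= jx_new (po' _ nv) (mr _ _ da) (mr _ _ dy) /= (addbe_le _ _ _ _ vv) /= (po_alv po).
          by split; [exact: (pb_eany H)|case=> _ []].
        have dr y : D N v y -> D N (rt N) y by exact: (D_rt W).
        split; split; [by apply/(e_be eS nv (dr _ da) (dr _ dk1) (dr _ dk2))|exact: g|exact: g| | |].
        - by move/(emb_eqv eS nv (dr _ da) (dr _ dk1)).
        - by move/(emb_eqv eS nv (dr _ da) (dr _ dk2)).
        - by rewrite /eqv /= jx_new (po' _ nv) (mr _ _ da) /= (addbe_le _ _ _ _ vv).
      have [b [x [y [z [fb hb']]]]] := ram t v (conj ltv n).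
      exists b, x, y, z; split; last exact: (br3_emb W eS hb').
      by apply: (fr_up W' (e_fr eS fb)); case: (w_frlt W' fva).
    (* The older nodes over a are now carried by the centre m of the new star; the three branches
       that made a ramify are three leaves of this star. *)
    * subst t; have fsa := (leE s ns).2.1 lts.1.
      have [b [x [y [z [fb [[h1 h2 h3] [m1 m2 m3]]]]]]] := ram v s (w_frlt W fsa).
      have eb := w_freq W fb fsa.
      have [_ dx dy] := pb_dom H h1; have [_ _ dz] := pb_dom H h2.
      have nn w : ~ eqv N v b w -> ~ eqv N v a w by move=> n e; apply: n; exact: (eqv_trans W eb e).
      exists m, x, y, z; split.
        rewrite /= !jx_new (po' _ ns) /=; split=> //=.
        by apply: (sb_refl dN).
      have bb p q : D N v p -> D N v q -> ~ eqv N v b p -> ~ eqv N v b q -> be N v b p q ->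
          be N' p0 m p q.
        move=> dp dq np nq hpq; rewrite /= !jx_new (mr _ _ dp) (mr _ _ dq).
        split=> //; [exact: D0k (nn _ np)|exact: D0k (nn _ nq)|].
        right; right; split; first exact: (sb_refl dN).
        by apply; rewrite /= addbe_old; apply: (pb_congl H eb).
      have be' p : D N v p -> ~ eqv N' p0 m p.
        by move=> dp; rewrite /eqv /= !jx_new (mr _ _ dp) => /star_eqv [_ _ /(sbN _ dp)].
      by split; split; auto.
    * by subst s t; case: lts.
  + by case: top => t ht; have [i1 i2] := w_nd W ht.1; exists t; exact: (sub_lt W S i1 i2).2 ht.
  + move=> t /ndE [nt|->]; last by rewrite /= jx_new.
    by rewrite /= (po' _ nt) /=; exact: cl.
- by rewrite /= jx_new.
- split; [exact: DU|exact: DU|].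
  rewrite /eqv /= jx_new (mr _ _ dk1) (mr _ _ dk2) => /star_eqv [_ _]; apply.
  by rewrite /= addbe_old.
Qed.

End Labels.

(** * Ramification and the granting of requests *)

Section Steps.
Context {d : Order.disp_t} {C : orderType d}.
Implicit Type N : @pst d C (nat * C) nat.

(** The proper nodes that violate the ramification clause of [finite_tb]. *)
Definition single_cone N t := [/\ nd N t, t <> rt N, exists s, lt N t s &
  forall s1 s2, lt N t s1 -> lt N t s2 -> cone N t s1 s2].

Definition good N := lab N /\ forall t, ~ single_cone N t.

Lemma lab_wptb N : lab N -> wptb N.
Proof. by case=> [[]]. Qed.

Lemma sub_be N N' t x y z : wptb N -> sub N N' -> be N t x y z -> be N' t x y z.
Proof.
move=> W [e _] h; have H := w_preB W t; have [dx dy dz] := pb_dom H h.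
have nt := w_be W h.
by apply/(e_be e nt (D_rt W dx) (D_rt W dy) (D_rt W dz)).
Qed.

Lemma sub_eqv N N' t x y : wptb N -> sub N N' -> D N t x -> D N t y ->
  (eqv N' t x y <-> eqv N t x y).
Proof.
move=> W [e _] dx dy; have nt := w_be W dx.
exact: (emb_eqv e nt (D_rt W dx) (D_rt W dy)).
Qed.

Lemma sub_fr N N' t s x : sub N N' -> fr N t s x -> fr N' t s x.
Proof. by case=> e _; exact: (e_fr e). Qed.

Lemma sub_lt1 N N' s t : wptb N -> sub N N' -> lt N s t -> lt N' s t.
Proof. by move=> W S l; have [ns nt] := w_nd W l.1; apply/(sub_lt W S). Qed.

Lemma sub_rt N N' : sub N N' -> rt N' = rt N.
Proof. by case=> e _; rewrite -(e_rt e). Qed.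

Lemma sub_col N N' t : wptb N -> sub N N' -> nd N t -> t <> rt N -> col N' t = col N t.
Proof. by move=> W [e _]; exact: (e_col e). Qed.

(** A point m put between the point $f_v(s)$ and another point of B(v) makes room for a second cone:
    a node over m, with the colour of s. This node is maximal, so no new node with a single cone
    arises. *)
Lemma ramify_one N v : lab N -> single_cone N v ->
  exists N', [/\ sub N N', lab N' & forall t, single_cone N' t -> single_cone N t /\ t <> v].
Proof.
move=> LN [nv nr [s ls] one]; have W := lab_wptb LN.
have [a [x [y [z [fa [[b1 b2 b3] [n1 n2 n3]]]]]]] := la_ram LN ls.
have H := w_preB W v; have [da dx _] := pb_dom H b1.
have [N1 [m [[S1 L1] nd1 nf1 na [bm nm]]]] := @add_point_label _ _ N v a (Some x) LN nv da nr
  (fun k0 e => ltac:(by case: e => <-)) (fun e => ltac:(discriminate)) (fun e => ltac:(discriminate)).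
have W1 := lab_wptb L1.
have cv : (col N1 v < col N s)%O by rewrite (sub_col W S1) //; exact: (w_col W ls).
have nv1 : nd N1 v by apply/nd1.
have nr1 : v <> rt N1 by rewrite (sub_rt S1).
have [N2 [u [[S2 L2 nu nd2] fu cu _ leu]]] := @add_node_label _ _ N1 v m (col N s) a x L1 bm
  (fun e => na (eqv_sym W1 e)) (fun e => nm (eqv_sym W1 e)) (fun e => False_ind _ (nr1 e))
  (fun _ => cv) (fun s h => False_ind _ (nf1 _ h)).
have W2 := lab_wptb L2.
have S := sub_trans W W1 S1 S2.
exists N2; split=> // t [nt tr [q lq] onet].
have tv : t <> v.
  move=> e; subst t.
  have lvu := w_frlt W2 fu; have lvs := sub_lt1 W S ls.
  have c := onet _ _ lvu lvs.
  have fs : fr N2 v s m by apply/(w_frcone W2 fu lvs).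
  have fs' : fr N2 v s a := sub_fr S fa.
  apply: na; apply/(sub_eqv W1 S2 (pb_domy (w_preB W1 v) bm) (pb_domx (w_preB W1 v) bm)).
  exact: (w_freq W2 fs' fs).
split=> //.
have up p : nd N1 p -> ~ le N2 u p by move=> np /(leu p np).2 /nf1.
have ntu : t <> u.
  move=> e; subst t; have [_ nq] := w_nd W2 lq.1.
  case: ((nd2 q).1 nq) => [n'|e]; last by subst q; case: lq.
  by apply: (up q n'); case: lq.
have nt1 : nd N1 t by case: ((nd2 t).1 nt).
have ntN : nd N t by apply/nd1.
have ltE p : nd N p -> (lt N2 t p <-> lt N t p) by move=> np; exact: (sub_lt W S).
split=> //; first by rewrite -(sub_rt S).
  have [_ nq] := w_nd W2 lq.1; case: ((nd2 q).1 nq) => [/nd1 n'|e].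
    by exists q; apply/ltE.
  subst q; exists v; split; last exact: tv.
  have [e _] := S1; apply/(e_le e ntN nv); exact: ((leu t nt1).1.1 lq.1).
move=> s1 s2 l1 l2.
have [_ m1] := w_nd W l1.1; have [_ m2] := w_nd W l2.1.
have [p [lp p1 p2]] := onet s1 s2 ((ltE _ m1).2 l1) ((ltE _ m2).2 l2).
have [np _] := w_nd W2 p1.
case: ((nd2 p).1 np) => [/nd1 np'|e]; last first.
  by subst p; case: (up s1 _ p1); apply/nd1.
have [e _] := S; exists p; split; first exact/ltE.
- exact/(e_le e np' m1).
- exact/(e_le e np' m2).
Qed.

Lemma ramify_all N : lab N -> exists N', sub N N' /\ good N'.
Proof.
move=> LN; suff key Q : fin Q -> forall N, lab N -> (forall t, single_cone N t -> Q t) ->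
    exists N', sub N N' /\ good N'.
  apply: (key (single_cone N)) => //; apply: fin_sub (la_finP LN) => t [//].
move: Q; apply: fin_ind => Q IH {LN}N LN hQ.
have [[v bv]|nb] := pselect (exists v, single_cone N v); last first.
  by exists N; split; [exact: subl_refl|split=> // t bt; apply: nb; exists t].
have [N1 [S1 L1 hb]] := ramify_one LN bv.
have [|||N2 [S2 G2]] := IH (fun t => Q t /\ t <> v) _ _ N1 L1.
- by move=> t [].
- by exists v; split; [exact: hQ|case].
- by move=> t /hb [/hQ].
exists N2; split=> //; apply: sub_trans S1 S2; exact: lab_wptb.
Qed.

Definition node_request N N' s t c := lt N s t -> s = rt N \/ (col N s < c)%O -> (c < col N t)%O ->
  exists u, [/\ lt N' s u, lt N' u t & col N' u = c].

Definition top_request N N' v a k1 k2 c := v <> rt N -> be N v a k1 k2 -> ~ eqv N v a k1 ->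
  ~ eqv N v a k2 -> (col N v < c)%O ->
  exists u, [/\ fr N' v u a, col N' u = c, D N' u k1, D N' u k2 & ~ eqv N' u k1 k2].

Definition between_request N N' v x y := v <> rt N -> D N v x -> D N v y -> ~ eqv N v x y ->
  exists b, [/\ be N' v b x y, ~ eqv N' v b x & ~ eqv N' v b y].

Definition leaf_request N N' v a k := v <> rt N -> D N v a -> D N v k ->
  exists b, ~ eqv N' v a b /\ be N' v a b k.

(** The node goes directly above w, the highest node below t and from s on that is s or has colour
    less than c. All nodes over $f_w(t)$ then have colour greater than c, unless a node of colour c
    is already in the interval. *)
Lemma grant_node N s t c : lab N -> exists N', [/\ sub N N', lab N' & node_request N N' s t c].
Proof.
move=> LN; have W := lab_wptb LN; have [fP] := la_finP LN.
have [hp|hn] := pselect ([/\ lt N s t, s = rt N \/ (col N s < c)%O & (c < col N t)%O]); last first.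
  by exists N; split=> //; move=> *; case: hn.
have [l hs ht] := hp.
have [[u hu]|nu] := pselect (exists u, [/\ lt N s u, lt N u t & col N u = c]).
  by exists N; split=> //; exists u.
have [w [sw wt hw] wmax] : exists2 w, [/\ le N s w, lt N w t & w = s \/ (col N w < c)%O] &
    forall q, [/\ le N s q, lt N q t & q = s \/ (col N q < c)%O] -> ~ lt N w q.
  apply: (fin_min (R := fun p q => lt N q p)) (s) _.
  - by move=> x y z h [h' _]; exact: (le_ltT W h' h).
  - by move=> x [].
  - by apply: fin_sub (la_finP LN) => q [/(w_nd W) []].
  - by split=> //; [apply: (w_refl W); case: (w_nd W l.1)|left].
have [F [x [y [z [fF [[b1 b2 b3] [n1 n2 n3]]]]]]] := la_ram LN wt.
have cU s' : fr N w s' F -> (c < col N s')%O.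
  move=> f'; have [q [wq q1 q2]] := (w_frcone W fF (w_frlt W f')).1 f'.
  have cq : (c < col N q)%O.
    have [->//|n] := pselect (q = t); have lqt : lt N q t by [].
    have lsq : lt N s q := le_ltT W sw wq.
    case: (Order.TotalTheory.ltgtP c (col N q)) => // h.
      case: (wmax q) => //; split=> //; first by case: lsq.
      by right.
    by case: nu; exists q.
  have [<-//|n] := pselect (q = s').
  apply: (Order.POrderTheory.lt_trans cq); apply: (w_col W) => // e.
  by apply: (lt_irr W wq); rewrite e; apply: (w_rt W); case: (w_nd W wt.1).
have hF : w = rt N -> eqv N w (ctr N) F.
  by move=> e; apply: (w_freq W _ fF); rewrite e; apply: (w_frctr W); rewrite -e.
have cw : w <> rt N -> (col N w < c)%O by case: hw => [->|//]; case: hs.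
have [N' [u [[S L nu' ndu] fu cu _ leu]]] := add_node_label LN b1 n1 n2 hF cw cU.
exists N'; split=> // _ _ _; exists u.
have W' := lab_wptb L.
have lwu := w_frlt W' fu.
have nt : nd N t by case: (w_nd W wt.1).
have [e _] := S.
split=> //.
  have [<-//|n] := pselect (w = s).
  apply: (le_ltT W' _ lwu); have [ns nw] := w_nd W sw; exact/(e_le e ns nw).
split; first exact/(leu t nt).2.
by move=> e'; apply: nu'; rewrite e'.
Qed.

(** If nodes lie over a, the least of them is t1, and k1, k2 are distinct points of B(t1). A smaller
    colour than that of t1 is inserted below t1, and t1 itself answers an equal colour. For a
    greater one, a point is put between k1 and k2 in B(t1) and a node over that point. *)
Lemma grant_top N v a k1 k2 c : lab N -> exists N', [/\ sub N N', lab N' & top_request N N' v a k1 k2 c].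
Proof.
move=> LN; have W := lab_wptb LN; have ZP := la_ptb LN.
have [[nr hb n1 n2 cv]|hn] := pselect ([/\ v <> rt N, be N v a k1 k2, ~ eqv N v a k1,
    ~ eqv N v a k2 & (col N v < c)%O]); last first.
  by exists N; split=> //; move=> *; case: hn.
have H := w_preB W v; have [da dk1 dk2] := pb_dom H hb.
have direct : (forall s, fr N v s a -> (c < col N s)%O) ->
    exists N', [/\ sub N N', lab N' & top_request N N' v a k1 k2 c].
  move=> cU; have [N' [u [[S L nu' ndu] fu cu [d1 d2 d3] leu]]] := @add_node_label _ _ N v a c k1 k2 LN hb n1 n2
    (fun e => False_ind _ (nr e)) (fun _ => cv) cU.
  by exists N'; split=> // _ _ _ _ _; exists u.
have [[t ft]|nf] := pselect (exists t, fr N v t a); last first.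
  by apply: direct => s hs; case: nf; exists s.
have [t1 ft1 tmin'] : exists2 t1, fr N v t1 a & forall q, fr N v q a -> ~ lt N q t1.
  apply: (fin_min (R := lt N)) ft.
  - by move=> x y z h [h' _]; exact: (lt_leT W h h').
  - by move=> x [].
  - by apply: fin_sub (la_finP LN) => q /(fr_nd W) [].
have tmin s : fr N v s a -> le N t1 s.
  move=> fs; have [z [lz z1 z2]] := (w_frcone W ft1 (w_frlt W fs)).1 fs.
  have [e|n] := pselect (z = t1); first by rewrite -e.
  by case: (tmin' z (fr_down W ft1 lz z1)).
have D1 := child_D ZP ft1 tmin dk1 n1; have D2 := child_D ZP ft1 tmin dk2 n2.
have nE := child_eqv ZP ft1 tmin hb.
have lvt := w_frlt W ft1; have nt1 : nd N t1 := (w_nd W lvt.1).2.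
have nr1 : t1 <> rt N.
  by move=> e; apply: (lt_irr W lvt); rewrite e; apply: (w_rt W); case: (w_nd W lvt.1).
case: (Order.TotalTheory.ltgtP c (col N t1)) => hc.
- apply: direct => s /tmin hs; have [<-//|n] := pselect (t1 = s).
  by apply: (Order.POrderTheory.lt_trans hc); apply: (w_col W).
- have [N1 [m [[S1 L1] nd1 nf1 na [bm nm]]]] := @add_point_label _ _ N t1 k1 (Some k2) LN nt1 D1 nr1
    (fun k0 e => ltac:(by case: e => <-)) (fun e => ltac:(discriminate)) (fun e => ltac:(discriminate)).
  have W1 := lab_wptb L1.
  have cv1 : (col N1 t1 < c)%O by rewrite (sub_col W S1).
  have nr1' : t1 <> rt N1 by rewrite (sub_rt S1).
  have [N2 [u [[S2 L2 nu nd2] fu cu [d1 d2 d3] leu]]] := @add_node_label _ _ N1 t1 m c k1 k2 L1 bm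
    (fun e => na (eqv_sym W1 e)) (fun e => nm (eqv_sym W1 e)) (fun e => False_ind _ (nr1' e))
    (fun _ => cv1) (fun s h => False_ind _ (nf1 _ h)).
  have W2 := lab_wptb L2.
  exists N2; split=> //; first exact: (sub_trans W W1 S1 S2).
  move=> _ _ _ _ _; exists u; split=> //.
  apply: (fr_up W2 (sub_fr S2 (sub_fr S1 ft1))); by case: (w_frlt W2 fu).
- by exists N; split=> //; move=> _ _ _ _ _; exists t1.
Qed.

Lemma grant_between N v x y : lab N -> exists N', [/\ sub N N', lab N' & between_request N N' v x y].
Proof.
move=> LN; have W := lab_wptb LN.
have [[nr dx dy n]|hn] := pselect ([/\ v <> rt N, D N v x, D N v y & ~ eqv N v x y]); last first.
  by exists N; split=> //; move=> *; case: hn.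
have nv := w_be W dx.
have [N1 [m [[S1 L1] nd1 nf1 na [bm nm]]]] := @add_point_label _ _ N v x (Some y) LN nv dx nr
  (fun k0 e => ltac:(by case: e => <-)) (fun e => ltac:(discriminate)) (fun e => ltac:(discriminate)).
have W1 := lab_wptb L1.
exists N1; split=> // _ _ _ _; exists m; split=> //.
  by move/(eqv_sym W1).
by move/(eqv_sym W1).
Qed.

(** If the request is not yet met, all points other than a lie in one branch at a. So a does not
    ramify and carries no node, and a leaf hung at it violates no axiom. *)
Lemma grant_leaf N v a k : lab N -> exists N', [/\ sub N N', lab N' & leaf_request N N' v a k].
Proof.
move=> LN; have W := lab_wptb LN; have H := w_preB W v.
have [[nr da dk]|hn] := pselect ([/\ v <> rt N, D N v a & D N v k]); last first.
  by exists N; split=> //; move=> *; case: hn.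
have nv := w_be W da.
have [[b hb]|nb] := pselect (exists b, ~ eqv N v a b /\ be N v a b k).
  by exists N; split=> //; exists b.
have deg y z : D N v y -> D N v z -> ~ eqv N v a y -> ~ eqv N v a z -> ~ be N v a y z.
  move=> dy dz ny nz hb.
  have h1 : ~ be N v a y k by move=> h; apply: nb; exists y.
  have h2 : ~ be N v a z k by move=> h; apply: nb; exists z.
  by apply: (pb_brtrans H dk h1 _) hb; move=> /(pb_sym H).
have nfr t : ~ fr N v t a.
  move=> ft; have [b [x [y [z [fb [[b1 _ _] [n1 n2 _]]]]]]] := la_ram LN (w_frlt W ft).
  have e := w_freq W fb ft; have [_ dx dy] := pb_dom H b1.
  apply: (deg x y) => //.
  - by move=> e'; apply: n1; exact: (eqv_trans W e e').
  - by move=> e'; apply: n2; exact: (eqv_trans W e e').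
  - exact: (pb_congl H e).
have [N1 [m [[S1 L1] nd1 nf1 na bm]]] := @add_point_label _ _ N v a None LN nv da nr
  (fun k0 e => ltac:(discriminate)) (fun _ => nfr) (fun _ => deg).
exists N1; split=> // _ _ _; exists m; split=> //; exact: bm.
Qed.

(* The kind of request, two nodes, three labels and a colour. *)
Definition request_data : Type := (nat * ((nat * C) * (nat * C)) * (nat * nat * nat) * C)%type.

Definition granted N N' (q : request_data) : Prop :=
  let: (ty, (s, t), (a, k1, k2), c) := q in
  match ty with
  | 0 => node_request N N' s t c
  | 1 => top_request N N' s a k1 k2 c
  | 2 => between_request N N' s a k1
  | _ => leaf_request N N' s a k1
  end.

(** Nodes with a single cone are repaired after the request is granted; the witnesses survive,
    because [sub] preserves and reflects everything a request mentions. *)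
Lemma grant N q : good N -> exists N', [/\ sub N N', good N' & granted N N' q].
Proof.
case=> LN _; case: q => [[[ty [s t]] [[a k1] k2]] c].
have [N1 [S1 L1 h1]] : exists N', [/\ sub N N', lab N' & granted N N' (ty, (s, t), (a, k1, k2), c)].
  case: ty => [|[|[|ty]]]; [exact: grant_node|exact: grant_top|exact: grant_between|exact: grant_leaf].
have [N2 [S2 G2]] := ramify_all L1.
have W := lab_wptb LN; have W1 := lab_wptb L1; have [L2 _] := G2; have W2 := lab_wptb L2.
exists N2; split=> //; first exact: (sub_trans W W1 S1 S2).
have bb w x y z : be N1 w x y z -> be N2 w x y z by exact: sub_be.
have ee w x y : D N1 w x -> D N1 w y -> ~ eqv N1 w x y -> ~ eqv N2 w x y.
  by move=> dx dy n /(sub_eqv W1 S2 dx dy).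
have Sc u s' : lt N1 s' u -> col N2 u = col N1 u.
  move=> l; have [ns nu] := w_nd W1 l.1; apply: (sub_col W1 S2 nu) => e.
  by apply: (lt_irr W1 l); rewrite e; exact: (w_rt W1).
case: ty h1 => [|[|[|ty]]] /=.
- move=> h p1 p2 p3; have [u [u1 u2 u3]] := h p1 p2 p3; exists u.
  by split; [exact: (sub_lt1 W1)|exact: (sub_lt1 W1)|rewrite (Sc _ _ u1)].
- move=> h p1 p2 p3 p4 p5; have [u [u1 u2 u3 u4 u5]] := h p1 p2 p3 p4 p5; exists u.
  split; [exact: sub_fr u1|by rewrite (Sc _ _ (w_frlt W1 u1))|exact: bb|exact: bb|exact: ee].
- move=> h p1 p2 p3 p4; have [b [u1 u2 u3]] := h p1 p2 p3 p4; exists b.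
  have [db dx dy] := pb_dom (w_preB W1 s) u1.
  by split; [exact: bb|exact: ee|exact: ee].
- move=> h p1 p2 p3; have [b [u1 u2]] := h p1 p2 p3; exists b.
  have [da db _] := pb_dom (w_preB W1 s) u2.
  by split; [exact: ee|exact: bb].
Qed.

(** The root is a star with centre 0 and leaves 1, 2, 3, the least number that makes the centre
    ramify. The node over 0 has the points 1, 2, 3 with 1 between the other two, hence no
    ramification point. *)
Lemma initial_structure (c0 : C) : exists N, good N.
Proof.
pose r0 : nat * C := (0%N, c0); pose p0 : nat * C := (1%N, c0).
pose Dm (x : nat) := (x < 4)%N : Prop.
pose S := seed r0 0%N Dm (fun p : nat * C => p.2).
have D00 : Dm 0%N by [].
have WS : wptb S := seed_wptb r0 _ D00.
have E1 x y : eqv S r0 x y <-> x = y /\ Dm x := seed_eqv r0 0%N Dm _ x y.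
have sbE x y : D0 S r0 0%N x -> D0 S r0 0%N y -> (sb S r0 0%N x y <-> x = y).
  move=> [/seed_D dx nx] [/seed_D dy ny]; split=> [h|-> /E1 [e _]].
    apply: contrapT => n; apply: h; split=> //; split=> //; right; right; split=> //.
  by apply: ny; apply/E1; rewrite -e.
have D0E x : D0 S r0 0%N x <-> (0 < x < 4)%N.
  rewrite /D0; split=> [[/seed_D dx nx]|/andP[h1 h2]].
    by rewrite dx andbT lt0n; apply/eqP => e; apply: nx; apply/E1; rewrite e.
  split; first exact/seed_D.
  by move=> /E1 [e _]; rewrite -e in h1.
have ccE x : D0 S r0 0%N x -> (cc S r0 0%N (Some 1%N) x <-> x = 1%N).
  by move=> dx; rewrite /cc sbE //; [split=> ->|apply/D0E].
have pl : place S r0 0%N c0 (Some 1%N).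
  split=> //.
  - exact/E1.
  - by move=> _; exact/E1.
  - by move=> x [<-]; apply/D0E.
  - right=> x y z dx dy dz; rewrite (ccE _ dx) (ccE _ dy) (ccE _ dz) => n1 n2 n3.
    move: (dx) (dy) (dz) => /D0E hx /D0E hy /D0E hz.
    have [e|n] := pselect (x = y); first by constructor 1; apply/(sbE _ _ dx dy).
    have [e|n'] := pselect (x = z); first by constructor 2; apply/(sbE _ _ dx dz).
    constructor 3; apply/(sbE _ _ dy dz).
    by case: x y z hx hy hz n1 n2 n3 n n' {dx dy dz} => [|[|[|[|x]]]] // [|[|[|[|y]]]] // [|[|[|[|z]]]].
  - by move=> s t x l; case: (@seed_lt _ _ _ _ r0 0%N Dm (fun p : nat * C => p.2) s t l).
  - by move=> t b x y z hb; right; exact: (seed_br3 D00 hb).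
pose Z2 := addnode S r0 0%N c0 (Some 1%N).
have P2 : ptb Z2 := addnode_ptb WS pl; have [W2 _ _] := P2.
have rp : r0 <> p0 by [].
have jr : jx p0 r0 = rt Z2 by exact: jx_old.
have ji p q : nd Z2 (jx p0 p) -> jx p0 p = jx p0 q -> p = q by move=> _ /jx_inj.
have js q : nd Z2 q -> exists p, jx p0 p = q.
  by case: q => [q|] nq; [exists q; apply: jx_old; rewrite -nq|exists p0; rewrite jx_new].
have jXs y : D Z2 (rt Z2) y -> exists x : nat, id x = y by exists y.
pose N : pst (nat * C) nat := @relab d C (nat * C) nat (option (nat * C)) nat Z2 (jx p0) id r0 0%N.
have P' : ptb N := @relab_ptb d C (nat * C) nat (option (nat * C)) nat Z2 (jx p0) id r0 0%N jr erefl ji js jXs P2.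
have [W' _ _] := P'.
have ndE t : nd N t -> t = r0 \/ t = p0.
  have [->|n] := pselect (t = p0); first by right.
  by rewrite /= (jx_old n) /= => <-; left.
have lr : lt N r0 p0.
  by split=> //; rewrite /= jx_new /=.
have fr0 : fr N r0 p0 0%N.
  by rewrite /= jx_new; left; split=> //; exact/E1.
have ltE t s : lt N t s -> t = r0 /\ s = p0.
  move=> l; have [/ndE nt /ndE ns] := w_nd W' l.1.
  case: nt => [et|et]; case: ns => [es|es]; subst t s => //; try by case: l.
  by case: (lt_irr W' l); case: lr.
have beN x y z : be N r0 x y z <-> be S r0 x y z by [].

exists N; split; last first.
  move=> t [_ ntr [s /ltE [et _]] _]; exact: ntr.
split=> //.
- exists 2, (fun i => if i is 0 then Some r0 else Some p0) => t /ndE [->|->]; [by exists 0%N|by exists 1%N].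
- exists 4, (fun i => Some i) => x; rewrite /D beN => /seed_D dx; by exists x.
- move=> t /ndE [->|->].
    by exists 0%N; apply/beN; exact: (seed_D r0 0%N Dm (fun p : nat * C => p.2) 0%N).2.
  have d1 : D0 S r0 0%N 1%N by apply/D0E.
  by exists 1%N; rewrite /D /= jx_new; split=> //; left; apply/sbE.
- move=> t s /ltE [-> ->]; exists 0%N, 1%N, 2, 3; split=> //.
  have b3 x y : (0 < x < 4)%N -> (0 < y < 4)%N -> x <> y -> be N r0 0%N x y.
    move=> /D0E dx /D0E dy n; apply/beN; apply: contrapT => h; apply: n.
    exact/(sbE _ _ dx dy).
  split; split; try by apply: b3.
  + by rewrite /eqv beN => /E1 [].
  + by rewrite /eqv beN => /E1 [].
  + by rewrite /eqv beN => /E1 [].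
- by exists p0.
- by move=> t /ndE [->|->]; rewrite /= ?jx_new ?(jx_old rp).
Qed.

End Steps.

(** * The limit of a chain of stages *)

Section Limit.
Context {d : Order.disp_t} {C : orderType d}.

(** What is needed, besides the axioms, to read off a tree of $B$-sets: no $B$-set is empty and the
    values of f ramify. The virtual root is exempt from the latter since it is dropped in the
    tree. *)
Record proper_pst (P X : Type) (L : @pst d C P X) : Prop := {
  pr_ptb : ptb L;
  pr_inh : forall t, nd L t -> exists x, D L t x;
  pr_ram : forall t s a, fr L t s a -> t <> rt L -> exists x y z, br3 L t a x y z }.

Variables (N : nat -> @pst d C (nat * C) nat) (sched : nat -> request_data (C := C)).
Hypotheses (gN : forall i, good (N i)) (sN : forall i, sub (N i) (N i.+1)).
Hypothesis often : forall q m, exists2 i, (m <= i)%N & sched i = q.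
Hypothesis sat : forall i, granted (N i) (N i.+1) (sched i).

Let lN i : lab (N i). Proof. by case: (gN i). Qed.
Let W i : wptb (N i). Proof. exact: lab_wptb. Qed.

Lemma chain_sub i j : (i <= j)%N -> sub (N i) (N j).
Proof.
elim: j => [|j IH]; first by rewrite leqn0 => /eqP->; exact: subl_refl.
rewrite leq_eqVlt => /orP[/eqP->|/IH h]; first exact: subl_refl.
exact: (sub_trans (W i) (W j) h (sN j)).
Qed.

Definition limit : @pst d C (nat * C) nat :=
  Pst (fun t => exists i, nd (N i) t) (fun s t => exists i, le (N i) s t)
    (rt (N 0)) (ctr (N 0)) (fun t => t.2)
    (fun t x y z => exists i, be (N i) t x y z) (fun t s x => exists i, fr (N i) t s x).

Notation L := limit.

(** Each atomic fact of the limit holds from some stage on, so finitely many of them hold together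
    at one stage, where the axioms are applied. *)
Definition ev (P : nat -> Prop) := exists i, forall j, (i <= j)%N -> P j.

Lemma ev2 P Q : ev P -> ev Q -> ev (fun i => P i /\ Q i).
Proof.
move=> [i hi] [j hj]; exists (maxn i j) => k; rewrite geq_max => /andP[h1 h2].
by split; auto.
Qed.

Lemma ev_ex P : ev P -> exists i, P i. Proof. by case=> i h; exists i; exact: h. Qed.

Lemma ev_nd t : nd L t -> ev (fun i => nd (N i) t).
Proof. by case=> i h; exists i => j /chain_sub [e _]; exact: (e_nd e h). Qed.

Lemma ev_le s t : le L s t -> ev (fun i => le (N i) s t).
Proof.
case=> i h; exists i => j /chain_sub [e _]; have [ns nt] := w_nd (W i) h.
exact/(e_le e ns nt).
Qed.

Lemma ev_be t x y z : be L t x y z -> ev (fun i => be (N i) t x y z).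
Proof. by case=> i h; exists i => j /chain_sub S; exact: (sub_be (W i) S h). Qed.

Lemma ev_fr t s x : fr L t s x -> ev (fun i => fr (N i) t s x).
Proof. by case=> i h; exists i => j /chain_sub S; exact: (sub_fr S h). Qed.

Lemma ev_lt s t : lt L s t -> ev (fun i => lt (N i) s t).
Proof. by case=> /ev_le [i h] n; exists i => j /h. Qed.

Lemma rtN i : rt (N i) = rt L. Proof. exact: (sub_rt (chain_sub (leq0n i))). Qed.
Lemma ctrN i : ctr (N i) = ctr L. Proof. by case: (chain_sub (leq0n i)). Qed.

Lemma colN i t : nd (N i) t -> col L t = col (N i) t.
Proof. by move=> nt; rewrite (la_col (lN i) nt). Qed.

Lemma stage_limit i : emb (N i) L id id.
Proof.
have LE j s t : nd (N j) s -> nd (N j) t -> (le L s t <-> le (N j) s t).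
  move=> ns nt; split=> [/ev_le [k h]|h]; last by exists j.
  have [e _] := chain_sub (leq_maxl j k).
  by apply/(e_le e ns nt); apply: h; exact: leq_maxr.
split=> //.
- by move=> t nt; exists i.
- exact: rtN.
- by move=> t nt _; rewrite (colN nt).
- by move=> s t; exact: LE.
- move=> m s t g; have [g1 g2 g3] := g.
  split; [by exists i|by exists i|move=> w h1 h2].
  have [k hk] := ev2 (ev_le h1) (ev_le h2).
  have [e _] := chain_sub (leq_maxl i k).
  have [h1' h2'] := hk _ (leq_maxr i k).
  by exists (maxn i k); case: (e_glb e g) => _ _; apply.
- move=> t x y z nt dx dy dz; split=> [/ev_be [k h]|h]; last by exists i.
  have [e _] := chain_sub (leq_maxl i k).
  by apply/(e_be e nt dx dy dz); apply: h; exact: leq_maxr.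
- by move=> t s x h; exists i.
Qed.

Lemma limit_be i t x y z : nd (N i) t -> D (N i) (rt L) x -> D (N i) (rt L) y ->
  D (N i) (rt L) z -> (be L t x y z <-> be (N i) t x y z).
Proof. by rewrite -(rtN i); exact: (e_be (stage_limit i)). Qed.

Lemma limit_Drt i t x : D (N i) t x -> D (N i) (rt L) x.
Proof. by rewrite -(rtN i); exact: (D_rt (W i)). Qed.

Lemma limit_wptb : wptb L.
Proof.
split.
- by move=> s t [i /(w_nd (W i)) [h1 h2]]; split; exists i.
- by move=> t [i h]; exists i; exact: (w_refl (W i)).
- move=> s t u /ev_le h1 /ev_le h2; have [i [a b]] := ev_ex (ev2 h1 h2).
  by exists i; exact: (w_trans (W i) a b).
- move=> s t /ev_le h1 /ev_le h2; have [i [a b]] := ev_ex (ev2 h1 h2).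
  exact: (w_anti (W i) a b).
- move=> x y z /ev_le h1 /ev_le h2; have [i [a b]] := ev_ex (ev2 h1 h2).
  by case: (w_tree (W i) a b) => h; [left|right]; exists i.
- move=> s t /ev_nd h1 /ev_nd h2; have [i [a b]] := ev_ex (ev2 h1 h2).
  by have [m g] := w_glb (W i) a b; exists m; exact: (e_glb (stage_limit i) g).
- by move=> t [i h]; exists i; rewrite -(rtN i); exact: (w_rt (W i)).
- by exists 0%N; exact: (w_ndrt (W 0)).
- move=> s t /ev_lt h1 /ev_lt h2; have [i [a b]] := ev_ex (ev2 h1 h2).
  rewrite -(rtN i) in a b; have [z [[z1 z1'] z2 z3]] := w_cone (W i) a b.
  by exists z; split; [split; [exists i|]; rewrite -?(rtN i)|exists i|exists i].
- move=> s t /ev_lt /ev_ex [i h] n; have [ns nt] := w_nd (W i) h.1.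
  by rewrite (colN ns) (colN nt); apply: (w_col (W i) h); rewrite rtN.
- by move=> t x y z [i h]; exists i; exact: (w_be (W i) h).
- move=> t; have H i := w_preB (W i) t; split.
  + by move=> x y z [i /(pb_dom (H i)) [*]]; split; exists i.
  + move=> x y /ev_be h1 /ev_be h2; have [i [a b]] := ev_ex (ev2 h1 h2).
    by exists i; exact: (pb_refl (H i)).
  + by move=> x y z [i h]; exists i; exact: (pb_sym (H i) h).
  + move=> x y z /ev_be h1 /ev_be h2; have [i [a b]] := ev_ex (ev2 h1 h2).
    by exists i; exact: (pb_eq (H i) a b).
  + move=> x y z w /ev_be h1 /ev_be h2; have [i [a b]] := ev_ex (ev2 h1 h2).
    by case: (pb_split (H i) a b) => h; [left|right]; exists i.
  + move=> x y z w /ev_be h1 /ev_be h2; have [i [a b]] := ev_ex (ev2 h1 h2).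
    by exists i; exact: (pb_congl (H i) a b).
  + move=> x y z w /ev_be h1 /ev_be h2; have [i [a b]] := ev_ex (ev2 h1 h2).
    by exists i; exact: (pb_congr (H i) a b).
  + move=> x y z /ev_be h1 /ev_be h2 /ev_be h3 n1 n2 n3.
    have [i [a [b c]]] := ev_ex (ev2 h1 (ev2 h2 h3)).
    have [u [u1 u2 u3]] : exists u, [/\ be (N i) t u x y, be (N i) t u x z & be (N i) t u y z].
      by apply: (pb_pos (H i)) => // h; [apply: n1|apply: n2|apply: n3]; exists i.
    by exists u; split; exists i.
- by exists 0%N; exact: (w_ctr (W 0)).
- have dc i : D (N i) (rt L) (ctr L) by rewrite -(ctrN i) -(rtN i); exact: (w_ctr (W i)).
  have nr i : nd (N i) (rt L) by rewrite -(rtN i); exact: (w_ndrt (W i)).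
  have ws i x y z := w_star (W i) x y z.
  move=> x y z; split.
    case=> i h; have := h; rewrite -{1}(rtN i) (ws i) ctrN rtN => -[dx dy dz hh].
    split; [by exists i|by exists i|by exists i|].
    case: hh => [hh|[hh|[h1 h2]]]; [by left; exists i|by right; left; exists i|].
    right; right; split; first by exists i.
    by move=> h3; apply: h2; apply/limit_be.
  case=> /ev_be h1 /ev_be h2 /ev_be h3 hh; have [i [dx [dy dz]]] := ev_ex (ev2 h1 (ev2 h2 h3)).
  exists i; rewrite -{1}(rtN i) (ws i) ctrN rtN; split=> //.
  case: hh => [/limit_be h|[/limit_be h|[/limit_be h n]]]; [by left; apply: h|by right; left; apply: h|].
  by right; right; split; [apply: h|move=> h'; apply: n; exists i].
- move=> s t x /ev_le h1 /ev_be h2; have [i [a b]] := ev_ex (ev2 h1 h2).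
  by exists i; exact: (w_mono (W i) a b).
- move=> s t x y /ev_le h1 /ev_be h2 /ev_be h3; have [i [a [b c]]] := ev_ex (ev2 h1 (ev2 h2 h3)).
  by exists i; exact: (w_monoe (W i) a b c).
- move=> s /ev_lt /ev_ex [i h]; exists i; rewrite -(rtN i) -(ctrN i).
  by apply: (w_frctr (W i)); rewrite rtN.
- by move=> t s x [i /(w_frlt (W i)) [h n]]; split=> //; exists i.
- by move=> t s x [i /(w_frD (W i)) h]; exists i.
- by move=> t s /ev_lt /ev_ex [i /(w_frex (W i)) [x h]]; exists x, i.
- move=> t s x y /ev_fr h1 /ev_fr h2; have [i [a b]] := ev_ex (ev2 h1 h2).
  by exists i; exact: (w_freq (W i) a b).
- move=> t s x y /ev_fr h1 /ev_be h2; have [i [a b]] := ev_ex (ev2 h1 h2).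
  by exists i; exact: (w_frcong (W i) a b).
- move=> t s1 s2 x /ev_fr h1 /ev_lt h2; split.
    move=> /ev_fr h3; have [i [a [b c]]] := ev_ex (ev2 h1 (ev2 h2 h3)).
    have [z [[z1 z1'] z2 z3]] := (w_frcone (W i) a b).1 c.
    by exists z; split; [split=> //; exists i|exists i|exists i].
  case=> z [/ev_lt z1 /ev_le z2 /ev_le z3].
  have [i [a [b [c1 [c2 c3]]]]] := ev_ex (ev2 h1 (ev2 h2 (ev2 z1 (ev2 z2 z3)))).
  by exists i; apply/(w_frcone (W i) a b); exists z.
- move=> u t x /ev_fr h1 /ev_be h2; have [i [a b]] := ev_ex (ev2 h1 h2).
  exact: (w_dom1 (W i) a b).
- move=> u t p x y /ev_fr h1 /ev_be h2 /ev_be h3 n; have [i [a [b c]]] := ev_ex (ev2 h1 (ev2 h2 h3)).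
  by exists i; apply: (w_eq1 (W i) a b c) => h; apply: n; exists i.
- move=> s t x y /ev_lt h1 /ev_be h2; have [i [l e]] := ev_ex (ev2 h1 h2).
  have [u [a [u1 u2 u3]]] := w_eq2 (W i) l e.
  exists u, a; split; [by exists i|by exists i|move=> h; apply: u3].
  have [dx dy] := eqvD (W i) e; have [nu _] := fr_nd (W i) u2.
  apply/limit_be => //; [exact: limit_Drt (w_frD (W i) u2)|exact: limit_Drt dx|exact: limit_Drt dy].
Qed.

Lemma limit_ptb : ptb L.
Proof.
split; first exact: limit_wptb.
- move=> s t x /ev_lt h1 /ev_be h2 n; have [i [a b]] := ev_ex (ev2 h1 h2).
  have [_ d2 _] := la_ptb (lN i).
  have [|u u1 u2] := d2 s t x a b; first by move=> h; apply: n; exists i.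
  by exists u; exists i.
- move=> t a x y z [[/ev_be h1 /ev_be h2 /ev_be h3] [n1 n2 n3]].
  have [i [a1 [a2 a3]]] := ev_ex (ev2 h1 (ev2 h2 h3)).
  have [_ _ fs] := la_ptb (lN i).
  have [|s h] := fs t a x y z; last by exists s, i.
  by split; split=> // h; [apply: n1|apply: n2|apply: n3]; exists i.
Qed.

Lemma limit_proper : proper_pst L.
Proof.
split; first exact: limit_ptb.
- by move=> t [i nt]; have [x hx] := la_inh (lN i) nt; exists x, i.
- move=> t s a [i h] n; have [a' [x [y [z [h' [[b1 b2 b3] [n1 n2 n3]]]]]]] := la_ram (lN i) (w_frlt (W i) h).
  have e := w_freq (W i) h' h; have H := w_preB (W i) t.
  have ne w : ~ eqv (N i) t a' w -> ~ eqv (N i) t a w.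
    by move=> n' e'; apply: n'; exact: (eqv_trans (W i) e e').
  exists x, y, z; apply: (br3_emb (W i) (stage_limit i)).
  by split; split; try exact: (pb_congl H e); exact: ne.
Qed.

Definition request ty s t a k1 k2 c : request_data (C := C) := (ty, (s, t), (a, k1, k2), c).

Lemma limit_nrt v i : v <> rt L -> v <> rt (N i). Proof. by rewrite rtN. Qed.

(** Each instance is a request whose hypotheses hold from some stage on; the schedule returns to it
    after that stage. *)
Lemma limit_rich : rich L.
Proof.
have nE i t x y : ~ eqv L t x y -> ~ eqv (N i) t x y by move=> n h; apply: n; exists i.
have nE' i t x y : D (N i) t x -> D (N i) t y -> ~ eqv (N i) t x y -> ~ eqv L t x y.
  move=> dx dy n h; apply: n.
  by apply/limit_be => //; [exact: (w_be (W i) dx)|exact: limit_Drt dx|exact: limit_Drt dy|exact: limit_Drt dy].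
split.
- move=> s t c /ev_lt [m hm] hs ht; have [i /hm l e] := often (request 0 s t 0 0 0 c) m.
  have [ns nt] := w_nd (W i) l.1.
  have := sat i; rewrite e /= => /(_ l); rewrite rtN -!(colN ns) -(colN nt).
  case=> // u [[u1 n1] [u2 n2] u3]; exists u; split; [by split=> //; exists i.+1|by split=> //; exists i.+1|].
  by rewrite -u3; exact: (colN (w_nd (W i.+1) u1).2).
- move=> v a k1 k2 c nr /ev_be [m hm] n1 n2 hc.
  have [i /hm hb e] := often (request 1 v v a k1 k2 c) m.
  have := sat i; rewrite e /= => /(_ (limit_nrt nr) hb (nE _ _ _ _ n1) (nE _ _ _ _ n2)).
  rewrite -(colN (w_be (W i) hb)) => /(_ hc) [u [u1 u2 u3 u4 u5]].
  exists u; split; [by exists i.+1| |by exists i.+1|by exists i.+1|exact: (nE' i.+1)].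
  by rewrite -u2; exact: (colN (fr_nd (W i.+1) u1).2).
- move=> v x y nr /ev_be h1 /ev_be h2 n.
  have [m hm] := ev2 h1 h2; have [i /hm [dx dy] e] := often (request 2 v v x y 0 (rt L).2) m.
  have := sat i; rewrite e /= => /(_ (limit_nrt nr) dx dy (nE _ _ _ _ n)) [b [b1 b2 b3]].
  have [db dx' dy'] := pb_dom (w_preB (W i.+1) v) b1.
  exists b; split; [by exists i.+1|exact: nE' b2|exact: nE' b3].
- move=> v a k nr /ev_be h1 /ev_be h2.
  have [m hm] := ev2 h1 h2; have [i /hm [dx dy] e] := often (request 3 v v a k 0 (rt L).2) m.
  have := sat i; rewrite e /= => /(_ (limit_nrt nr) dx dy) [b [b1 b2]].
  have [da db _] := pb_dom (w_preB (W i.+1) v) b2.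
  by exists b; split; [exact: nE' b1|exists i.+1].
Qed.

Lemma limit_top : exists t, lt L (rt L) t.
Proof.
by have [t [h n]] := la_top (lN 0); exists t; split=> //; exists 0%N.
Qed.

End Limit.

Section Chain.
Context {d : Order.disp_t} {C : orderType d}.

(** Index i is devoted to the item whose code is the exponent of 2 in i; the indices
    $2^{f(q)}(2m+1)$ make q recur beyond every bound. *)
Lemma schedule (Q : Type) (q0 : Q) (f : Q -> nat) : injective f ->
  exists s : nat -> Q, forall q m, exists2 i, (m <= i)%N & s i = q.
Proof.
move=> fi; have /choice [g hg] : forall n, exists q, forall q', f q' = n -> q = q'.
  move=> n; have [[q hq]|n'] := pselect (exists q, f q = n); last by exists q0 => q' h; case: n'; exists q'.
  by exists q => q' h; apply: fi; rewrite hq.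
exists (fun i => g (logn 2 i)) => q m; exists (2 ^ f q * m.*2.+1)%N.
  apply: (@leq_trans m.*2.+1); first by rewrite -addnn leqW // leq_addr.
  by rewrite leq_pmull // expn_gt0.
rewrite lognM ?expn_gt0 // pfactorK // [logn 2 m.*2.+1]lognE /= dvdn2 /= odd_double addn0.
exact: hg.
Qed.

Lemma chain_ex (c0 : C) (sched : nat -> request_data (C := C)) : exists N,
  forall i, [/\ good (N i), sub (N i) (N i.+1) & granted (N i) (N i.+1) (sched i)].
Proof.
have [N0 g0] := initial_structure c0.
pose T := {N : @pst d C (nat * C) nat | good N}.
have nx (i : nat) (N : T) : exists N' : T, sub (sval N) (sval N') /\ granted (sval N) (sval N') (sched i).
  by have [N' [h1 h2 h3]] := grant (sched i) (svalP N); exists (exist _ N' h2).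
pose F := fix F i : T := if i is i.+1 then projT1 (cid (nx i (F i))) else exist _ N0 g0.
exists (fun i => sval (F i)) => i; split; first exact: svalP.
- by case: (projT2 (cid (nx i (F i)))).
- by case: (projT2 (cid (nx i (F i)))).
Qed.

End Chain.

(** * From trees of B-sets to labelled structures and back *)

Import Order.TTheory.
Local Open Scope order_scope.

Lemma Bset_refl (X : Bset) (x y : X) : Brel x x y.
Proof. by have [_ /(_ erefl) []] := @Brel_eq X x x y. Qed.

Lemma Bset_eq (X : Bset) (x y : X) : Brel x y y -> x = y.
Proof.
by move=> h; apply/(@Brel_eq X x y y); split=> //; apply: Brel_sym; exact: Bset_refl.
Qed.

Lemma Bset_sb_trans (X : Bset) (a x y z : X) : ~ Brel a x y -> ~ Brel a y z -> ~ Brel a x z.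
Proof. by move=> h1 h2 /Brel_split-/(_ y) []. Qed.

Lemma ramificationP (X : Bset) (a : X) : ramification_point a <->
  exists x y z, [/\ Brel a x y, Brel a x z & Brel a y z] /\ [/\ a <> x, a <> y & a <> z].
Proof.
have nb w : a <> w -> ~ Brel a w w by move=> n /Bset_eq.
split.
- case=> K1 [K2 [K3 [[[x xa ->] [y ya ->] [z za ->]] [n1 n2 n3]]]].
  have key u w : u <> a -> w <> a ->
      [set v | same_branch a u v]%classic <> [set v | same_branch a w v]%classic -> Brel a u w.
    move=> ua wa n; apply: contrapT => h; apply: n; apply/seteqP; split=> v [_ va h'] /=;
      split=> //; apply: Bset_sb_trans h'; [by move/Brel_sym|by []].
  by exists x, y, z; split; split; auto.
- case=> x [y [z [[h1 h2 h3] [n1 n2 n3]]]].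
  exists [set v | same_branch a x v]%classic, [set v | same_branch a y v]%classic,
    [set v | same_branch a z v]%classic; split; split.
  + by exists x => // e; apply: n1.
  + by exists y => // e; apply: n2.
  + by exists z => // e; apply: n3.
  + move=> e; have : [set v | same_branch a y v]%classic y by split; auto.
    by rewrite -e => -[].
  + move=> e; have : [set v | same_branch a z v]%classic z by split; auto.
    by rewrite -e => -[].
  + move=> e; have : [set v | same_branch a z v]%classic z by split; auto.
    by rewrite -e => -[].
Qed.

Definition pull (X : Type) (Y : Bset) (g : X -> option Y) (x y z : X) : Prop :=
  exists x' y' z', [/\ g x = Some x', g y = Some y', g z = Some z' & Brel x' y' z'].

Section Pull.
Variables (X : Type) (Y : Bset) (g : X -> option Y).

Lemma pullE x y z x' y' z' : g x = Some x' -> g y = Some y' -> g z = Some z' ->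
  (pull g x y z <-> Brel x' y' z').
Proof.
move=> ex ey ez; split=> [[x1 [y1 [z1 []]]]|h]; last by exists x', y', z'.
by rewrite ex ey ez => -[->] [->] [->].
Qed.

Lemma pullD x : pull g x x x <-> exists x', g x = Some x'.
Proof.
split=> [[x' [_ [_ [h _ _ _]]]]|[x' h]]; first by exists x'.
by exists x', x', x'; split=> //; exact: Bset_refl.
Qed.

Lemma pull_eqv x y : pull g x y y <-> exists x', g x = Some x' /\ g y = Some x'.
Proof.
split=> [[x' [y' [z' [h1 h2 h3 h]]]]|[x' [h1 h2]]].
  have e : y' = z' by congruence.
  by subst z'; have e := Bset_eq h; subst y'; exists x'.
by exists x', x', x'; split=> //; exact: Bset_refl.
Qed.

Lemma pull_preB : positive_type Y -> (forall y, exists x, g x = Some y) -> preB (pull g).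
Proof.
move=> pos surj; split.
- by move=> x y z [x' [y' [z' [h1 h2 h3 _]]]]; split; apply/pullD; [exists x'|exists y'|exists z'].
- move=> x y /pullD [x' hx] /pullD [y' hy]; exists x', x', y'; split=> //; exact: Bset_refl.
- by move=> x y z [x' [y' [z' [h1 h2 h3 h]]]]; exists x', z', y'; split=> //; exact: Brel_sym.
- move=> x y z [x' [y' [z' [h1 h2 h3 h]]]] /(pullE h2 h1 h3) h'.
  apply/pull_eqv; exists x'; split=> //; rewrite h2; congr Some.
  by apply/esym/(@Brel_eq Y x' y' z').
- move=> x y z w [x' [y' [z' [h1 h2 h3 h]]]] /pullD [w' hw].
  by case: (Brel_split w' h) => h'; [left; exists x', y', w'|right; exists x', w', z'].
- move=> x y z w /pull_eqv [x' [h1 h2]] [x1 [z1 [w1 []]]].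
  by rewrite h1 => -[<-] hz hw h; exists x', z1, w1.
- move=> x y z w /pull_eqv [x' [h1 h2]] [z1 [x1 [w1 []]]] hz.
  by rewrite h1 => -[<-] hw h; exists z1, x', w1.
- move=> x y z /pullD [x' hx] /pullD [y' hy] /pullD [z' hz].
  rewrite (pullE hx hy hz) (pullE hy hx hz) (pullE hz hx hy) => n1 n2 n3.
  have [u' [u1 u2 u3]] := pos _ _ _ n1 n2 n3; have [u hu] := surj u'.
  by exists u; split; [exists u', x', y'|exists u', x', z'|exists u', y', z'].
Qed.

End Pull.

(** * A tree with a root as a labelled structure *)

Section Tbp.
Context {d : Order.disp_t} {C : orderType d}.
Variables (E : tree_of_Bsets C) (r : node E).
Hypothesis hr : forall t, r <= t.

Definition G (t : node E) (o : option (tbB r)) : option (tbB t) := obind (tbg r t) o.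

Definition tple (s t : option (node E)) : Prop :=
  match s, t with
  | None, _ => True
  | Some s, Some t => s <= t
  | Some _, None => False
  end.

Definition tpbe (t : option (node E)) : option (tbB r) -> option (tbB r) -> option (tbB r) -> Prop :=
  if t is Some t then pull (G t) else starb (fun _ => True) eq (eq None).

Definition tpfr (t s : option (node E)) (x : option (tbB r)) : Prop :=
  match t, s with
  | Some t, Some s => t < s /\ G t x = Some (tbf t s)
  | None, Some s => x = None
  | _, None => False
  end.

(** The labels are the points of B(r) at the actual root r, together with [None], the centre of the
    virtual root below r, whose star has the points of B(r) as leaves. A node t carries its $B$-set
    pulled back along $g_{rt}$. *)
Definition tbp : @pst d C (option (node E)) (option (tbB r)) :=
  Pst (fun _ => True) tple None None
    (fun t => if t is Some t then colour E t else colour E r) tpbe tpfr.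

Lemma Gsurj t (y : tbB t) : exists x, G t (Some x) = Some y.
Proof.
have := hr t; rewrite le_eqVlt => /orP[/eqP e|h].
  by subst t; exists y => /=; rewrite tbg_id.
by have [x hx] := tbg_surj y h; exists x.
Qed.

Lemma Gcomp s t x : s <= t -> G t x = obind (tbg s t) (G s x).
Proof. by move=> st; case: x => [x|] //=; exact: tbg_comp. Qed.

Lemma tpD t x : pull (G t) x x x <-> G t x <> None.
Proof. by rewrite pullD; split=> [[x' ->]//|]; case: (G t x) => [y|] // _; exists y. Qed.

Lemma tpeqvN x y : starb (fun _ => True) eq (eq (None : option (tbB r))) x y y <-> x = y.
Proof.
split=> [[_ _ _ [//|[//|[_ []//]]]]|->].
by split=> //; left.
Qed.

Lemma tplt s t : lt tbp (Some s) (Some t) <-> s < t.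
Proof.
rewrite /lt /= lt_neqAle; split=> [[-> n]|/andP[/eqP n ->]].
  by rewrite andbT; apply/eqP => e; apply: n; rewrite e.
by split=> // -[].
Qed.

Lemma tpcone t s1 s2 : cone tbp (Some t) (Some s1) (Some s2) <-> same_cone t s1 s2.
Proof.
split=> [[[z|] [/= h1 h2 h3]]|[z [h1 h2 h3]]]; last by exists (Some z); split=> //; apply/tplt.
  by exists z; split=> //; apply/tplt.
by case: h1.
Qed.

Lemma tbp_ptb : ptb tbp.
Proof.
have rN t : G t None = None by [].
split.
- split=> /=.
  + by [].
  + by move=> [t|] _ /=.
  + by move=> [s|] [t|] [u|] //=; exact: le_trans.
  + by move=> [s|] [t|] //= h1 h2; congr Some; apply/eqP; rewrite eq_le h1.
  + move=> [x|] [y|] [z|] //=; try by auto.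
    move=> h1 h2; have := (node_semilinear E).1 x y z h1 h2.
    by rewrite /Order.comparable => /orP.
  + move=> [s|] [t|] _ _; try by exists None.
    exists (Some (Order.meet s t)); split=> /=; [exact: leIl|exact: leIr|].
    by move=> [w|] //=; rewrite lexI => -> ->.
  + by [].
  + by [].
  + move=> [s|] [t|] [_ n1] [_ n2] //; exists (Some r); split=> //=.
  + move=> [s|] [t|] //=; last by case.
    by move=> /tplt /colourP.
  + by [].
  + move=> [t|] /=; last first.
      apply: star_preB => //; try by move=> *; congruence.
      by left; exists None.
    apply: pull_preB; first exact: tbB_positive.
    by move=> y; have [x hx] := Gsurj y; exists (Some x).
  + by apply/tpeqvN.
  + move=> x y z; rewrite /D /eqv /=; split=> -[_ _ _ h].
      split; try by apply/tpeqvN.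
      by rewrite !tpeqvN.
    by move: h; rewrite !tpeqvN.
  + move=> [s|] [t|] x //=; rewrite /D /= ?tpeqvN //.
    by move=> st; rewrite !tpD (Gcomp _ st); case: (G s x).
  + move=> [s|] [t|] x y //=; rewrite /D /eqv /= ?tpeqvN //.
      move=> st; rewrite tpD !pull_eqv (Gcomp _ st) => -[x' [h1 h2]]; rewrite h1 /=.
      case E1 : (tbg s t x') => [x1|] // _; exists x1; split=> //.
      by rewrite (Gcomp _ st) h2.
    by move=> _ ->.
  + by move=> [s|] // [].
  + move=> [t|] [s|] x //= [h1 h2]; exact/tplt.
  + move=> [t|] [s|] x //=; last by move=> ->; apply/tpeqvN.
    by move=> [h1 h2]; apply/tpD; rewrite h2.
  + move=> [t|] [s|] //.
    * by move=> /tplt h; have [x hx] := Gsurj (tbf t s); exists (Some x).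
    * by case.
    * by move=> _; exists None.
    * by case.
  + move=> [t|] [s|] x y //=.
      by move=> [h1 h2] [_ h3]; apply/pull_eqv; exists (tbf t s).
    by move=> -> ->; apply/tpeqvN.
  + move=> [t|] [s|] x y //=.
      by move=> [h1 h2] /pull_eqv [x' []]; rewrite h2 => -[<-].
    by move=> -> /tpeqvN.
  + move=> [t|] [s1|] [s2|] x //=.
    * move=> [h1 h2] /tplt h3; rewrite tpcone -(tbf_eq h1 h3) h2; split=> [[_ [//]]|->//].
    * by move=> _ [].
    * move=> -> h3; split=> // _; exists (Some r); split=> //=; exact: hr.
    * by move=> _ [].
  + move=> [u|] [t|] x //=; last by move=> ->; move/tpD.
    move=> [h1 h2] /tpD; rewrite (Gcomp _ (ltW h1)) h2 /=; apply.
    by apply/(tbg_dom _ h1); exists u; rewrite tbg_id.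
  + move=> [u|] [t|] a x y //=; last first.
      move=> -> /tpD dx /tpD dy n; have -> : x = y.
        apply: contrapT => xy; apply: n; split=> //; right; right; split=> //.
      by apply/pullD; case E1 : (G t y) dy => [y'|] // _; exists y'.
    move=> [h1 h2] /tpD dx /tpD dy n; rewrite /eqv /=; apply/pull_eqv.
    move: dx dy; rewrite !(Gcomp _ (ltW h1)).
    case Ex : (G u x) => [x'|] //=; case Ey : (G u y) => [y'|] //=.
    case Ex' : (tbg u t x') => [x1|] // _; case Ey' : (tbg u t y') => [y1|] // _.
    exists x1; split=> //; congr Some; apply/esym/(tbg_eq h1 Ex' Ey').
    have nf w w1 : tbg u t w = Some w1 -> w <> tbf u t.
      move=> e ew; have : tbg u t w = None.
        by apply/(tbg_dom _ h1); exists u; rewrite tbg_id ew.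
      by rewrite e.
    exists u, x', y'; rewrite !tbg_id; split=> //; split=> //; [exact: nf Ex'|exact: nf Ey'|].
    by move=> hb; apply: n; exists (tbf u t), x', y'.
  + move=> [s|] [t|] x y //=; try by case.
      move=> /tplt st /pull_eqv [x1 []]; rewrite !(Gcomp _ (ltW st)).
      case Ex : (G s x) => [x'|] //= h1; case Ey : (G s y) => [y'|] //= h2.
      have [+ _] := tbg_eq st h1 h2; move=> /(_ erefl) [u [xu [yu [[su ut] h3 h4 [h5 h6 h7]]]]].
      have [a ha] := Gsurj (tbf u t).
      exists (Some u), (Some a); split=> //=.
      by rewrite (pullE (x' := tbf u t) (y' := xu) (z' := yu)) // (Gcomp _ su) ?Ex ?Ey.
    move=> _ /pull_eqv [x1 []]; case: x => [x|] // + ; case: y => [y|] //= h1 h2.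
    have := hr t; rewrite le_eqVlt => /orP[/eqP e|rt'].
      subst t; move: h1 h2; rewrite !tbg_id => -[->] [->]; exists None, None.
      by split=> // -[_ _ _ [//|[//|[_]]]].
    have [+ _] := tbg_eq rt' h1 h2; move=> /(_ erefl) [u [xu [yu [[su ut] h3 h4 [h5 h6 h7]]]]].
    have [a ha] := Gsurj (tbf u t).
    exists (Some u), (Some a); split=> //=.
    by rewrite (pullE (x' := tbf u t) (y' := xu) (z' := yu)).
- move=> [s|] [t|] x; try by case.
    move=> /tplt st; rewrite /D /= !tpD (Gcomp _ (ltW st)).
    case Ex : (G s x) => [x'|] //= _ /contrapT /(tbg_dom _ st) [u [su ut h]].
    by exists (Some u) => //; split=> //; rewrite (Gcomp _ su) Ex.
  move=> _ _; rewrite /D /= tpD => /contrapT; case: x => [x|] /= h; last by exists None.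
  have := hr t; rewrite le_eqVlt => /orP[/eqP e|rt'].
    by subst t; rewrite tbg_id in h.
  by move: h => /(tbg_dom _ rt') [u [su ut h]]; exists (Some u).
- move=> [t|] a x y z; rewrite /br3 /eqv /=.
    case=> -[[a' [x' [y' [ea ex ey h1]]]] h2 h3] [n1 n2 n3].
    have [a2 [x2 [z' [ea2 ex2 ez h2']]]] := h2.
    move: ea2 ex2; rewrite ea ex => -[ea2] [ex2]; subst a2 x2.
    have /(pullE ea ey ez) h3' := h3.
    have nn w w' : G t w = Some w' -> ~ pull (G t) a w w -> a' <> w'.
      by move=> ew n e; apply: n; apply/pull_eqv; exists w'; rewrite ew -e ea.
    have ra : ramification_point a'.
      apply/ramificationP; exists x', y', z'; split=> //; split.
      + exact: nn ex n1.
      + exact: nn ey n2.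
      + exact: nn ez n3.
    by have [s ts fs] := tbf_surj ra; exists (Some s); split=> //; rewrite fs.
  case=> -[[_ _ _ h1] _ _] []; rewrite !tpeqvN => n1 n2 n3.
  by exists (Some r); case: h1 => [//|[//|[]]].
Qed.

End Tbp.

(** * Reading a tree of $B$-sets off a labelled structure *)

Section Conv.
Context {d : Order.disp_t} {C : orderType d}.

Record ctree (P : choiceType) := Ctree { cL :> @pst d C P nat; c_proper : proper_pst cL }.

Section Fixed.
Variables (P : choiceType) (L : ctree P).

Definition cnode : Type := {t : P | `[< nd L t /\ t <> rt L >]}.
HB.instance Definition _ := Choice.on cnode.

Let W : wptb L. Proof. by case: (pr_ptb (c_proper L)). Qed.
Let d2 : dom2 L. Proof. by case: (pr_ptb (c_proper L)). Qed.
Let fs : frs L. Proof. by case: (pr_ptb (c_proper L)). Qed.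

Lemma cnd (t : cnode) : nd L (val t).
Proof. by have /asboolP [] := valP t. Qed.

Lemma cnrt (t : cnode) : val t <> rt L.
Proof. by have /asboolP [] := valP t. Qed.

Definition mkn (t : P) (h : nd L t /\ t <> rt L) : cnode :=
  exist (fun t => `[< nd L t /\ t <> rt L >]) t (asboolT h).

Definition cle (s t : cnode) : bool := `[< le L (val s) (val t) >].

Lemma cle_refl : reflexive cle.
Proof. by move=> t; apply/asboolP/(w_refl W)/cnd. Qed.

Lemma cle_anti : antisymmetric cle.
Proof.
by move=> s t /andP[/asboolP h1 /asboolP h2]; apply/val_inj/(w_anti W).
Qed.

Lemma cle_trans : transitive cle.
Proof. by move=> s t u /asboolP h1 /asboolP h2; apply/asboolP/(w_trans W h1). Qed.

Fact cnode_display : Order.disp_t. Proof. exact: Order.Disp tt tt. Qed.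

HB.instance Definition _ :=
  Order.Le_isPOrder.Build cnode_display cnode cle_refl cle_anti cle_trans.

Lemma cleP (s t : cnode) : s <= t <-> le L (val s) (val t).
Proof. by split=> [/asboolP|h]; [|apply/asboolP]. Qed.

(** Two proper nodes lie in one cone of the virtual root, so their greatest lower bound is
    proper. *)
Lemma cmeet_ex (s t : cnode) : exists m : cnode, isglb L (val m) (val s) (val t).
Proof.
have [m g] := w_glb W (cnd s) (cnd t); have [g1 g2 g3] := g.
have lr (u : cnode) : lt L (rt L) (val u).
  by split; [apply: (w_rt W); exact: cnd|move=> e; apply: (@cnrt u)].
have [z [lz zs zt]] := w_cone W (lr s) (lr t).
have hm : nd L m /\ m <> rt L.
  split; first by case: (w_nd W g1).
  by move=> e; subst m; apply: (lt_irr W lz); exact: g3.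
by exists (mkn hm).
Qed.

Definition cmeet (s t : cnode) : cnode := projT1 (cid (cmeet_ex s t)).

Lemma cmeetP (s t : cnode) : isglb L (val (cmeet s t)) (val s) (val t).
Proof. exact: projT2 (cid (cmeet_ex s t)). Qed.

Lemma clexI (x y z : cnode) : (x <= cmeet y z) = (x <= y) && (x <= z).
Proof.
have [g1 g2 g3] := cmeetP y z; apply/idP/andP.
  by move/cleP => h; split; apply/cleP; apply: (w_trans W h).
by case=> /cleP h1 /cleP h2; apply/cleP; exact: g3.
Qed.

HB.instance Definition _ :=
  Order.POrder_isMeetSemilattice.Build cnode_display cnode clexI.

Lemma cltP (s t : cnode) : s < t <-> lt L (val s) (val t).
Proof.
rewrite lt_neqAle; split=> [/andP[/eqP n /cleP h]|[h n]].
  by split=> // /val_inj.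
by apply/andP; split; [apply/eqP => e; apply: n; rewrite e|apply/cleP].
Qed.

Lemma cconeP (t s1 s2 : cnode) : same_cone t s1 s2 <-> cone L (val t) (val s1) (val s2).
Proof.
split=> [[z [/cltP h1 /cleP h2 /cleP h3]]|[z [h1 h2 h3]]]; first by exists (val z).
have hz : nd L z /\ z <> rt L.
  split; first by case: (w_nd W h2).
  by move=> e; subst z; apply: (lt_irr W h1); apply: (w_rt W); exact: cnd.
by exists (mkn hz); split; [apply/cltP|apply/cleP|apply/cleP].
Qed.

(** One label is chosen in each class, so that B(t) is a set of natural numbers rather than a
    quotient. The default 0 is not met on labels with a value at t. *)
Definition rep (t : P) (x : nat) : nat := xget 0%N [set y | eqv L t x y]%classic.

Lemma rep_eqv t x : D L t x -> eqv L t x (rep t x).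
Proof. by move=> dx; apply: (@xgetPex _ 0%N [set y | eqv L t x y]%classic); exists x. Qed.

Lemma rep_eq t x y : eqv L t x y -> rep t x = rep t y.
Proof.
move=> e; rewrite /rep; congr xget; apply/seteqP; split=> z /=; apply: (eqv_trans W) => //.
exact: (eqv_sym W).
Qed.

Definition cB (t : P) : Type := {x : nat | `[< D L t x /\ rep t x = x >]}.

(* x is a label of the point y *)
Definition isc (t : P) (x : nat) (y : cB t) : Prop := eqv L t x (val y).

Lemma cB_D t (y : cB t) : D L t (val y). Proof. by have /asboolP [] := valP y. Qed.

Lemma isc_val t (y : cB t) : isc (val y) y. Proof. exact: cB_D. Qed.

Lemma isc_D t x (y : cB t) : isc x y -> D L t x.
Proof. by case/(eqvD W). Qed.

Lemma isc_ex t x : D L t x -> exists y : cB t, isc x y.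
Proof.
move=> dx; have e := rep_eqv dx.
have h : D L t (rep t x) /\ rep t (rep t x) = rep t x.
  by split; [case: (eqvD W e)|rewrite -(rep_eq e)].
by exists (exist _ (rep t x) (asboolT h)).
Qed.

Lemma isc_eq t x x' (y y' : cB t) : isc x y -> isc x' y' -> (y = y' <-> eqv L t x x').
Proof.
move=> h h'; split=> [e|e].
  by subst y'; apply: (eqv_trans W h); exact: (eqv_sym W).
apply: val_inj; have /asboolP [_ <-] := valP y; have /asboolP [_ <-] := valP y'.
by apply: rep_eq; apply: (eqv_trans W (eqv_sym W h)); apply: (eqv_trans W e).
Qed.

Lemma isc_fun t x (y y' : cB t) : isc x y -> isc x y' -> y = y'.
Proof. by move=> h h'; apply/(isc_eq h h'); exact: isc_D h. Qed.

Definition cbe (t : P) (x y z : cB t) : Prop := be L t (val x) (val y) (val z).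

Lemma cbeP t x y z (x' y' z' : cB t) : isc x x' -> isc y y' -> isc z z' ->
  (cbe x' y' z' <-> be L t x y z).
Proof. by move=> h1 h2 h3; symmetry; apply: (pb_congE (w_preB W t)). Qed.

Section OnNode.
Variable t : P.
Hypothesis nt : nd L t.

Lemma cB_inh : inhabited (cB t).
Proof.
have [x dx] := pr_inh (c_proper L) nt; have [y _] := isc_ex dx; exact: inhabits y.
Qed.

Lemma cbe_eq (x y z : cB t) : cbe x y z /\ cbe y x z <-> x = y.
Proof.
have H := w_preB W t; rewrite /cbe; split=> [[h1 h2]|->].
  by apply/(isc_eq (isc_val x) (isc_val y)); exact: (pb_eq H h1 h2).
by split; apply: (pb_refl H); exact: cB_D.
Qed.

Lemma cbe_split (x y z w : cB t) : cbe x y z -> cbe x y w \/ cbe x w z.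
Proof. by move=> h; apply: (pb_split (w_preB W t) h); exact: cB_D. Qed.

Definition cBset : Bset := MkBset cB_inh (fun x y z => @pb_sym _ _ (w_preB W t) _ _ _)
  cbe_eq cbe_split.

Lemma cBset_pos : positive_type cBset.
Proof.
move=> x y z n1 n2 n3.
have [u [u1 u2 u3]] := pb_pos (w_preB W t) (cB_D x) (cB_D y) (cB_D z) n1 n2 n3.
have [u' hu] := isc_ex (pb_domx (w_preB W t) u1).
by exists u'; split; apply/(cbeP hu (isc_val _) (isc_val _)).
Qed.

Lemma cBset_ram x (a : cBset) : isc x a ->
  (ramification_point a <-> exists y1 y2 y3, br3 L t x y1 y2 y3).
Proof.
move=> ha; rewrite ramificationP; split=> [[y1 [y2 [y3 [[h1 h2 h3] [n1 n2 n3]]]]]|].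
  exists (val y1), (val y2), (val y3); split; split.
  - exact/(cbeP ha (isc_val y1) (isc_val y2)).
  - exact/(cbeP ha (isc_val y1) (isc_val y3)).
  - exact/(cbeP ha (isc_val y2) (isc_val y3)).
  - by move=> e; apply: n1; apply/(isc_eq ha (isc_val y1)).
  - by move=> e; apply: n2; apply/(isc_eq ha (isc_val y2)).
  - by move=> e; apply: n3; apply/(isc_eq ha (isc_val y3)).
case=> y1 [y2 [y3 [[h1 h2 h3] [n1 n2 n3]]]].
have H := w_preB W t.
have [z1 hz1] := isc_ex (pb_domy H h1); have [z2 hz2] := isc_ex (pb_domz H h1).
have [z3 hz3] := isc_ex (pb_domz H h2).
exists z1, z2, z3; split; split.
- exact/(cbeP ha hz1 hz2).
- exact/(cbeP ha hz1 hz3).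
- exact/(cbeP ha hz2 hz3).
- by move/(isc_eq ha hz1).
- by move/(isc_eq ha hz2).
- by move/(isc_eq ha hz3).
Qed.

End OnNode.

Definition cBn (t : cnode) : Bset := cBset (cnd t).

Lemma cf_ex (t s : cnode) : exists y : cBn t, t < s -> forall x, isc x y <-> fr L (val t) (val s) x.
Proof.
have [/cltP l|n] := pselect (t < s); last by have [y] := cB_inh (cnd t); exists y.
have [x hx] := w_frex W l; have [y hy] := isc_ex (w_frD W hx).
exists y => _ x'; split=> [h|h].
  by apply: (w_frcong W hx); exact/(isc_eq hy h).
by have [y' hy'] := isc_ex (w_frD W h); have -> : y = y' by apply/(isc_eq hy hy'); exact: (w_freq W hx h).
Qed.

Definition cf (t s : cnode) : cBn t := projT1 (cid (cf_ex t s)).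

Lemma cfP (t s : cnode) x : t < s -> (isc x (cf t s) <-> fr L (val t) (val s) x).
Proof. by move=> l; apply: (projT2 (cid (cf_ex t s))). Qed.

Definition cg (s t : cnode) (x : cBn s) : option (cBn t) :=
  if pselect (D L (val t) (val x)) is left h then Some (projT1 (cid (isc_ex h))) else None.

Lemma cg_some (s t : cnode) x (x' : cBn s) (y : cBn t) : s <= t -> isc x x' ->
  (cg t x' = Some y <-> isc x y).
Proof.
move=> /cleP st hx; rewrite /cg; case: pselect => [h|h].
  case: (cid _) => y' /= hy'.
  have e : eqv L (val t) x (val x') .
    by apply: (w_monoe W st hx); apply/(eqvDE W st hx).
  have hy2 : isc x y' by exact: (eqv_trans W e hy').
  by split=> [[<-]//|hy]; congr Some; exact: isc_fun hy2 hy.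
by split=> // hy; case: h; apply/(eqvDE W st hx); exact: isc_D hy.
Qed.

Lemma cg_none (s t : cnode) x (x' : cBn s) : s <= t -> isc x x' ->
  (cg t x' = None <-> ~ D L (val t) x).
Proof.
move=> /cleP st hx; rewrite /cg (eqvDE W st hx).
by case: pselect => [h|h]; split.
Qed.

Lemma conv_semilinear : semilinear cnode.
Proof.
split=> [x y z /cleP h1 /cleP h2|x y].
  by apply/orP; case: (w_tree W h1 h2) => h; [left|right]; apply/cleP.
by exists (Order.meet x y); split; [exact: leIl|exact: leIr].
Qed.

Lemma conv_colour : colouring (fun t : cnode => col L (val t)).
Proof. by move=> s t /cltP h; apply: (w_col W) => //; exact: cnrt. Qed.

Lemma conv_fram (t s : cnode) : t < s -> ramification_point (cf t s).
Proof.
move=> l; have /cltP l' := l; have [x hx] := w_frex W l'.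
apply/(cBset_ram (x := x)); first exact/cfP.
by apply: (pr_ram (c_proper L) hx); exact: cnrt.
Qed.

Lemma conv_fsurj (t : cnode) (a : cBn t) : ramification_point a ->
  exists2 s, t < s & cf t s = a.
Proof.
move=> /(cBset_ram (isc_val a)) [y1 [y2 [y3 h]]]; have [s hs] := fs h.
have l := w_frlt W hs.
have hn : nd L s /\ s <> rt L.
  split; first by case: (w_nd W l.1).
  by move=> e; subst s; apply: (lt_irr W l); apply: (w_rt W); exact: cnd.
exists (mkn hn); first exact/cltP.
have lt' : t < mkn hn by exact/cltP.
by apply: (isc_fun (x := val a)); [exact/cfP|exact: isc_val].
Qed.

Lemma conv_feq (t s1 s2 : cnode) : t < s1 -> t < s2 ->
  (cf t s1 = cf t s2 <-> same_cone t s1 s2).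
Proof.
move=> l1 l2; have /cltP l1' := l1; have /cltP l2' := l2.
have [x hx] := w_frex W l1'; rewrite cconeP -(w_frcone W hx l2').
have h1 : isc x (cf t s1) by exact/cfP.
split=> [e|h]; first by apply/(cfP _ l2); rewrite -e.
by apply: (isc_fun h1); exact/cfP.
Qed.

Lemma conv_gid (s : cnode) (x : cBn s) : cg s x = Some x.
Proof. by apply/(cg_some _ (lexx s) (isc_val x)); exact: isc_val. Qed.

Lemma ndrt (u : P) (s : cnode) : le L (val s) u -> nd L u /\ u <> rt L.
Proof.
move=> h; split; first by case: (w_nd W h).
move=> e; subst u; apply: (@cnrt s); apply: (w_anti W h); apply: (w_rt W); exact: cnd.
Qed.

Lemma conv_gdom (s t : cnode) (x : cBn s) : s < t ->
  (cg t x = None <-> exists u, [/\ s <= u, u < t & cg u x = Some (cf u t)]).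
Proof.
move=> l; have /cltP l' := l; have hx := isc_val x.
rewrite (cg_none (ltW l) hx); split=> [h|[u [/[dup] su /cleP su' ut h]]].
  have [u su fu] := d2 l' (cB_D x) h.
  have ut : lt L u (val t) := w_frlt W fu.
  exists (mkn (ndrt su)); split; [exact/cleP|exact/cltP|].
  apply/(cg_some _ _ hx); first exact/cleP.
  by apply/cfP => //; exact/cltP.
apply: (w_dom1 W (u := val u)); apply/(cfP _ ut).
exact/(cg_some _ su hx).
Qed.

Lemma conv_gsurj (s t : cnode) (a : cBn t) : s < t -> exists x : cBn s, cg t x = Some a.
Proof.
move=> l; have /cltP l' := l.
have [x hx] := isc_ex (w_mono W l'.1 (cB_D a)).
by exists x; apply/(cg_some _ (ltW l) hx); exact: isc_val.
Qed.

Lemma conv_geq (s t : cnode) (x y : cBn s) (a b : cBn t) : s < t ->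
  cg t x = Some a -> cg t y = Some b ->
  (a = b <-> exists u (x' y' : cBn u),
     [/\ s <= u /\ u < t, cg u x = Some x', cg u y = Some y' &
         same_branch (cf u t) x' y']).
Proof.
move=> l; have /cltP l' := l; have hx := isc_val x; have hy := isc_val y.
move=> /(cg_some _ (ltW l) hx) ha /(cg_some _ (ltW l) hy) hb.
rewrite (isc_eq ha hb); split=> [e|[u [x' [y' [[su ut] h1 h2 [n1 n2 n3]]]]]].
  have [u [p [su fu nb]]] := w_eq2 W l' e.
  have ut : lt L u (val t) := w_frlt W fu.
  pose u' := mkn (ndrt su); have su' : s <= u' by exact/cleP.
  have ut' : u' < t by exact/cltP.
  have dx : D L (val u') (val x) by exact: (w_mono W ut.1 (isc_D ha)).
  have dy : D L (val u') (val y) by exact: (w_mono W ut.1 (isc_D hb)).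
  have [x' hx'] := isc_ex dx; have [y' hy'] := isc_ex dy.
  have hf : isc p (cf u' t) by exact/cfP.
  have nf w (w' : cBn u') : isc w w' -> D L (val t) w -> w' <> cf u' t.
    by move=> hw dw e'; apply: (w_dom1 W (u := val u')) dw; apply/(cfP _ ut'); rewrite -e'.
  exists u', x', y'; split; [by []|exact/(cg_some _ su' hx)|exact/(cg_some _ su' hy)|split].
  - exact: nf hx' (isc_D ha).
  - exact: nf hy' (isc_D hb).
  - by move=> hb'; apply: nb; exact/(cbeP hf hx' hy').
have hf := isc_val (cf u t).
move: h1 h2 => /(cg_some _ su hx) hx' /(cg_some _ su hy) hy'.
apply: (w_eq1 W (u := val u) (a := val (cf u t))); [exact/cfP|exact: isc_D ha|exact: isc_D hb|].
by move=> hb'; apply: n3; exact/(cbeP hf hx' hy').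
Qed.

Lemma conv_gcomp (s t u : cnode) (x : cBn s) : s <= t -> t <= u ->
  cg u x = obind (@cg t u) (cg t x).
Proof.
move=> st tu; have hx := isc_val x; have su := le_trans st tu.
case E1 : (cg t x) => [y|] /=.
  move: E1 => /(cg_some _ st hx) hy.
  case E2 : (cg u y) => [z|].
    by apply/(cg_some _ su hx); exact/(cg_some _ tu hy).
  by apply/(cg_none su hx); exact/(cg_none tu hy).
move: E1 => /(cg_none st hx) n; apply/(cg_none su hx) => h; apply: n.
have /cleP tu' := tu; exact: (w_mono W tu' h).
Qed.

Definition conv : tree_of_Bsets C :=
  MkTreeOfBsets conv_semilinear conv_colour (fun t => @cBset_pos (val t) (cnd t))
    conv_fram conv_fsurj conv_feq conv_gid conv_gdom conv_gsurj conv_geq conv_gcomp.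

End Fixed.
End Conv.

(** * Strong embeddings in terms of labels *)

Section Transfer.
Context {d : Order.disp_t} {C : orderType d}.

Section Tau.
Variables (A1 A2 : tree_of_Bsets C) (i : strong_embedding A1 A2).

Lemma tau_lt s t : s < t -> tau i s < tau i t.
Proof. by case: (tauP i) => _ + _; apply. Qed.

Lemma tau_meet s t : tau i (Order.meet s t) = Order.meet (tau i s) (tau i t).
Proof. by case: (tauP i). Qed.

(** The order is reflected because meets are preserved: if the image of s is below that of t, then s
    and its meet with t have the same image, and strict monotonicity makes them equal. *)
Lemma tau_le s t : (tau i s <= tau i t) = (s <= t).
Proof.
apply/idP/idP => [h|]; last by rewrite le_eqVlt => /orP[/eqP->//|/tau_lt/ltW].
have e : tau i (Order.meet s t) = tau i s by rewrite tau_meet; exact/meet_idPl.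
have := leIl s t; rewrite le_eqVlt => /orP[/eqP <-|/tau_lt]; first exact: leIr.
by rewrite e ltxx.
Qed.

Lemma tau_inj : injective (tau i).
Proof. by move=> s t e; apply: le_anti; rewrite -!tau_le e lexx. Qed.

Lemma tau_ltE s t : (tau i s < tau i t) = (s < t).
Proof. by rewrite !lt_neqAle tau_le (inj_eq tau_inj). Qed.

Lemma tau_col t : colour A2 (tau i t) = colour A1 t.
Proof. by case: (tauP i). Qed.

Lemma phi_inj t : injective (phi i t). Proof. by case: (phiP i t). Qed.

Lemma phi_B t x y z : Brel (phi i t x) (phi i t y) (phi i t z) <-> Brel x y z.
Proof. by case: (phiP i t). Qed.

End Tau.

Lemma tp_glb (E : tree_of_Bsets C) (r : node E) m s t :
  isglb (tbp r) (Some m) (Some s) (Some t) <-> m = Order.meet s t.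
Proof.
split=> [[h1 h2 h3]|->].
  have := h3 (Some (Order.meet s t)) (leIl s t) (leIr t s) => /= h4.
  by apply: le_anti; rewrite h4 lexI; move: h1 h2 => /= -> ->.
by split=> /=; [exact: leIl|exact: leIr|move=> [w|] //=; rewrite lexI => -> ->].
Qed.

Section Conv.
Variables (P : choiceType) (L : ctree (C := C) P).

Let W : wptb L. Proof. by case: (pr_ptb (c_proper L)). Qed.

Lemma conv_glb (m s t : node (conv L)) : isglb L (val m) (val s) (val t) -> m = Order.meet s t.
Proof.
by move=> g; apply: val_inj; apply: (glb_uniq W g); exact: cmeetP.
Qed.

Section From.
Variables (E : tree_of_Bsets C) (r : node E) (hr : forall t, r <= t).
Variables (f : option (node E) -> P) (h : option (tbB r) -> nat).
Hypothesis e : emb (tbp r) L f h.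

Let WE : wptb (tbp r). Proof. by case: (tbp_ptb hr). Qed.

Let rtD x : D (tbp r) (rt (tbp r)) x. Proof. exact/tpeqvN. Qed.

Lemma from_rt t : nd L (f (Some t)) /\ f (Some t) <> rt L.
Proof.
split; first exact: (e_nd e).
move=> et; have := e_le e (s := Some t) (t := None) I I.
rewrite et -(e_rt e) /= => -[h1 _]; apply: h1; rewrite (e_rt e); apply: (w_refl W).
exact: (w_ndrt W).
Qed.

Definition from_tau (t : node E) : node (conv L) := mkn (from_rt t).

Lemma from_le s t : from_tau s <= from_tau t <-> s <= t.
Proof. by rewrite cleP /=; exact: (e_le e (s := Some s) (t := Some t)). Qed.

Lemma from_lt s t : s < t -> from_tau s < from_tau t.
Proof.
by move=> st; apply/cltP; apply: (emb_lt WE W e); exact/tplt.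
Qed.

Lemma from_phi_ex t (y : tbB t) : exists p : tbB (from_tau t),
  forall x, G t x = Some y -> isc (h x) p.
Proof.
have [x hx] := Gsurj hr y.
have [|p hp] := @isc_ex _ _ _ L (f (Some t)) (h (Some x)).
  by apply/(emb_D e) => //; apply/tpD; rewrite hx.
exists p => x' hx'; apply: (eqv_trans W _ hp).
by apply/(emb_eqv e) => //; apply/pull_eqv; exists y.
Qed.

Definition from_phi t (y : tbB t) : tbB (from_tau t) := projT1 (cid (from_phi_ex y)).

Lemma from_phiP t (y : tbB t) x : G t x = Some y -> isc (h x) (from_phi y).
Proof. exact: (projT2 (cid (from_phi_ex y))). Qed.

Lemma from_B t (x y z : tbB t) :
  Brel (from_phi x) (from_phi y) (from_phi z) <-> Brel x y z.
Proof.
have [x' hx] := Gsurj hr x; have [y' hy] := Gsurj hr y; have [z' hz] := Gsurj hr z.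
rewrite -(pullE hx hy hz).
apply: (iff_trans (cbeP (from_phiP hx) (from_phiP hy) (from_phiP hz))).
exact: (e_be e (t := Some t)).
Qed.

Lemma from_tauP : tree_embedding (colour E) (colour (conv L)) from_tau.
Proof.
split=> [t|s t|s t]; last 1 first.
- apply: conv_glb; exact: (e_glb e (m := Some _) (s := Some _) (t := Some _) ((tp_glb _ _ _ _).2 erefl)).
- exact: (e_col e (t := Some t)).
- exact: from_lt.
Qed.

Lemma from_phi_inj t : strong_Bset_embedding (@from_phi t).
Proof.
split; last exact: from_B.
by move=> x y exy; apply: Bset_eq; apply/from_B; rewrite exy; exact: Bset_refl.
Qed.

Lemma from_f t s : t < s -> from_phi (tbf t s) = tbf (from_tau t) (from_tau s).
Proof.
move=> ts; have [x hx] := Gsurj hr (tbf t s).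
apply: (isc_fun (from_phiP hx)); apply/(cfP _ (from_lt ts)).
by apply: (e_fr e (t := Some t) (s := Some s)).
Qed.

Lemma from_g s t (x : tbB s) : s <= t ->
  tbg (from_tau s) (from_tau t) (from_phi x) = omap (@from_phi t) (tbg s t x).
Proof.
move=> st; have st' : from_tau s <= from_tau t by exact/from_le.
have [w hw] := Gsurj hr x.
have hg := Gcomp hr (Some w) st; rewrite hw /= in hg.
case E1 : (tbg s t x) => [y|] /=.
  by apply/(cg_some _ st' (from_phiP hw)); apply: from_phiP; rewrite -E1.
apply/(cg_none st' (from_phiP hw)) => hd.
have /tpD : D (tbp r) (Some t) (Some w) by apply/(emb_D e).
by rewrite [G t _]hg E1.
Qed.

Definition from_emb : strong_embedding E (conv L) :=
  MkStrongEmbedding from_tauP from_phi_inj from_f from_g.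

End From.

Section To.
Variables (M : tree_of_Bsets C) (r : node M) (hr : forall t, r <= t).
Variable i : strong_embedding M (conv L).

Definition to_f (t : option (node M)) : P :=
  if t is Some t then val (tau i t) else rt L.

Definition to_h (x : option (tbB r)) : nat :=
  if x is Some x then val (phi i r x) else ctr L.

Let lr t : lt L (rt L) (val (tau i t)).
Proof. by split; [exact: (w_rt W (cnd _))|move=> e; exact: (@cnrt _ _ _ L (tau i t) (esym e))]. Qed.

Lemma to_G t o :
  (exists y, G t o = Some y /\ isc (to_h o) (phi i t y)) \/
  (G t o = None /\ ~ D L (val (tau i t)) (to_h o)).
Proof.
have lt' : tau i r <= tau i t by rewrite tau_le.
case: o => [x|] /=; last first.
  by right; split=> //; apply: (w_dom1 W (u := rt L)); exact: (w_frctr W (lr t)).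
have hx := isc_val (phi i r x); have := phi_g i x (hr t).
case E1 : (tbg r t x) => [y|] /= hg.
  by left; exists y; split=> //; apply/(cg_some _ lt' hx).
by right; split=> //; apply/(cg_none lt' hx).
Qed.

Lemma to_rt x y : eqv L (rt L) (to_h x) (to_h y) <-> x = y.
Proof.
have nc z : ~ eqv L (rt L) (ctr L) (val (phi i r z)).
  move=> e; apply: (w_dom1 W (w_frctr W (lr r))).
  apply/(eqvDE W (lr r).1 e); exact: cB_D.
split; last first.
  move=> ->; case: y => [y|] /=; last exact: (w_ctr W).
  by apply: (w_mono W (lr r).1); exact: cB_D.
case: x y => [x|] [y|] //= => [e|e|/nc//]; last by case: (nc _ (eqv_sym W e)).
congr Some; apply: (phi_inj (i := i)).
apply/(isc_eq (isc_val _) (isc_val _)); apply: (w_monoe W (lr r).1 e); exact: cB_D.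
Qed.

Lemma to_emb : emb (tbp r) L to_f to_h.
Proof.
have hD x : D L (rt L) (to_h x) by exact/to_rt.
split.
- by move=> [t|] _ /=; [exact: cnd|exact: (w_ndrt W)].
- by [].
- by move=> [t|] // _ _; exact: (tau_col i t).
- move=> [s|] [t|] _ _ /=.
  + by rewrite -[s <= t](tau_le i); apply: iff_sym; exact: cleP.
  + by split=> // h; case: (lt_irr W (lr s)).
  + by split=> // _; case: (lr t).
  + by split=> // _; exact: (w_refl W (w_ndrt W)).
- move=> m [s|] [t|] g /=.
  + case: m g => [m|] g; last by case: g => _ _ /(_ (Some (Order.meet s t)) (leIl _ _) (leIr _ _)).
    by move/tp_glb: g => ->; rewrite /= tau_meet; exact: cmeetP.
  + have -> : m = None by case: g; case: m.
    by split=> //=; [case: (lr s)|exact: (w_refl W (w_ndrt W))].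
  + have -> : m = None by case: g; case: m.
    by split=> //=; [exact: (w_refl W (w_ndrt W))|case: (lr t)].
  + have -> : m = None by case: g; case: m.
    by split=> //=; exact: (w_refl W (w_ndrt W)).
- move=> [t|] x y z _ _ _ _ /=; last first.
    rewrite (w_star W); split=> -[h1 h2 h3 h]; split=> //.
      by move: h; rewrite !(to_rt) -/(to_h None) to_rt.
    by move: h; rewrite !(to_rt) -/(to_h None) to_rt.
  have H := w_preB W (val (tau i t)).
  case: (to_G t x) => [[x' [hx ix]]|[hx nx]]; last first.
    split=> [/(pb_domx H)//|[x1 [y1 [z1 []]]]]; by rewrite hx.
  case: (to_G t y) => [[y' [hy iy]]|[hy ny]]; last first.
    split=> [/(pb_domy H)//|[x1 [y1 [z1 []]]]]; by rewrite hy.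
  case: (to_G t z) => [[z' [hz iz]]|[hz nz]]; last first.
    split=> [/(pb_domz H)//|[x1 [y1 [z1 []]]]]; by rewrite hz.
  by rewrite (pullE hx hy hz) -(phi_B i) -(cbeP ix iy iz).
- move=> [t|] [s|] x //=; last by move=> ->; exact: (w_frctr W (lr s)).
  move=> [ts hx]; have ts' := tau_lt i ts; apply/(cfP _ ts').
  case: (to_G t x) => [[x' [hx' ix]]|[]]; last by rewrite hx.
  by move: hx'; rewrite hx => -[e]; subst x'; rewrite phi_f in ix.
Qed.

End To.
End Conv.

Section Fin.
Variables (M E : tree_of_Bsets C) (i : strong_embedding M E).
Variables (r : node M) (hr : forall t, r <= t) (e : node E) (he : forall t, e <= t).

Lemma sect_ex (y : tbB (tau i r)) : exists x, G (r := e) (tau i r) (Some x) = Some y.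
Proof. exact: Gsurj. Qed.

Definition fin_f (t : option (node M)) : option (node E) := omap (tau i) t.

(** The root of M may be sent above the root of E; a point of its $B$-set is then named by a chosen
    preimage in the root of E. *)
Definition fin_h (x : option (tbB r)) : option (tbB e) :=
  if x is Some x then Some (projT1 (cid (sect_ex (phi i r x)))) else None.

Lemma fin_G t o : G (tau i t) (fin_h o) = omap (phi i t) (G t o).
Proof.
case: o => [x|] //; have hx := projT2 (cid (sect_ex (phi i r x))).
have lt' : tau i r <= tau i t by rewrite tau_le.
by rewrite (Gcomp he _ lt') hx; exact: (phi_g i x (hr t)).
Qed.

Lemma fin_h_inj : injective fin_h.
Proof.
move=> x y exy; have := fin_G r x; rewrite exy fin_G.
case: x y exy => [x|] [y|] //= _; rewrite !tbg_id /= => -[/phi_inj ->].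
by [].
Qed.

Lemma fin_emb : emb (tbp r) (tbp e) fin_f fin_h.
Proof.
have WE : wptb (tbp e) by case: (tbp_ptb he).
split.
- by [].
- by [].
- by move=> [t|] // _ _; exact: (tau_col i t).
- by move=> [s|] [t|] _ _ //=; rewrite tau_le.
- move=> m [s|] [t|] g /=.
  + case: m g => [m|] g; last by case: g => _ _ /(_ (Some (Order.meet s t)) (leIl _ _) (leIr _ _)).
    by move/tp_glb: g => ->; apply/tp_glb; rewrite tau_meet.
  + by have -> : m = None by case: g; case: m.
  + by have -> : m = None by case: g; case: m.
  + by have -> : m = None by case: g; case: m.
- move=> [t|] x y z _ _ _ _ /=; last first.
    have E1 u w : fin_h u = fin_h w <-> u = w by split=> [/fin_h_inj|->].
    have E2 u : (None = fin_h u) <-> None = u by split=> [/(@fin_h_inj None)|<-].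
    by split=> -[_ _ _ hh]; split=> //; move: hh; rewrite !E1 E2.
  rewrite /pull; split=> -[x1 [y1 [z1 []]]]; rewrite ?fin_G.
    case Ex : (G t x) => [x'|] //= [<-]; case Ey : (G t y) => [y'|] //= [<-].
    case Ez : (G t z) => [z'|] //= [<-] /phi_B hb; by exists x', y', z'.
  move=> -> -> -> hb; exists (phi i t x1), (phi i t y1), (phi i t z1); split=> //.
  exact/phi_B.
- move=> [t|] [s|] x //=; last by move=> ->.
  by move=> [ts hx]; rewrite tau_lt // fin_G hx /= phi_f.
Qed.

End Fin.
End Transfer.

Lemma finite_fin (T : Type) : finite_set [set: T] -> fin (fun _ : T => True).
Proof.
case=> n /card_set_bijP [f [hf1 hf2 hf3]].
have /choice [g hg] : forall i, exists o : option T, forall x, f x = i -> o = Some x.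
  move=> i; have [[x hx]|n'] := pselect (exists x, f x = i); last first.
    by exists None => x hx; case: n'; exists x.
  by exists (Some x) => y hy; congr Some; apply: hf2; rewrite ?in_setT // hy.
exists n, g => x _; exists (f x); last exact: hg.
exact: (hf1 x I).
Qed.

(** * Extension and universality in the limit *)

Section ConvRich.
Context {d : Order.disp_t} {C : orderType d}.
Variables (P : choiceType) (L : ctree (C := C) P).
Hypothesis LR : rich L.

Let LP : ptb L. Proof. exact: pr_ptb (c_proper L). Qed.
Let WL : wptb L. Proof. by case: LP. Qed.

Lemma conv_pt_eqv (t1 t2 : node (conv L)) (y1 : tbB t1) (y2 : tbB t2) x1 x2 :
  val t1 = val t2 -> isc x1 y1 -> isc x2 y2 -> eqv L (val t1) x1 x2 ->
  existT (fun t : node (conv L) => tbB t) t1 y1 = existT _ t2 y2.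
Proof. by move=> /val_inj e; subst t2 => h1 h2 e; congr existT; exact/(isc_eq h1 h2). Qed.

Lemma conv_pt_eq (t1 t2 : node (conv L)) (y1 : tbB t1) (y2 : tbB t2) x1 x2 :
  val t1 = val t2 -> isc x1 y1 -> isc x2 y2 -> eqv L (rt L) x1 x2 ->
  existT (fun t : node (conv L) => tbB t) t1 y1 = existT _ t2 y2.
Proof.
move=> et h1 h2 e; apply: (conv_pt_eqv et h1 h2); apply: (w_monoe WL) e (isc_D h1).
by apply: (w_rt WL); exact: cnd.
Qed.

Lemma tbp_fin (E : tree_of_Bsets C) (e : node E) : finite_tb E ->
  fin (nd (tbp e)) /\ fin (D (tbp e) (rt (tbp e))).
Proof.
case=> [f1 f2 _ _]; split.
  have [n [g hg]] := finite_fin f1; exists n.+1, (fun i => if i is i.+1 then omap Some (g i) else Some None).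
  by move=> [t|] _; [have [i li ei] := hg t I; exists i.+1; rewrite //= ei|exists 0%N].
have [n [g hg]] := finite_fin (f2 e); exists n.+1, (fun i => if i is i.+1 then omap Some (g i) else Some None).
by move=> [t|] _; [have [i li ei] := hg t I; exists i.+1; rewrite //= ei|exists 0%N].
Qed.

Lemma tbp_inh (E : tree_of_Bsets C) (e : node E) (he : forall t, e <= t) p :
  exists x, D (tbp e) p x.
Proof.
case: p => [t|]; last by exists None; exact/tpeqvN.
have [y] := Bset_inhabited (tbB t); have [x hx] := Gsurj he y.
by exists (Some x); apply/tpD; rewrite hx.
Qed.

(** M with its two embeddings is itself a partial embedding of E into L; its completion is the
    required extension. *)
Lemma conv_rich M E (i : strong_embedding M E) (h : strong_embedding M (conv L)) :
  finite_tb M -> finite_tb E ->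
  exists k : strong_embedding E (conv L), emb_eq (emb_comp k i) h.
Proof.
move=> [_ _ [r hr] _] /[dup] fE [_ _ [e he] _].
have [fn fx] := tbp_fin e fE.
have EP := tbp_ptb he.
have s0t : exists t, lt (tbp r) (rt (tbp r)) t by exists (Some r).
pose s0 := Stage (E := tbp e) (L := L) (tbp_ptb hr) (fin_emb i hr he) (to_emb hr h)
  (fun t _ => tbp_inh hr t) s0t.
have [s [ab1 ab2] cs] := completion EP LP LR fn fx (fun p _ => tbp_inh he p) s0.
have [f [g [eg hf hg]]] := complete_emb EP cs.
have fE0 t : f (Some (tau i t)) = val (tau h t).
  by have [t' [nt' e1 e2]] := ab1 (Some t) I; rewrite -[RHS]e2 -hf // e1.
exists (from_emb he eg).
have ht t : val (tau (from_emb he eg) (tau i t)) = val (tau h t) by exact: fE0.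
split=> [t|[t y]]; first exact/val_inj/ht.
have [w hw] := Gsurj hr y.
have hw2 : G (tau i t) (fin_h i he (Some w)) = Some (phi i t y).
  by have := fin_G i hr he t (Some w); rewrite hw.
apply: (conv_pt_eq (x1 := g (fin_h i he (Some w))) (x2 := to_h h (Some w)) (ht t)).
- exact: from_phiP.
- case: (to_G hr h t (Some w)) => [[y' [hy' iy']]|[]]; last by rewrite hw.
  by move: hy'; rewrite hw => -[->].
- have dw : D (tbp r) (rt (tbp r)) (Some w) by exact/tpeqvN.
  have [x' [dx' e1 e2]] := ab2 (Some w) dw.
  by have := hg x' dx'; rewrite e1 e2.
Qed.

End ConvRich.

Section Universal.
Context {d : Order.disp_t} {C : orderType d}.
Variables (P : choiceType) (L : ctree (C := C) P).
Hypothesis LR : rich L.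

Let LP : ptb L. Proof. exact: pr_ptb (c_proper L). Qed.
Let WL : wptb L. Proof. by case: LP. Qed.

(** For a colour below that of t0, a node fits between the virtual root and t0. For one above, two
    branches are produced at a point of t0 by [ri_leaf], and [ri_top] applies. *)
Lemma all_colours c t0 : lt L (rt L) t0 -> exists2 u, lt L (rt L) u & col L u = c.
Proof.
move=> l; have [n0 _] := w_nd WL l.1; have [_ nt] := w_nd WL l.1.
have nr : t0 <> rt L by case: l => _ n e; apply: n.
have [->|] := eqVneq c (col L t0); first by exists t0.
rewrite neq_lt => /orP[h|h].
  by have [u [h1 h2 h3]] := ri_node LR l (or_introl erefl) h; exists u.
have [a da] := pr_inh (c_proper L) nt.
have [b [nb hb]] := ri_leaf LR nr da da.
have [b' [nb' hb']] := ri_leaf LR nr da (pb_domy (w_preB WL t0) hb).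
have [u [fu cu _ _ _]] := ri_top LR nr hb' nb' nb h.
by exists u => //; exact: (lt_leT WL l (w_frlt WL fu).1).
Qed.

(** The partial embedding to be completed has one proper node with one point. It matches the root of
    E with a node of L of the same colour. *)
Lemma conv_universal t0 E : lt L (rt L) t0 -> finite_tb E ->
  inhabited (strong_embedding E (conv L)).
Proof.
move=> l0 /[dup] fE [_ _ [e he] _].
pose c := colour E e.
have [u lu cu] := all_colours c l0.
have [m dm] := pr_inh (c_proper L) (w_nd WL lu.1).2.
have [fn fx] := tbp_fin e fE.
have EP := tbp_ptb he; have [WE _ _] := EP.
have [x1] := Bset_inhabited (tbB e).
(* [false] is the centre of the virtual root and [true] its only leaf, which becomes the point of
   the node to be added. *)
pose S := seed tt false (fun _ => True) (fun _ : unit => c).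
have WS : wptb S := seed_wptb tt (fun=> c) (I : (fun _ : bool => True) false).
have E1 x y : eqv S tt x y <-> x = y.
  by rewrite (seed_eqv tt false (fun=> True) (fun _ : unit => c)); split=> [[]|].
have D1 x : D0 S tt false x -> x = true.
  by case: x => // -[_ []]; exact/E1.
have pl : place S tt false c None.
  split=> //.
  - exact/E1.
  - by move=> _; exact/E1.
  - right=> x y z /D1 -> /D1 -> _ _ _ _; constructor 1 => /=.
    by move/E1.
  - by move=> s t x l; exfalso; move: (l) => -[_]; case: s {l}; case: t.
  - by move=> t b x y z hb; right; exact: (seed_br3 I hb).
have bE x y : be S tt false x y -> D0 S tt false x -> D0 S tt false y -> False.
  by move=> h /D1 ex /D1 ey; subst x y; move: h => /E1.
have P1 := addnode_ptb WS pl.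
pose hE (b : bool) := if b then Some x1 else None : option (tbB e).
pose hL (b : bool) := if b then m else ctr L.
have EE : emb S (tbp e) (fun _ => rt (tbp e)) hE.
  apply: seed_emb => // x y _ _; apply: (iff_trans (tpeqvN _ _)).
  by case: x; case: y.
have mr : D L (rt L) m by exact: (D_rt WL dm).
have cm : ~ eqv L (rt L) (ctr L) m.
  by move=> e'; apply: (w_dom1 WL (w_frctr WL lu)); apply/(eqvDE WL lu.1 e').
have EL : emb S L (fun _ => rt L) hL.
  apply: seed_emb => // x y _ _; case: x; case: y; split=> //=.
  - by move=> /(eqv_sym WL) /cm.
  - by move=> _; exact: (w_ctr WL).
have EE1 := emb_addnode WS WE EE pl (w := Some e).
have EL1 := emb_addnode WS WL EL pl (w := u).
have {}EE1 : emb (addnode S tt false c None) (tbp e) (fun o => if o is Some t then rt (tbp e) else Some e) hE.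
  apply: EE1 => //.
  - by move=> x /D1 -> /=; apply/tpD => /=; rewrite tbg_id.
  - by move=> x y dx dy /bE /(_ dx dy).
have {}EL1 : emb (addnode S tt false c None) L (fun o => if o is Some t then rt L else u) hL.
  apply: EL1 => //.
  - exact: (w_frctr WL).
  - by move=> x /D1 ->.
  - by move=> x y dx dy /bE /(_ dx dy).
have i1 t : nd (addnode S tt false c None) t -> exists x, D (addnode S tt false c None) t x.
  case: t => [t|] _.
    by exists false; case: t; exact/E1.
  exists true; apply/star_D; split; first exact/E1.
  by move/E1.
have t1 : exists t, lt (addnode S tt false c None) (Some tt) t.
  by exists None; split=> //=; split.
have [s ab cs] := completion EP LP LR fn fx (fun p _ => tbp_inh he p) (Stage P1 EE1 EL1 i1 t1).
have [f [g [eg _ _]]] := complete_emb EP cs.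
exact: inhabits (from_emb he eg).
Qed.

End Universal.

Local Open Scope classical_set_scope.
Local Open Scope card_scope.
Local Open Scope order_scope.

Lemma fin_finite (T : Type) : fin (fun _ : T => True) -> finite_set [set: T].
Proof.
case=> n [e he].
have /choice [f hf] : forall x, exists i, (i < n)%N /\ e i = Some x.
  by move=> x; have [i li ei] := he x I; exists i.
have fi : {in [set: T] &, injective f}.
  by move=> x y _ _ exy; have [_ ex] := hf x; have [_ ey] := hf y; move: ex; rewrite exy ey => -[].
have /eq_finite_set -> : [set: T] #= range f by apply/card_set_bijP; exists f; exact: inj_bij.
 apply: (@sub_finite_set _ _ `I_n) => // i [x _ <-].
by case: (hf x).
Qed.

Lemma countable_inj (T U : Type) (f : T -> U) : injective f -> countable [set: U] ->
  countable [set: T].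
Proof.
move=> fi /countable_injP [g hg]; apply/countable_injP; exists (g \o f).
by move=> x y _ _ /hg; rewrite !in_setT => /(_ isT isT) /fi.
Qed.

Section Incl.
Context {d : Order.disp_t} {C : orderType d}.

Definition emb_id (A : tree_of_Bsets C) : strong_embedding A A.
Proof.
refine (@MkStrongEmbedding _ _ A A id _ (fun t x => x) _ _ _); [by split|by split|by []|].
by move=> s t x _ /=; case: tbg.
Defined.

Section Two.
Variables (P : choiceType) (L1 L2 : ctree (C := C) P).
Hypothesis e : emb L1 L2 id id.
Variable r : node (conv L1).
Hypothesis hr : forall t, r <= t.

Let W1 : wptb L1. Proof. by case: (pr_ptb (c_proper L1)). Qed.
Let W2 : wptb L2. Proof. by case: (pr_ptb (c_proper L2)). Qed.

Lemma conv_incl : exists k : strong_embedding (conv L1) (conv L2),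
  (forall t, val (tau k t) = val t) /\ forall t (y : cB L1 (val t)),
    @isc _ _ _ L2 (val (tau k t)) (val y) (phi k t y).
Proof.
have WE : wptb (tbp r) by case: (tbp_ptb hr).
have e1 := emb_compose WE W1 (to_emb hr (emb_id (conv L1))) e.
exists (from_emb hr e1); split=> // t y.
have [x hx] := Gsurj hr (t := t) y.
have h1 := from_phiP hr e1 hx.
apply: (eqv_trans W2 _ h1).
have : @isc _ _ _ L1 (val t) (val (x : cB L1 (val r))) y by apply/(cg_some (t := t) y (hr t) (isc_val (x : cB L1 (val r)))).
move=> /(eqv_sym W1) h2; have nt := cnd t; have [dx dy] := eqvD W1 h2.
by apply/(emb_eqv e nt (D_rt W1 dx) (D_rt W1 dy)).
Qed.

End Two.

Variables (P : choiceType) (L : ctree (C := C) P).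
Let W : wptb L. Proof. by case: (pr_ptb (c_proper L)). Qed.

(** A minimal proper node is least, because all proper nodes lie in one cone of the virtual root. *)
Lemma conv_root : fin (nd L) -> (exists t, lt L (rt L) t) ->
  exists r : node (conv L), forall t, r <= t.
Proof.
move=> fn [t0 l0].
have [m lm mmin] : exists2 m, lt L (rt L) m & forall q, lt L (rt L) q -> ~ lt L q m.
  apply: (fin_min (R := lt L)) l0.
  - by move=> x y z h [h' _]; exact: (lt_leT W h h').
  - by move=> x [].
  - by apply: fin_sub fn => q [/(w_nd W) []].
have hm : nd L m /\ m <> rt L by split; [case: (w_nd W lm.1)|case: lm => _ n e; apply: n].
exists (mkn hm : node (conv L)) => t; apply/cleP => /=.
have lt0 : lt L (rt L) (val t).
  by split; [apply: (w_rt W); exact: cnd|move=> e; apply: (@cnrt _ _ _ L t)].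
have [z [z1 z2 z3]] := w_cone W lm lt0.
by have [<-//|n] := pselect (z = m); case: (mmin z).
Qed.

Lemma conv_finite : fin (nd L) -> fin (D L (rt L)) -> (exists t, lt L (rt L) t) ->
  (forall t, nd L t -> t <> rt L -> (exists s, lt L t s) ->
    exists s1 s2, [/\ lt L t s1, lt L t s2 & ~ cone L t s1 s2]) ->
  finite_tb (conv L).
Proof.
move=> fn fx top ram; split.
- apply: fin_finite; case: fn => n [e he].
  exists n, (fun i => obind (insub : P -> option (cnode L)) (e i)) => t _.
  by have [i li ei] := he (val t) (cnd t); exists i => //; rewrite ei /= valK.
- move=> t; apply: fin_finite; case: fx => n [e he].
  exists n, (fun i => obind (insub : nat -> option (cB L (val t))) (e i)) => x _.
  have [i li ei] := he (val (x : cB L (val t))) (D_rt W (cB_D (x : cB L (val t)))).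
  by exists i => //; rewrite ei /= valK.
- exact: conv_root.
- move=> t nm; have [s1' [s2' [l1 l2 nc]]] : exists s1 s2, [/\ lt L (val t) s1, lt L (val t) s2 & ~ cone L (val t) s1 s2].
    apply: ram; [exact: cnd|exact: cnrt|].
    by apply: contrapT => n; apply: nm => -[s /cltP ls]; apply: n; exists (val s).
  have ok s : lt L (val t) s -> nd L s /\ s <> rt L.
    move=> l; split; first by case: (w_nd W l.1).
    by move=> e; apply: (lt_irr W l); rewrite e; apply: (w_rt W); exact: cnd.
  pose s1 : node (conv L) := mkn (ok _ l1); pose s2 : node (conv L) := mkn (ok _ l2).
  have l1' : t < s1 by apply/cltP.
  have l2' : t < s2 by apply/cltP.
  exists [set y | same_cone t s1 y], [set y | same_cone t s2 y]; split.
  + by exists s1.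
  + by exists s2.
  + move=> /seteqP [_ /(_ s2)] => h; apply: nc; apply/(cconeP (L := L) t s1 s2).
    by apply: h; exists s2.
Qed.

Lemma conv_countable : countable [set: P] -> countable_tb (conv L).
Proof.
move=> cP; split; first exact: countable_inj val_inj cP.
by move=> t; apply: (countable_inj (f := val)); [exact: val_inj|exact: countableP].
Qed.

End Incl.

(** * Finite trees inside T_C *)

Section TreeC.
Context {d d' : Order.disp_t} {C : orderType d} {T : meetSemilatticeType d'}.
Variables (F : T -> C).
Hypothesis TC : is_TC F.

Let Fle s t : s <= t -> F s <= F t.
Proof. by rewrite le_eqVlt => /orP[/eqP->//|/(TC_colouring TC)/ltW]. Qed.

Lemma cone_trans t x y z : same_cone (T := T) t x y -> same_cone t y z -> same_cone t x z.
Proof.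
move=> [u [tu ux uy]] [v [tv vy vz]].
have [tree _] := TC_semilinear TC; have := tree _ _ _ uy vy.
rewrite /Order.comparable => /orP[uv|vu].
  by exists u; split=> //; exact: le_trans uv vz.
by exists v; split=> //; exact: le_trans vu ux.
Qed.

Lemma cone_symm t x y : same_cone (T := T) t x y -> same_cone t y x.
Proof. by case=> z [*]; exists z. Qed.

Lemma above_colour t c : F t < c -> exists2 x, t < x & F x = c.
Proof.
move=> tc; have [S [cS aS] St] := TC_chain TC t; have [x Sx Fx] := aS c.
exists x => //; have := cS t x St Sx; rewrite /Order.comparable => /orP[|/Fle].
  by rewrite le_eqVlt => /orP[/eqP e|//]; move: tc; rewrite e Fx ltxx.
by rewrite Fx leNgt tc.
Qed.

(* There are infinitely many cones at t, so one of them avoids a finite set. *)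
Lemma new_cone (I : Type) (f : I -> T) t c : finite_set [set: I] -> F t < c ->
  exists w, [/\ t < w, F w = c & forall i, t < f i -> ~ same_cone t w (f i)].
Proof.
move=> fI tc; have [x0 tx0 _] := above_colour tc.
have tm : ~ maximal t by move=> h; apply: h; exists x0.
have [y ty hy] : exists2 y, t < y & forall i, t < f i -> ~ same_cone t y (f i).
  apply: contrapT => n; have := infinite_nat.
  rewrite -(eq_finite_set (TC_ramification TC tm)); apply.
  apply: (@sub_finite_set _ _ [set [set z | same_cone t (f i) z] | i in [set: I]]); last first.
    exact: finite_image.
  move=> K [y ty ->]; have [i hi] : exists i, t < f i /\ same_cone t y (f i).
    apply: contrapT => n'; apply: n; exists y => // i h1 h2; apply: n'; by exists i.
  exists i => //; apply/seteqP; split=> z /=; apply: cone_trans; first by case: hi.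
  by apply: cone_symm; case: hi.
(* The point x of colour c on a colour chain through y may lie below y, but it is above t because
   its colour is greater; in either case it is in the cone of y. *)
have [S [cS aS] Sy] := TC_chain TC y; have [x Sx Fx] := aS c.
have [tx xy] : t < x /\ same_cone t x y.
  have := cS x y Sx Sy; rewrite /Order.comparable => /orP[xy|yx]; last first.
    by split; [exact: lt_le_trans ty yx|exists y].
  suff tx : t < x by split=> //; exists x.
  have [tree _] := TC_semilinear TC; have := tree _ _ _ xy (ltW ty).
  rewrite /Order.comparable => /orP[/Fle|]; first by rewrite Fx leNgt tc.
  by rewrite le_eqVlt => /orP[/eqP e|//]; move: tc; rewrite e Fx ltxx.
exists x; split=> // i ti h; apply: (hy i ti); exact: cone_trans (cone_symm xy) h.
Qed.

(** The embedding is extended over initial segments, U being the nodes not yet placed. A minimal v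
    in U has a greatest predecessor p and is sent into a cone at the image of p that avoids the
    images of all other nodes, so that meets with v are computed at p. *)
Lemma finite_over (M : tree_of_Bsets C) : finite_tb M -> finite_tb_over F M.
Proof.
move=> /[dup] fM [fn _ [r hr] _]; split=> //.
have fN := finite_fin fn.
pose part (Q : node M -> Prop) (f : node M -> T) :=
  [/\ forall t, Q t -> F (f t) = colour M t,
      forall s t, Q s -> Q t -> s < t -> f s < f t &
      forall s t, Q s -> Q t -> f (Order.meet s t) = Order.meet (f s) (f t)].
suff key U : fin U -> forall f, ~ U r -> (forall s t, s <= t -> ~ U t -> ~ U s) ->
    part (fun t => ~ U t) f -> exists iota, tree_embedding (colour M) F iota.
  have [x0] := TC_inhabited TC; have [S [_ aS] _] := TC_chain TC x0.
  have [w _ Fw] := aS (colour M r).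
  apply: (key (fun t => t <> r)) (fun _ => w) _ _ _.
  - by apply: fin_sub fN.
  - by move=> h; apply: h.
  - move=> s t st /contrapT e h; apply: h; apply: le_anti; rewrite hr andbT.
    by rewrite e in st.
  - split=> [t /contrapT -> //|s t /contrapT -> /contrapT ->|s t _ _].
      by rewrite ltxx.
    by rewrite meetxx.
move: U; apply: fin_ind => U IH f nUr dU [f1 f2 f3].
have [[v0 Uv0]|nU] := pselect (exists v, U v); last first.
  exists f; split=> [t|s t|s t]; [apply: f1|apply: f2|apply: f3] => h; apply: nU.
  - by exists t.
  - by exists s.
  - by exists t.
  - by exists s.
  - by exists t.
have [v Uv vmin] : exists2 v, U v & forall q, U q -> ~ (q < v).
  apply: (fin_min (R := fun p q => p < q)) Uv0; last exact: fin_sub fN.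
    by move=> x y z; exact: lt_trans.
  by move=> x; rewrite ltxx.
have rv : r < v by rewrite lt_neqAle hr andbT; apply/eqP => e; apply: nUr; rewrite e.
have [p [nUp pv] pmax] : exists2 p, ~ U p /\ p < v & forall q, ~ U q /\ q < v -> ~ (p < q).
  apply: (fin_min (R := fun p q => q < p)) (conj nUr rv); last exact: fin_sub fN.
    by move=> x y z h1 h2; exact: lt_trans h2 h1.
  by move=> x; rewrite ltxx.
have pmax' q : q < v -> q <= p.
  move=> qv; have nUq : ~ U q by move=> h; exact: (vmin q).
  have [tree _] := node_semilinear M; have := tree _ _ _ (ltW qv) (ltW pv).
  rewrite /Order.comparable => /orP[//|]; rewrite le_eqVlt => /orP[/eqP->//|pq].
  by case: (pmax q).
have fpv : F (f p) < colour M v by rewrite f1 //; exact: colourP.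
have [w [pw Fw hw]] := new_cone f fn fpv.
have mE s : ~ U s -> Order.meet v s = Order.meet p s.
  move=> nUs; apply: le_anti; rewrite !lexI !leIr !andbT; apply/andP; split.
    apply: pmax'; rewrite lt_neqAle leIl andbT; apply/eqP => e.
    by apply: (dU v s) Uv => //; rewrite -e leIr.
  by apply: le_trans (leIl _ _) (ltW pv).
(* If the meet of w and [f s] were strictly above [f p], then w and [f s] would share a cone at
   [f p], against the choice of w. *)
have wE s : ~ U s -> Order.meet w (f s) = f (Order.meet v s).
  move=> nUs; rewrite mE // f3 //; apply: le_anti; apply/andP; split; last first.
    by rewrite lexI leIr andbT; apply: le_trans (leIl _ _) (ltW pw).
  rewrite lexI leIr andbT; have [tree _] := TC_semilinear TC.
  have := tree _ _ _ (leIl w (f s)) (ltW pw); rewrite /Order.comparable => /orP[//|].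
  rewrite le_eqVlt => /orP[/eqP <- //|pz]; exfalso.
  have ps : f p < f s by apply: lt_le_trans pz (leIr _ _).
  have e : f (Order.meet p s) = f p by rewrite f3 //; exact/meet_idPl/ltW.
  have ps' : p <= s.
    apply: contrapT => n; have : Order.meet p s < p.
      by rewrite lt_neqAle leIl andbT; apply/eqP => e'; apply: n; rewrite -e' leIr.
    have nm : ~ U (Order.meet p s) by apply: (dU _ p) => //; exact: leIl.
    by move=> l; have := f2 _ _ nm nUp l; rewrite e ltxx.
  apply: (hw s ps); exists (Order.meet w (f s)); split=> //; [exact: leIl|exact: leIr].
have above s : ~ U s -> ~ (v < s) by move=> nUs /ltW vs; exact: (dU v s vs nUs).
pose f' t := if t == v then w else f t.
have f'v : f' v = w by rewrite /f' eqxx.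
have f'o t : ~ U t -> f' t = f t.
  by move=> n; rewrite /f'; case: eqP => // e; case: n; rewrite e.
apply: (IH (fun t => U t /\ t <> v) _ _ f').
- by move=> t [].
- by exists v; split=> //; case.
- by case.
- move=> s t st nt [Us ns]; have [ev|nv] := pselect (t = v).
    by apply: (vmin s Us); rewrite lt_neqAle -{2}ev st andbT; apply/eqP.
  by apply: (dU s t st) Us => Ut; apply: nt.
have cs t : ~ (U t /\ t <> v) -> t = v \/ ~ U t.
  by move=> h; have [e|n] := pselect (t = v); [left|right=> h'; apply: h].
split.
- by move=> t /cs [->|h]; rewrite ?f'v ?f'o // f1.
- move=> s t /cs [->|hs] /cs [->|ht] st.
  + by move: st; rewrite ltxx.
  + by case: (above t ht).
  + rewrite f'v f'o //; have := pmax' _ st; rewrite le_eqVlt => /orP[/eqP->//|sp].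
    by apply: lt_trans pw; exact: f2.
  + by rewrite !f'o //; exact: f2.
- have nm s t : ~ U t -> ~ U (Order.meet s t) by move=> h; apply: (dU _ t) => //; exact: leIr.
  move=> s t /cs [->|hs] /cs [->|ht].
  + by rewrite meetxx f'v meetxx.
  + by rewrite f'v !f'o ?wE //; exact: nm.
  + by rewrite meetC [RHS]meetC f'v !f'o ?wE //; exact: nm.
  + by rewrite !f'o ?f3 //; exact: nm.
Qed.

End TreeC.

(** * Back-and-forth *)

Section Flat.
Context {d : Order.disp_t} {C : orderType d}.
Implicit Types A M N : tree_of_Bsets C.

Definition pt A := {t : node A & tbB t}.

Definition mkpt A (t : node A) (x : tbB t) : pt A := existT _ t x.

Lemma mkpt_inj A (t : node A) (x y : tbB t) : mkpt x = mkpt y -> x = y.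
Proof. exact: eq_from_Tagged. Qed.

Definition fpt A (t s : node A) : pt A := mkpt (tbf t s).

Definition gpt A (p : pt A) (t : node A) : option (pt A) :=
  omap (@mkpt A t) (tbg (projT1 p) t (projT2 p)).

Definition Bpt A (p q r : pt A) : Prop :=
  exists t (x y z : tbB t), [/\ p = mkpt x, q = mkpt y, r = mkpt z & Brel x y z].

Lemma BptE A (t : node A) (x y z : tbB t) : Bpt (mkpt x) (mkpt y) (mkpt z) <-> Brel x y z.
Proof.
split=> [[s [x' [y' [z' [e1 e2 e3]]]]]|h]; last by exists t, x, y, z.
have e := congr1 (@projT1 _ _) e1; rewrite /= in e; subst s.
by rewrite (mkpt_inj e1) (mkpt_inj e2) (mkpt_inj e3).
Qed.

Lemma Bpt_tag A (p q r : pt A) : Bpt p q r -> projT1 q = projT1 p /\ projT1 r = projT1 p.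
Proof. by case=> t [x [y [z [-> -> -> _]]]]. Qed.

(* Strong embeddings as maps on the disjoint unions of the B-sets, which avoids
   transports between B-sets at equal nodes. *)
Record flat A1 A2 (f : node A1 -> node A2) (g : pt A1 -> pt A2) : Prop := {
  fl_tau : tree_embedding (colour A1) (colour A2) f;
  fl_tag : forall p, projT1 (g p) = f (projT1 p);
  fl_inj : injective g;
  fl_B : forall p q r, Bpt (g p) (g q) (g r) <-> Bpt p q r;
  fl_f : forall t s, t < s -> g (fpt t s) = fpt (f t) (f s);
  fl_g : forall p t, projT1 p <= t -> gpt (g p) (f t) = omap g (gpt p t) }.

Lemma flat_of A1 A2 (h : strong_embedding A1 A2) : flat (tau h) (phi_tot h).
Proof.
split.
- exact: tauP.
- by [].
- move=> [t x] [s y] e; have /= e1 := congr1 (@projT1 _ _) e.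
  have e2 := tau_inj e1; subst s; congr existT.
  exact: (phi_inj (mkpt_inj e)).
- move=> p q r; split=> /[dup] hb /Bpt_tag /= [].
    move=> /tau_inj e1 /tau_inj e2; move: p q r e1 e2 hb => [t x] [s y] [u z] /= e1 e2; subst s u.
    by move=> /BptE /phi_B h0; apply/BptE.
  move: p q r hb => [t x] [s y] [u z] hb /= e1 e2; subst s u.
  by apply/BptE/phi_B/BptE.
- by move=> t s ts; rewrite /phi_tot /fpt /= phi_f.
- move=> [s x] t /= st; rewrite /gpt /= phi_g //.
  by case: (tbg s t x).
Qed.

Lemma of_flat A1 A2 f g : @flat A1 A2 f g ->
  exists h : strong_embedding A1 A2, tau h =1 f /\ phi_tot h =1 g.
Proof.
case=> f1 f2 f3 f4 f5 f6.
have ex t (x : tbB t) : exists y : tbB (f t), g (mkpt x) = mkpt y.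
  by have := f2 (mkpt x); case: (g _) => u y /= e; subst u; exists y.
pose ph t (x : tbB t) := projT1 (cid (ex t x)).
have phE t (x : tbB t) : g (mkpt x) = mkpt (ph t x) := projT2 (cid (ex t x)).
have p1 t : strong_Bset_embedding (ph t).
  split=> [x y e|x y z].
    by apply: mkpt_inj; apply: f3; rewrite !phE e.
  by rewrite -BptE -!phE f4 BptE.
have p2 t s : t < s -> ph t (tbf t s) = tbf (f t) (f s).
  by move=> ts; apply: mkpt_inj; rewrite -phE; exact: f5.
have p3 s t (x : tbB s) : s <= t -> tbg (f s) (f t) (ph s x) = omap (ph t) (tbg s t x).
  move=> st; have := f6 (mkpt x) t st; rewrite phE /gpt /=.
  case: (tbg s t x) => [y|]; case: (tbg (f s) (f t) _) => [z|] //= [].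
  by rewrite -/(mkpt y) phE => /mkpt_inj ->.
exists (MkStrongEmbedding f1 p1 p2 p3); split=> // -[t x].
by rewrite /phi_tot /= -/(mkpt x) phE.
Qed.

Lemma pt_ex A (t : node A) : exists p : pt A, projT1 p = t.
Proof. by have [x] := Bset_inhabited (tbB t); exists (mkpt x). Qed.

(** Inclusion of the images on points suffices: no $B$-set is empty, and a point determines its
    node. *)
Lemma factor A M N (h : strong_embedding M A) (i : strong_embedding N A) :
  (forall p, exists q, phi_tot i q = phi_tot h p) ->
  exists k : strong_embedding M N, emb_eq (emb_comp i k) h.
Proof.
move=> /choice [g hg].
have /choice [f hf] t : exists u, tau i u = tau h t.
  have [p <-] := pt_ex t; exists (projT1 (g p)).
  exact: (congr1 (@projT1 _ _) (hg p)).
have Fi := flat_of i; have Fh := flat_of h.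
have tagE p : projT1 (g p) = f (projT1 p).
  by apply: (tau_inj (i := i)); rewrite hf; exact: (congr1 (@projT1 _ _) (hg p)).
have flt s t : s < t -> f s < f t by move=> st; rewrite -(tau_ltE i) !hf tau_ltE.
have F : flat f g.
  split=> //.
  - split=> // [t|s t]; first by rewrite -(tau_col i) hf tau_col.
    by apply: (tau_inj (i := i)); rewrite hf !tau_meet !hf.
  - by move=> p q e; apply: (fl_inj Fh); rewrite -!hg e.
  - by move=> p q r; rewrite -(fl_B Fi) !hg (fl_B Fh).
  - move=> t s ts; apply: (fl_inj Fi); rewrite hg (fl_f Fh ts) (fl_f Fi) ?hf //.
    exact: flt.
  - move=> p t pt; apply: (inj_omap (fl_inj Fi)).
    rewrite -(fl_g Fi); last by rewrite tagE -(tau_le i) !hf tau_le.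
    by rewrite hg hf (fl_g Fh pt); case: (gpt p t) => [q|] //=; rewrite hg.
have [k [k1 k2]] := of_flat F; exists k; split=> [t|p].
  by rewrite /= k1 hf.
by rewrite -[LHS]/(phi_tot i (phi_tot k p)) k2 hg.
Qed.

Lemma emb_eq_phi A1 A2 (h k : strong_embedding A1 A2) : phi_tot h =1 phi_tot k -> emb_eq h k.
Proof.
move=> e; split=> // t; have [p <-] := pt_ex t; exact: (congr1 (@projT1 _ _) (e p)).
Qed.

Section Glue.
Variables (A A' : tree_of_Bsets C) (M : nat -> tree_of_Bsets C).
Variables (a : forall i, strong_embedding (M i) A) (b : forall i, strong_embedding (M i) A').
Hypothesis ext : forall i, exists u : strong_embedding (M i) (M i.+1),
  phi_tot (a i.+1) \o phi_tot u =1 phi_tot (a i) /\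
  phi_tot (b i.+1) \o phi_tot u =1 phi_tot (b i).
Hypothesis cover : forall p, exists i q, phi_tot (a i) q = p.

Let R i p p' := exists q, phi_tot (a i) q = p /\ phi_tot (b i) q = p'.

Let R_up i j p p' : (i <= j)%N -> R i p p' -> R j p p'.
Proof.
elim: j => [|j IH]; first by rewrite leqn0 => /eqP->.
rewrite leq_eqVlt => /orP[/eqP->//|/IH h /h [q [e1 e2]]].
have [u [h1 h2]] := ext j; exists (phi_tot u q).
by have /= -> := h1 q; have /= -> := h2 q.
Qed.

Let R_fun i j p p' p'' : R i p p' -> R j p p'' -> p' = p''.
Proof.
move=> /(R_up (leq_maxl i j)) [q [e1 e2]] /(R_up (leq_maxr i j)) [q' [e1' e2']].
by rewrite -e2 -e2'; congr phi_tot; apply: (fl_inj (flat_of (a (maxn i j)))); rewrite e1.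
Qed.

(** The pairs formed by the two images of a point of M i increase with i, so their union is a
    function. Each clause of [flat] involves finitely many points and nodes and is checked in a
    single M i. *)
Lemma glue_embeddings : exists K : strong_embedding A A', forall i, emb_eq (emb_comp K (a i)) (b i).
Proof.
have /choice [g hg] p : exists p', exists i, R i p p'.
  by have [i [q e]] := cover p; exists (phi_tot (b i) q), i, q.
have gE i q : g (phi_tot (a i) q) = phi_tot (b i) q.
  by have [j h] := hg (phi_tot (a i) q); apply: (R_fun h (j := i)); exists q.
have /choice [f hf] t : exists t', forall i u, tau (a i) u = t -> tau (b i) u = t'.
  have [p <-] := pt_ex t; exists (projT1 (g p)) => i u e.
  have [j [q [e1 e2]]] := hg p; have [w ew] := pt_ex u; subst u.
  have [q' [f1 f2]] := R_up (leq_maxl j i) (ex_intro _ q (conj e1 e2)).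
  have [w' [f3 f4]] := R_up (leq_maxr j i) (ex_intro _ w (conj erefl erefl)).
  rewrite -f2 -[LHS]/(projT1 (phi_tot (b i) w)) -f4 /=; congr tau.
  apply: (tau_inj (i := a (maxn j i))).
  rewrite -[LHS]/(projT1 (phi_tot (a (maxn j i)) w')) -[RHS]/(projT1 (phi_tot (a (maxn j i)) q')).
  by rewrite f3 f1.
have fE i u : f (tau (a i) u) = tau (b i) u by symmetry; exact: (hf _ i u erefl).
have st p : exists i, forall j, (i <= j)%N -> exists q, phi_tot (a j) q = p.
  have [i [q e]] := cover p; exists i => j ij.
  by have [q' [e' _]] := R_up ij (ex_intro _ q (conj e erefl)); exists q'.
have sn t : exists i, forall j, (i <= j)%N -> exists u, tau (a j) u = t.
  have [p <-] := pt_ex t; have [i hi] := st p; exists i => j /hi [q <-].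
  by exists (projT1 q).
have F : flat f g.
  split.
  - have two : forall s t, exists i u v, tau (a i) u = s /\ tau (a i) v = t.
      move=> s t; have [i hi] := sn s; have [j hj] := sn t.
      have [u hu] := hi _ (leq_maxl i j); have [v hv] := hj _ (leq_maxr i j).
      by exists (maxn i j), u, v.
    split=> [t|s t|s t].
    + have [i hi] := sn t; have [u <-] := hi _ (leqnn i).
      by rewrite fE !tau_col.
    + have [i [u [v [<- <-]]]] := two s t.
      by rewrite !fE !tau_ltE.
    + have [i [u [v [<- <-]]]] := two s t.
      by rewrite -tau_meet !fE tau_meet.
  - move=> p; have [i hi] := st p; have [q <-] := hi _ (leqnn i).
    by rewrite gE -[RHS]/(f (tau (a i) (projT1 q))) fE.
  - move=> p p'; have [i hi] := st p; have [j hj] := st p'.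
    have [q <-] := hi _ (leq_maxl i j); have [q' <-] := hj _ (leq_maxr i j).
    by rewrite !gE => /(fl_inj (flat_of _)) ->.
  - move=> p p' p''; have [i hi] := st p; have [j hj] := st p'; have [k hk] := st p''.
    have [q <-] := hi _ (leq_maxl i (maxn j k)).
    have [q' <-] : exists q', phi_tot (a (maxn i (maxn j k))) q' = p'.
      by apply: hj; apply: leq_trans (leq_maxr _ _); exact: leq_maxl.
    have [q'' <-] : exists q', phi_tot (a (maxn i (maxn j k))) q' = p''.
      by apply: hk; apply: leq_trans (leq_maxr _ _); exact: leq_maxr.
    by rewrite !gE !(fl_B (flat_of _)).
  - move=> s t; have [i hi] := sn s; have [j hj] := sn t.
    have [u <-] := hi _ (leq_maxl i j); have [v <-] := hj _ (leq_maxr i j).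
    rewrite tau_ltE => uv; rewrite -(fl_f (flat_of _) uv) gE !fE.
    exact: (fl_f (flat_of _) uv).
  - move=> p t; have [i hi] := st p; have [j hj] := sn t.
    have [q <-] := hi _ (leq_maxl i j); have [v <-] := hj _ (leq_maxr i j).
    rewrite /= tau_le => qv; rewrite gE fE !(fl_g (flat_of _) qv).
    by case: (gpt q v) => [w|] //=; rewrite gE.
have [K [K1 K2]] := of_flat F; exists K => i; apply: emb_eq_phi => q.
by rewrite -[LHS]/(phi_tot K (phi_tot (a i) q)) K2 gE.
Qed.

End Glue.

Lemma inverse_iso A A' (K : strong_embedding A A') (K' : strong_embedding A' A) :
  phi_tot K' \o phi_tot K =1 id -> phi_tot K \o phi_tot K' =1 id -> isomorphism K.
Proof.
move=> h1 h2; split.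
  exists (tau K') => t; have [p <-] := pt_ex t.
    exact: (congr1 (@projT1 _ _) (h1 p)).
  exact: (congr1 (@projT1 _ _) (h2 p)).
move=> t; have /choice [g hg] : forall y, exists x, phi K t x = y.
  move=> y; have := h2 (mkpt y); have := h1 (phi_tot K' (mkpt y)) => /= e1 e2.
  case: (phi_tot K' _) e2 => s x e2.
  have /= e3 := congr1 (@projT1 _ _) e2; have e4 := tau_inj e3; subst s.
  by exists x; exact: mkpt_inj e2.
by exists g => // x; apply: (phi_inj (i := K)).
Qed.

End Flat.

Section BackForth.
Context {d : Order.disp_t} {C : orderType d}.
Implicit Types A M N : tree_of_Bsets C.

Definition extensible A := forall M E (i : strong_embedding M E), finite_tb M -> finite_tb E ->
  forall h : strong_embedding M A, exists k : strong_embedding E A, emb_eq (emb_comp k i) h.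

Lemma enum_ex (Q : Type) (f : Q -> nat) : injective f ->
  exists e : nat -> option Q, forall q, exists i, e i = Some q.
Proof.
move=> fi; have /choice [e he] : forall n, exists o : option Q, forall q, f q = n -> o = Some q.
  move=> n; have [[q hq]|n'] := pselect (exists q, f q = n); last first.
    by exists None => q h; case: n'; exists q.
  by exists (Some q) => q' h; congr Some; apply: fi; rewrite hq.
by exists e => q; exists (f q); exact: he.
Qed.

Lemma pt_enum A : countable_tb A ->
  exists e : nat -> option (pt A), forall p, exists i, e i = Some p.
Proof.
case=> /countable_injP [f hf] ct.
have ex (t : node A) : exists g : tbB t -> nat, injective g.
  have /countable_injP [g hg] := ct t; exists g => x y.
  by apply: hg; rewrite in_setT.
pose g t := projT1 (cid (ex t)).
have gi t : injective (g t) := projT2 (cid (ex t)).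
apply: (enum_ex (f := fun p => pickle (f (projT1 p), g _ (projT2 p)))).
move=> [t x] [s y] /(pcan_inj pickleK) [] /= /hf; rewrite !in_setT => /(_ isT isT) e.
by subst s => /gi ->.
Qed.

Lemma chain_bound (I Q : Type) (G : I -> Q -> Prop) (S : Q -> Prop) (i0 : I) :
  (forall i j, (forall q, G i q -> G j q) \/ (forall q, G j q -> G i q)) ->
  fin S -> (forall q, S q -> exists i, G i q) -> exists i, forall q, S q -> G i q.
Proof.
move=> tot; move: S; apply: fin_ind => S IH hS.
have [[q0 Sq0]|n] := pselect (exists q, S q); last by exists i0 => q Sq; case: n; exists q.
have [|||i hi] := IH (fun q => S q /\ q <> q0).
- by move=> q [].
- by exists q0; split=> // -[].
- by move=> q [/hS].
have [j hj] := hS _ Sq0; case: (tot i j) => h.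
  by exists j => q Sq; have [->//|n] := pselect (q = q0); apply/h/hi.
by exists i => q Sq; have [->|n] := pselect (q = q0); [exact: h|exact: hi].
Qed.

(** M has finitely many points, so one member of the chain contains all their images and p as
    well. *)
Lemma embedding_through_chain A (K : tree_of_Bsets C -> Prop) M (a : strong_embedding M A) (p : pt A) :
  (forall N, K N -> finite_tb N) -> union_of_chain K A -> finite_tb M ->
  exists N (c : strong_embedding N A) (k : strong_embedding M N),
    [/\ finite_tb N, emb_eq (emb_comp c k) a & exists q, phi_tot c q = p].
Proof.
move=> KF [I [N [h [KN tot _ cov]]]] [fn fx _ _].
pose G i (q : pt A) := exists q', phi_tot (h i) q' = q.
have totG i j : (forall q, G i q -> G j q) \/ (forall q, G j q -> G i q).
  by case: (tot i j) => -[k [_ hk]]; [left|right] => q [q' <-]; exists (phi_tot k q'); exact: hk.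
have [i0 _] := cov p.
have b1 (t : node M) : exists i, forall x : tbB t, G i (phi_tot a (mkpt x)).
  have [||i hi] := @chain_bound I (tbB t) (fun i x => G i (phi_tot a (mkpt x))) (fun _ => True) i0 _ (finite_fin (fx t)).
  - by move=> i j; case: (totG i j) => H; [left|right] => q; exact: H.
  - by move=> x _; exact: cov.
  - by exists i => x; exact: hi.
have [||i hi] := @chain_bound I (node M) (fun i t => forall x : tbB t, G i (phi_tot a (mkpt x))) (fun _ => True) i0 _ (finite_fin fn).
- by move=> i j; case: (totG i j) => H; [left|right] => q hq x; exact/H/hq.
- by move=> t _; exact: b1.
have [j hj] := cov p.
have [k [k1 k2]] : exists k, (forall q, G i q -> G k q) /\ G k p.
  by case: (totG i j) => H; [exists j|exists i; split=> //; exact: H].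
have [|u hu] := @factor _ _ A M (N k) a (h k).
  by move=> [t x]; exact/k1/hi.
by exists (N k), (h k), u; split=> //; exact/KF/KN.
Qed.

(** A finite partial isomorphism between A and A', given by its graph with the two projections. *)
Record triple A A' := Triple {
  t_M : tree_of_Bsets C;
  t_fin : finite_tb t_M;
  t_a : strong_embedding t_M A;
  t_b : strong_embedding t_M A' }.

Definition extends A A' (S S' : triple A A') :=
  exists u : strong_embedding (t_M S) (t_M S'),
    phi_tot (t_a S') \o phi_tot u =1 phi_tot (t_a S) /\
    phi_tot (t_b S') \o phi_tot u =1 phi_tot (t_b S).

Lemma extends_trans A A' (S1 S2 S3 : triple A A') :
  extends S1 S2 -> extends S2 S3 -> extends S1 S3.
Proof.
move=> [u [u1 u2]] [v [v1 v2]]; exists (emb_comp v u); split=> p.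
  by rewrite -u1 -[RHS]v1.
by rewrite -u2 -[RHS]v2.
Qed.

Lemma extends_refl A A' (S : triple A A') : extends S S.
Proof. by exists (emb_id _); split=> -[t x]. Qed.

Section Two.
Variables (K K' : tree_of_Bsets C -> Prop).
Hypotheses (KF : forall N, K N -> finite_tb N) (KF' : forall N, K' N -> finite_tb N).

Lemma forth A A' (S : triple A A') (p : pt A) : union_of_chain K A -> extensible A' ->
  exists S', extends S S' /\ exists q, phi_tot (t_a S') q = p.
Proof.
move=> ch ri; have [N [c [k [fN [_ e] hq]]]] := embedding_through_chain (t_a S) p KF ch (t_fin S).
have [b [_ hb]] := ri _ _ k (t_fin S) fN (t_b S).
by exists (Triple fN c b); split=> //; exists k.
Qed.

Lemma back A A' (S : triple A A') (p : pt A') : union_of_chain K' A' -> extensible A ->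
  exists S', extends S S' /\ exists q, phi_tot (t_b S') q = p.
Proof.
move=> ch ri; have [N [c [k [fN [_ e] hq]]]] := embedding_through_chain (t_b S) p KF' ch (t_fin S).
have [b [_ hb]] := ri _ _ k (t_fin S) fN (t_a S).
by exists (Triple fN b c); split=> //; exists k.
Qed.

Lemma back_and_forth A A' (S0 : triple A A') :
  countable_tb A -> countable_tb A' -> union_of_chain K A -> union_of_chain K' A' ->
  extensible A -> extensible A' ->
  exists2 h : strong_embedding A A', isomorphism h & emb_eq (emb_comp h (t_a S0)) (t_b S0).
Proof.
move=> /pt_enum [e he] /pt_enum [e' he'] ch ch' ri ri'.
have nx i (S : triple A A') : exists S', [/\ extends S S',
    forall p, e i = Some p -> exists q, phi_tot (t_a S') q = p &
    forall p, e' i = Some p -> exists q, phi_tot (t_b S') q = p].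
  have [S1 [x1 h1]] : exists S', extends S S' /\
      forall p, e i = Some p -> exists q, phi_tot (t_a S') q = p.
    case: (e i) => [p|]; last by exists S; split=> //; exact: extends_refl.
    by have [S1 [x1 h1]] := forth S p ch ri'; exists S1; split=> // _ [<-].
  have [S2 [x2 h2]] : exists S', extends S1 S' /\
      forall p, e' i = Some p -> exists q, phi_tot (t_b S') q = p.
    case: (e' i) => [p|]; last by exists S1; split=> //; exact: extends_refl.
    by have [S2 [x2 h2]] := back S1 p ch' ri; exists S2; split=> // _ [<-].
  exists S2; split=> //; first exact: extends_trans x1 x2.
  move=> p /h1 [q <-]; have [u [u1 _]] := x2; exists (phi_tot u q); exact: u1.
pose S := fix S i := if i is i.+1 then projT1 (cid (nx i (S i))) else S0.
have SP i : [/\ extends (S i) (S i.+1),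
    forall p, e i = Some p -> exists q, phi_tot (t_a (S i.+1)) q = p &
    forall p, e' i = Some p -> exists q, phi_tot (t_b (S i.+1)) q = p].
  exact: projT2 (cid (nx i (S i))).
have [||h hh] := @glue_embeddings _ _ A A' (fun i => t_M (S i)) (fun i => t_a (S i)) (fun i => t_b (S i)).
- by move=> i; case: (SP i).
- by move=> p; have [i hi] := he p; case: (SP i) => _ /(_ _ hi) [q hq] _; exists i.+1, q.
have [||h' hh'] := @glue_embeddings _ _ A' A (fun i => t_M (S i)) (fun i => t_b (S i)) (fun i => t_a (S i)).
- by move=> i; case: (SP i) => -[u [u1 u2]] _ _; exists u.
- by move=> p; have [i hi] := he' p; case: (SP i) => _ _ /(_ _ hi) [q hq]; exists i.+1, q.
exists h; last exact: (hh 0%N).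
have E i q : phi_tot h (phi_tot (t_a (S i)) q) = phi_tot (t_b (S i)) q.
  by case: (hh i) => _; apply.
have E' i q : phi_tot h' (phi_tot (t_b (S i)) q) = phi_tot (t_a (S i)) q.
  by case: (hh' i) => _; apply.
apply: (inverse_iso (K' := h')) => p /=.
  have [i hi] := he p; case: (SP i) => _ /(_ _ hi) [q <-] _; by rewrite E E'.
have [i hi] := he' p; case: (SP i) => _ _ /(_ _ hi) [q <-]; by rewrite E' E.
Qed.

End Two.
End BackForth.

(** * Existence and uniqueness of the generic tree *)

Section Generic.
Context {d d' : Order.disp_t} {C : orderType d} {T : meetSemilatticeType d'}.
Variables (F : T -> C).
Hypotheses (TC : is_TC F) (Cc : countable [set: C]).

Lemma stage_finite (N : ctree (C := C) (nat * C)%type) : good N -> finite_tb (conv N).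
Proof.
move=> [LN nb]; apply: conv_finite.
- exact: (la_finP LN).
- exact: (la_finX LN).
- exact: (la_top LN).
- move=> t nt nr hs; apply: contrapT => n; apply: (nb t); split=> // s1 s2 l1 l2.
  by apply: contrapT => nc; apply: n; exists s1, s2.
Qed.

Lemma good_proper (N : @pst d C (nat * C) nat) : good N -> proper_pst N.
Proof.
move=> [LN _]; have W := lab_wptb LN; split.
- exact: (la_ptb LN).
- by move=> t; exact: (la_inh LN).
- move=> t s a h _; have [a' [x [y [z [h' [[b1 b2 b3] [n1 n2 n3]]]]]]] := la_ram LN (w_frlt W h).
  have e := w_freq W h' h; have H := w_preB W t.
  have ne w : ~ eqv N t a' w -> ~ eqv N t a w.
    by move=> n' e'; apply: n'; exact: (eqv_trans W e e').
  by exists x, y, z; split; split; try exact: (pb_congl H e); exact: ne.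
Qed.

(** The tree is read off the limit of the stages, and the trees read off the stages form the
    required chain. Countability of C allows all requests, which mention colours, to be put into one
    sequence. *)
Lemma generic_exists : exists A : tree_of_Bsets C,
  [/\ countable_tb A, union_of_chain (@finite_tb d C) A, extensible A, inhabited (node A) &
    forall M, finite_tb M -> inhabited (strong_embedding M A)].
Proof.
have [t0] := TC_inhabited TC.
have /countable_injP [fC hC] := Cc.
have [sched often] : exists s : nat -> request_data (C := C),
    forall q m, exists2 i, (m <= i)%N & s i = q.
  (* This colour only serves in the default request, for indices that code none. *)
  pose c : C := F t0.
  apply: (schedule ((0, ((0, c), (0, c)), (0, 0, 0), c) : request_data (C := C))
    (f := fun q : request_data => let: (ty, ((s1, s2), (t1, t2)), k, c) := q in
       pickle (ty, ((s1, fC s2), (t1, fC t2)), k, fC c))).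
  move=> [[[ty [[s1 s2] [t1 t2]]] k] c1] [[[ty' [[s1' s2'] [t1' t2']]] k'] c1'].
  have fi x y : fC x = fC y -> x = y by move=> /hC; rewrite !in_setT; apply.
  by move=> /(pcan_inj pickleK) [-> -> /fi -> -> /fi -> -> /fi ->].
have [N hN] := chain_ex (F t0) sched.
have gN i : good (N i) by case: (hN i).
have sN i : sub (N i) (N i.+1) by case: (hN i).
have sat i : granted (N i) (N i.+1) (sched i) by case: (hN i).
pose Tr i : ctree (nat * C)%type := Ctree (good_proper (gN i)).
pose L : ctree (nat * C)%type := Ctree (limit_proper gN sN).
have WL : wptb L := limit_wptb gN sN.
have LR : rich L := limit_rich gN sN often sat.
have [tL lL] : exists t, lt L (rt L) t := limit_top gN.
have rN i : exists r : node (conv (Tr i)), forall t, r <= t.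
  by have [] := stage_finite (N := Tr i) (gN i).
have inL i : exists k : strong_embedding (conv (Tr i)) (conv L),
    (forall t, val (tau k t) = val t) /\ forall t (y : cB (Tr i) (val t)),
    @isc _ _ _ L (val (tau k t)) (val y) (phi k t y).
  by have [r hr] := rN i; exact: (conv_incl (L1 := Tr i) (L2 := L) (stage_limit gN sN i) hr).
pose h i := projT1 (cid (inL i)).
have h1 i t : val (tau (h i) t) = val t by case: (projT2 (cid (inL i))).
have h2 i t (y : cB (Tr i) (val t)) : @isc _ _ _ L (val (tau (h i) t)) (val y) (phi (h i) t y).
  by case: (projT2 (cid (inL i))) => _; apply.
have hsub i j : (i <= j)%N -> sub_strong (h i) (h j).
  move=> ij; have [r hr] := rN i; have [e _] := chain_sub gN sN ij.
  have [k [k1 k2]] := conv_incl (L1 := Tr i) (L2 := Tr j) e hr; exists k.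
  have Wj : wptb (Tr j) by case: (gN j) => /lab_wptb.
  apply: emb_eq_phi => -[t y].
  have e1 := k2 t y; have [dx dy] := eqvD Wj e1.
  apply: (conv_pt_eqv (L := L) (x1 := val (phi k t y : cB (Tr j) (val (tau k t)))) (x2 := val (y : cB (Tr i) (val t)))).
  - by rewrite /= !h1 k1.
  - exact: h2.
  - exact: h2.
  - rewrite /= h1; apply: (eqv_sym WL).
    by exists j.
exists (conv L); split.
- apply: conv_countable; apply: (countable_inj (f := fun p : nat * C => (p.1, fC p.2))); last exact: countableP.
  by move=> [m x] [m' y] [-> /hC]; rewrite !in_setT => /(_ isT isT) ->.
- exists nat, (fun i => conv (Tr i)), h; split.
  + by move=> i; apply: stage_finite; exact: gN.
  + by move=> i j; case/orP: (leq_total i j) => ij; [left|right]; exact: hsub.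
  + move=> t; have [i nt] := cnd t.
    have ok : nd (Tr i) (val t) /\ val t <> rt (Tr i).
      by split=> // e; apply: (@cnrt _ _ _ L t); rewrite e; exact: (rtN gN sN i).
    by exists i, (mkn ok : node (conv (Tr i))); apply: val_inj; rewrite h1.
  + move=> [t y]; have [i dy] : D L (val t) (val (y : cB L (val t))) by exact: cB_D.
    have ok : nd (Tr i) (val t) /\ val t <> rt (Tr i).
      split; first by case: (gN i) => /lab_wptb W _; exact: (w_be W dy).
      by move=> e; apply: (@cnrt _ _ _ L t); rewrite e; exact: (rtN gN sN i).
    pose u : node (conv (Tr i)) := mkn ok.
    have [q hq] := @isc_ex _ _ _ (Tr i) (val u) _ dy.
    exists i, (existT _ u (q : tbB u)).
    apply: (conv_pt_eqv (L := L) (x1 := val q) (x2 := val (y : cB L (val t)))).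
    * by rewrite h1.
    * exact: (h2 i u q).
    * exact: isc_val.
    * by rewrite h1; apply: (eqv_sym WL); exists i.
- by move=> M E i fM fE k; exact: conv_rich.
- have hL : nd L tL /\ tL <> rt L.
    by split; [case: (w_nd WL lL.1)|case: lL => _ n e; apply: n].
  exact: inhabits (mkn hL).
- by move=> M fM; exact: conv_universal lL fM.
Qed.

End Generic.

Theorem theorem4p6 (d d' : Order.disp_t) (C : orderType d)
    (C_countable : countable [set: C])
    (C_noleast : ~ exists c : C, forall c' : C, c <= c')
    (T : meetSemilatticeType d') (F : T -> C) (TC : is_TC F) :
  exists2 A : tree_of_Bsets C,
    generic F A &
    forall A' : tree_of_Bsets C, generic F A' -> isomorphic A A'.
Proof.
have [A [ctA [I [M [h [fM tot nodes pts]]]] extA [t0] univ]] := generic_exists TC C_countable.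
have over N : finite_tb N -> finite_tb_over F N by exact: finite_over.
have chA : union_of_chain (finite_tb_over F) A.
  by exists I, M, h; split=> // i; apply/over/fM.
have Kf N : finite_tb_over F N -> finite_tb N by case.
exists A.
  split=> //.
  - by move=> N _; exact: over.
  - by move=> N [fN _]; exact: univ.
  - by move=> N E i [fN _] [fE _]; exact: extA.
  (* Homogeneity is back-and-forth from A to itself, started at the graph of the given
     isomorphism. *)
  - move=> N1 N2 i j f fN1 fN2 _.
    exact: (back_and_forth Kf Kf (Triple fN1 i (emb_comp j f)) ctA ctA chA chA extA extA).
(* For uniqueness the starting point is a member of the chain of A, embedded in A' by
   universality. *)
move=> A' gA'; have [i0 _] := nodes t0.
have [b] := generic_universal gA' (over _ (fM i0)).
have extA' : extensible A'.
  by move=> N E i fN fE; apply: (generic_rich gA'); exact: over.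
have [k ik _] := back_and_forth Kf Kf (Triple (fM i0) (h i0) b) ctA
  (generic_countable gA') chA (generic_chain gA') extA extA'.
by exists k.
Qed.
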